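(* Every topological group $G$ is isomorphic, as a topological group, to $\pi_1^{\tau}(Z)$ for some space $Z$ obtained from a generalized wedge of circles $\Sigma(X_+)$ (for a suitable space $X$) by attaching $2$-cells. Moreover, by further attaching cells of dimension greater than $2$ one obtains a space $Z'$ with $\pi_1^{\tau}(Z')\cong G$ as topological groups and $\pi_n^{\tau}(Z')$ trivial for all $n>1$.
   Context: For a based space $(Y,y_0)$, $\Omega(Y,y_0)$ is the loop space with the compact-open topology, and $\pi_1^{qtop}(Y,y_0)$ is $\pi_1(Y,y_0)$ with the quotient topology from $\Omega(Y,y_0)\to\pi_1(Y,y_0)$, $\alpha\mapsto[\alpha]$. $F_M(S)$ denotes the free (Markov) topological group on a space $S$. For a group with (arbitrary) topology $G$, $\tau(G)$ is $G$ with the quotient topology with respect to the multiplication epimorphism $m_G:F_M(G)\to G$ sending each generator $g$ to $g$. Set $\pi_1^{\tau}=\tau\circ\pi_1^{qtop}$ and $\pi_n^{\tau}(Y)=\pi_1^{\tau}(\Omega^{n-1}Y)$. The generalized wedge of circles on a space $X$ is $\Sigma(X_+)=X\times I/(X\times\{0,1\})$, based at the image of $X\times\{0,1\}$. *)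

(* Defs.v *)
From Stdlib Require Import Reals Lra.
From mathcomp Require Import all_boot.
From mathcomp Require Import boolp classical_sets.

Unset Strict Implicit.
Unset Printing Implicit Defensive.

Local Open Scope classical_set_scope.

Definition is_top {T : Type} (O : set (set T)) : Prop :=
  [/\ O setT,
      (forall U V, O U -> O V -> O (U `&` V)) &
      (forall F : set (set T), F `<=` O -> O (\bigcup_(U in F) U))].

Definition gen {T : Type} (B : set (set T)) : set (set T) :=
  fun U => forall O, is_top O -> B `<=` O -> O U.

Definition cont {A B : Type} (OA : set (set A)) (OB : set (set B)) (f : A -> B)
  : Prop := forall V, OB V -> OA (f @^-1` V).

Definition prod_opens {A B : Type} (OA : set (set A)) (OB : set (set B))
  : set (set (A * B)) :=
  gen (fun W => exists U V, [/\ OA U, OB V & W = U `*` V]).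

Definition homeo {A B : Type} (OA : set (set A)) (OB : set (set B)) (h : A -> B)
  : Prop := exists g : B -> A, [/\ cancel h g, cancel g h, cont OA OB h &
                                   cont OB OA g].

Record space := Space { car :> Type; sopens : set (set car) }.
Record pspace := PSpace { pcar :> Type; popens : set (set pcar); base : pcar }.
Arguments sopens : clear implicits.
Arguments popens : clear implicits.
Arguments base : clear implicits.

Definition I := {t : R | Rle R0 t /\ Rle t R1}.
Definition opI : set (set I) := fun U =>
  forall x, U x -> exists2 eps, Rlt R0 eps &
    forall y : I, Rlt (Rabs (Rminus (proj1_sig y) (proj1_sig x))) eps -> U y.

Lemma I0_proof : Rle R0 R0 /\ Rle R0 R1.
Proof. split; lra. Qed.
Lemma I1_proof : Rle R0 R1 /\ Rle R1 R1.
Proof. split; lra. Qed.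
Definition I0 : I := exist _ R0 I0_proof.
Definition I1 : I := exist _ R1 I1_proof.

Lemma clamp_proof (x : R) : Rle R0 (Rmax R0 (Rmin R1 x)) /\ Rle (Rmax R0 (Rmin R1 x)) R1.
Proof.
split; [apply Rmax_l|]. apply Rmax_lub; [lra|apply Rmin_l].
Qed.
Definition clampI (x : R) : I := exist _ (Rmax R0 (Rmin R1 x)) (clamp_proof x).

Definition Iopen := {t : R | Rlt R0 t /\ Rlt t R1}.

Definition sumsq {k : nat} (x : 'I_k -> R) : R := \big[Rplus/R0]_(i < k) Rmult (x i) (x i).

Definition disk (k : nat) := {x : 'I_k -> R | Rle (sumsq x) R1}.
Definition ball (k : nat) := {x : 'I_k -> R | Rlt (sumsq x) R1}.
Definition sphere (k : nat) := {x : 'I_k -> R | sumsq x = R1}.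

Definition opRk {k : nat} (P : ('I_k -> R) -> Prop) : set (set {z | P z}) :=
  fun U => forall x : {z | P z}, U x -> exists2 eps, Rlt R0 eps &
    forall y : {z | P z},
      (forall i, Rlt (Rabs (Rminus (proj1_sig y i) (proj1_sig x i))) eps) -> U y.

Definition opD (k : nat) : set (set (disk k)) := @opRk k (fun x : 'I_k -> R => Rle (sumsq x) R1).
Definition opS (k : nat) : set (set (sphere k)) := @opRk k (fun x : 'I_k -> R => sumsq x = R1).
Arguments opD : clear implicits.
Arguments opS : clear implicits.

(** * Quotient constructions (carriers are sets of normal forms) *)

(** generalized wedge of circles Sigma(X_+) = X x I / (X x {0,1}):
    None is the collapsed point, Some (x,t) the class of (x,t), 0<t<1. *)
Definition susp_r {X : space} (p : (X * I)%type) : option (X * Iopen)%type :=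
  match Rlt_dec R0 (proj1_sig p.2), Rlt_dec (proj1_sig p.2) R1 with
  | left h0, left h1 => Some (p.1, exist _ (proj1_sig p.2) (conj h0 h1))
  | _, _ => None
  end.

Definition susp (X : space) : pspace :=
  @PSpace (option (X * Iopen)%type)
    (fun V => prod_opens (sopens X) opI (@susp_r X @^-1` V)) None.

(** attaching k-cells (indexed by J, along phi : J -> S^(k-1) -> A) to A:
    the adjunction space (A + J x D^k)/(b ~ phi j b, b in S^(k-1)),
    carrier A + J x (open disk). *)
Lemma sphere_of_disk_proof {k : nat} {x : 'I_k -> R} :
  Rle (sumsq x) R1 -> ~ Rlt (sumsq x) R1 -> sumsq x = R1.
Proof. move=> h1 h2; apply Rle_antisym => //; exact: Rnot_lt_le. Qed.

Definition attach_r {A : pspace} {k : nat} {J : Type} (phi : J -> sphere k -> A)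
  (u : A + (J * disk k)) : A + (J * ball k) :=
  match u with
  | inl a => inl a
  | inr (j, x) =>
    match Rlt_dec (sumsq (proj1_sig x)) R1 with
    | left h => inr (j, exist _ (proj1_sig x) h)
    | right h => inl (phi j (exist _ (proj1_sig x)
                               (sphere_of_disk_proof (proj2_sig x) h)))
    end
  end.

Definition sum_opens (A : pspace) (k : nat) (J : Type)
  : set (set (A + (J * disk k))) :=
  fun U => popens A (inl @^-1` U) /\
           forall j, opD k (fun x => U (inr (j, x))).

Definition attach {A : pspace} {k : nat} {J : Type} (phi : J -> sphere k -> A)
  : pspace :=
  @PSpace (A + (J * ball k))
    (fun V => @sum_opens A k J (attach_r phi @^-1` V)) (inl (base A)).

Definition cell_attachment {A B : pspace} (i : A -> B) (k : nat) : Prop :=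
  exists (J : Type) (phi : J -> sphere k -> A),
    (forall j, cont (opS k) (popens A) (phi j)) /\
    exists h : B -> attach phi,
      [/\ homeo (popens B) (popens (attach phi)) h,
          forall a, h (i a) = inl a & i (base A) = base B].

Definition is_colimit {Zs : nat -> pspace} (incl : forall n, Zs n -> Zs n.+1)
  {Z' : pspace} (iota : forall n, Zs n -> Z') : Prop :=
  [/\ forall n z, iota n.+1 (incl n z) = iota n z,
      forall n, injective (iota n),
      forall w : Z', exists n (z : Zs n), iota n z = w,
      iota 0 (base (Zs 0)) = base Z' &
      forall U, popens Z' U <-> forall n, popens (Zs n) (iota n @^-1` U)].

Definition is_loop {Y : pspace} (f : I -> Y) : Prop :=
  [/\ cont opI (popens Y) f, f I0 = base Y & f I1 = base Y].

Definition loop (Y : pspace) := {f : I -> Y | is_loop f}.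

Lemma const_loop_proof (Y : pspace) : is_loop (fun _ : I => base Y).
Proof.
split=> // V HV x Hx; exists R1; [lra|] => y _; exact: Hx.
Qed.
Definition const_loop (Y : pspace) : loop Y := exist _ _ (const_loop_proof Y).

Definition compactI (K : set I) : Prop :=
  forall F : set (set I), F `<=` opI -> K `<=` \bigcup_(U in F) U ->
    exists s : seq (set I), List.Forall F s /\
      K `<=` \bigcup_(U in [set U | List.In U s]) U.

Definition co_opens (Y : pspace) : set (set (loop Y)) :=
  gen (fun W => exists K U, [/\ compactI K, popens Y U &
         W = [set f : loop Y | forall t, K t -> U (proj1_sig f t)]]).

Definition Omega (Y : pspace) : pspace :=
  @PSpace (loop Y) (co_opens Y) (const_loop Y).

Definition concat {Y : pspace} (a b : loop Y) (t : I) : Y :=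
  if Rle_dec (proj1_sig t) (Rdiv R1 (Rplus R1 R1))
  then proj1_sig a (clampI (Rmult (Rplus R1 R1) (proj1_sig t)))
  else proj1_sig b (clampI (Rminus (Rmult (Rplus R1 R1) (proj1_sig t)) R1)).

Definition homotopic {Y : pspace} (a b : loop Y) : Prop :=
  exists H : I * I -> Y,
    [/\ cont (prod_opens opI opI) (popens Y) H,
        forall s, H (s, I0) = proj1_sig a s,
        forall s, H (s, I1) = proj1_sig b s &
        forall t, H (I0, t) = base Y /\ H (I1, t) = base Y].

Definition pi1_trivial (Y : pspace) : Prop :=
  forall a : loop Y, homotopic a (const_loop Y).

Definition is_group {G : Type} (mul : G -> G -> G) (inv : G -> G) (e : G) : Prop :=
  [/\ forall x y z, mul x (mul y z) = mul (mul x y) z,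
      forall x, mul e x = x, forall x, mul x e = x,
      forall x, mul (inv x) x = e & forall x, mul x (inv x) = e].

Definition is_group_top {G : Type} (O : set (set G)) (mul : G -> G -> G)
  (inv : G -> G) : Prop :=
  [/\ is_top O, cont (prod_opens O O) O (fun p => mul p.1 p.2) & cont O O inv].

Definition is_topgroup {G : Type} (O : set (set G)) (mul : G -> G -> G)
  (inv : G -> G) (e : G) : Prop := is_group mul inv e /\ is_group_top O mul inv.

Section FreeGroup.
Variable S : Type.

(** a letter (true, x) stands for x, (false, x) for x^-1 *)
Definition letter := (bool * S)%type.
Definition cancels (a b : letter) : Prop := b.2 = a.2 /\ b.1 = ~~ a.1.

Fixpoint reduced (w : seq letter) : Prop :=
  match w with
  | a :: ((b :: _) as w') => ~ cancels a b /\ reduced w'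
  | _ => True
  end.

Definition push (a : letter) (w : seq letter) : seq letter :=
  match w with
  | b :: w' => if asbool (cancels a b) then w' else a :: w
  | [::] => [:: a]
  end.

Definition reduce (w : seq letter) : seq letter := foldr push [::] w.

Lemma reduced_behead w : reduced w -> reduced (behead w).
Proof. by case: w => [|a [|b w]] //= []. Qed.

Lemma push_reduced a w : reduced w -> reduced (push a w).
Proof.
case: w => [|b w] //= Hw.
case: asboolP => H; first exact: (reduced_behead (b :: w)).
by split.
Qed.

Lemma reduce_reduced w : reduced (reduce w).
Proof. elim: w => [|a w IH] //=; exact: push_reduced. Qed.

Definition FG := {w : seq letter | reduced w}.


Definition FG_mul (u v : FG) : FG :=
  exist _ (reduce (proj1_sig u ++ proj1_sig v)) (reduce_reduced _).
Definition FG_inv (u : FG) : FG :=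
  exist _ (reduce (rev (map (fun a : letter => (~~ a.1, a.2)) (proj1_sig u))))
    (reduce_reduced _).
Definition FG_of (x : S) : FG := exist _ [:: (true, x)] Logic.I.

(** topology of the free (Markov) topological group F_M(S): the finest group
    topology on F(S) for which the generator map S -> F(S) is continuous *)
Definition FM_opens (OS : set (set S)) : set (set FG) :=
  gen (fun V => exists O, [/\ is_group_top O FG_mul FG_inv,
                              cont OS O FG_of & O V]).
End FreeGroup.

Definition mG {G : Type} (mul : G -> G -> G) (inv : G -> G) (e : G)
  (w : FG G) : G :=
  foldr (fun a acc => mul (if a.1 then a.2 else inv a.2) acc) e (proj1_sig w).

Definition tau_opens {G : Type} (mul : G -> G -> G) (inv : G -> G) (e : G)
  (OG : set (set G)) : set (set G) :=
  fun U => FM_opens G OG (mG mul inv e @^-1` U).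

(** pi_1^tau(Y, y0) is isomorphic, as a topological group, to (G, OG):
    h induces a bijection pi_1(Y,y0) -> G which is a group homomorphism, and,
    transporting the quotient topology of pi_1^qtop along this bijection, tau of
    the resulting (quasitopological) group is exactly the topology OG. *)
Definition pi1tau_iso (Y : pspace) {G : Type} (OG : set (set G))
  (mul : G -> G -> G) (inv : G -> G) (e : G) : Prop :=
  exists h : loop Y -> G,
    [/\ forall g, exists a, h a = g,
        forall a b, h a = h b <-> homotopic a b,
        forall a b c, (forall t, proj1_sig c t = concat a b t) ->
                      h c = mul (h a) (h b) &
        forall U, OG U <->
          tau_opens mul inv e (fun V => popens (Omega Y) (h @^-1` V)) U].

(* Main.v *)
(* Realise G as a quotient q : X -> G of a totally path-disconnected space X.  Over
   susp X there is a G-bundle, flat along paths, whose holonomy around the circle of x is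
   q x; its transition functions are continuous for the topology of G, so holonomy is
   continuous on the loop space.  Attach, in stage n,
   a cell of dimension n + 2 along every continuous map of S^(n+1) along which the bundle is
   trivial: the bundle extends over these cells.  A k-cube can be pushed off all cells of
   dimension > k, so every loop deforms into susp X, where two loops with the same
   holonomy become homotopic through a 2-cell, and every k-sphere (k > 1) deforms into stage
   k - 1, where it bounds a (k + 1)-cell.  Hence holonomy induces pi_1 = G.  The circles give a
   continuous X -> Omega lifting the quotient map q, so pi_1^qtop already carries the topology
   of G, and tau changes nothing. *)

Require Import Defs.
From Stdlib Require Import Reals Lra Eqdep_dec.
From mathcomp Require Import all_boot.
From mathcomp Require Import boolp classical_sets.

#[local] Obligation Tactic := idtac.

(** * Topology and continuity *)

Section Topology.
Local Open Scope classical_set_scope.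

(** The two conditions on transition functions share the work. Constancy along paths gives path
    lifting, its uniqueness and homotopy invariance of holonomy; continuity for [OG] gives
    continuity of holonomy on the loop space. On [susp X] the transition function is q itself, so q
    must be constant along paths; G may contain nonconstant paths, hence the passage to X. Cells are
    attached along all admissible maps at once, so no generators or relations are selected, and
    extending the bundle over a cell takes only a lift over its attaching sphere. No separation
    axiom is assumed, and the spaces carry quotient and union topologies. Homotopies are therefore
    controlled by compactness of I and of cubes: the tube lemma handles products with I, and a cube
    meets cells of boundedly many stages only. With one dimension per stage, pushing a cube off
    cells concerns a single attachment at a time, and the same tower is the filtration of the final
    space. *)

Lemma gen_top {T} (B : set (set T)) : is_top (gen B).
Proof.
split.
- by move=> O [].
- by move=> U V hU hV O hO hB; case: (hO) => _ h _; apply: h; [exact: hU|exact: hV].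
- move=> F hF O hO hB; case: (hO) => _ _ h; apply: h => U /hF; exact.
Qed.

Lemma sub_gen {T} (B : set (set T)) : B `<=` gen B.
Proof. by move=> U hU O _; apply. Qed.

Lemma top_local {T} {O : set (set T)} (U : set T) : is_top O ->
  (forall x, U x -> exists V, [/\ O V, V x & V `<=` U]) -> O U.
Proof.
move=> [_ _ h] hU.
have -> : U = \bigcup_(V in [set V | O V /\ V `<=` U]) V.
  apply/seteqP; split=> [x /hU [V [? ? ?]]|x [V [_]]]; last exact.
  by exists V.
by apply: h => V [].
Qed.

Lemma prod_opensP {A B} (OA : set (set A)) (OB : set (set B)) (W : set (A * B)) :
  is_top OA -> is_top OB ->
  prod_opens OA OB W <->
  forall a b, W (a, b) -> exists U V, [/\ OA U, OB V, U a, V b &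
    forall a' b', U a' -> V b' -> W (a', b')].
Proof.
move=> tA tB; split; last first.
  move=> hW; apply: top_local => [|[a b] /hW [U [V [hU hV Ua Vb s]]]]; first exact: gen_top.
  exists (U `*` V); split=> //; last by move=> [a' b'] [/=]; exact: s.
  by apply: sub_gen; exists U, V.
move=> hW; apply: (hW [set W' : set (A * B) | forall a b, W' (a, b) -> exists U V,
  [/\ OA U, OB V, U a, V b & forall a' b', U a' -> V b' -> W' (a', b')]]).
  case: tA tB => [tA1 tA2 _] [tB1 tB2 _]; split.
  - by move=> a b _; exists setT, setT.
  - move=> W1 W2 h h' a b [/h [U [V [hU hV Ua Vb s]]] /h' [U' [V' [hU' hV' Ua' Vb' s']]]].
    exists (U `&` U'), (V `&` V'); split; [exact: tA2|exact: tB2|by []|by []|].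
    by move=> a' b' [? ?] [? ?]; split; [apply: s|apply: s'].
  - move=> F hF a b [W1 FW /(hF _ FW) [U [V [hU hV Ua Vb s]]]].
    by exists U, V; split=> // a' b' ? ?; exists W1 => //; apply: s.
by move=> _ [U [V [hU hV ->]]] a b [/= Ua Vb]; exists U, V.
Qed.

Lemma prod_opens_top {A B} (OA : set (set A)) (OB : set (set B)) :
  is_top (prod_opens OA OB).
Proof. exact: gen_top. Qed.

Lemma contP {A B} (OA : set (set A)) (OB : set (set B)) (f : A -> B) : is_top OA ->
  cont OA OB f <-> forall a V, OB V -> V (f a) ->
    exists U, [/\ OA U, U a & forall x, U x -> V (f x)].
Proof.
move=> tA; split=> [h a V hV Va|h V hV]; first by exists (f @^-1` V); split=> //; apply: h.
by apply: top_local => // a /(h _ _ hV) [U [? ? ?]]; exists U.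
Qed.

Lemma cont_comp {A B C} (OA : set (set A)) (OB : set (set B)) (OC : set (set C)) f g :
  cont OA OB f -> cont OB OC g -> cont OA OC (fun x => g (f x)).
Proof. by move=> hf hg V /hg /hf. Qed.

Lemma cont_gen {A B} (OA : set (set A)) (S : set (set B)) f : is_top OA ->
  (forall V, S V -> OA (f @^-1` V)) -> cont OA (gen S) f.
Proof.
move=> [t1 t2 t3] h V hV; apply: (hV [set V0 | OA (f @^-1` V0)]); last exact: h.
split=> // [U U' hU hU'|F hF]; first exact: t2.
rewrite /=.
have -> : f @^-1` (\bigcup_(U in F) U) =
    \bigcup_(W in [set W | exists2 U, F U & W = f @^-1` U]) W.
  apply/seteqP; split=> [x [U FU Ux]|x [_ [U FU ->] ?]]; last by exists U.
  by exists (f @^-1` U) => //; exists U.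
by apply: t3 => _ [U FU ->]; apply: hF.
Qed.

Lemma cont_pair {A B C} (OA : set (set A)) (OB : set (set B)) (OC : set (set C)) f g :
  is_top OA -> cont OA OB f -> cont OA OC g ->
  cont OA (prod_opens OB OC) (fun x => (f x, g x)).
Proof.
move=> tA hf hg; apply: cont_gen => // _ [U [V [hU hV ->]]].
by case: (tA) => _ h _; apply: (h _ _ (hf _ hU) (hg _ hV)).
Qed.

Lemma cont_fst {A B} (OA : set (set A)) (OB : set (set B)) : is_top OB ->
  cont (prod_opens OA OB) OA fst.
Proof.
move=> [tB _ _] U hU; apply: sub_gen; exists U, setT; split=> //.
by apply/seteqP; split=> [[a b] ?|[a b] []].
Qed.

Lemma cont_const {A B} (OA : set (set A)) (OB : set (set B)) b : is_top OA ->
  cont OA OB (fun=> b).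
Proof.
move=> tA; apply/contP => // a V _ Vb; case: tA => tA _ _.
by exists setT.
Qed.

End Topology.

(** * Topologies given by balls, and continuity by epsilon and delta *)

Section Metric.
Local Open Scope R_scope.
Local Open Scope classical_set_scope.

(* bl x e y: y lies in the open ball of radius e around x. *)
Record mspace := MSpace {
  mcar :> Type;
  bl : mcar -> R -> mcar -> Prop;
  bl_refl : forall x e, 0 < e -> bl x e x;
  bl_mono : forall x e e' y, e <= e' -> bl x e y -> bl x e' y;
  bl_open : forall x e y, bl x e y ->
    exists2 e', 0 < e' & forall z, bl y e' z -> bl x e z }.
Arguments bl {m}.

Definition mopen (K : mspace) : set (set K) := fun U => forall x, U x ->
  exists2 e, 0 < e & forall y : K, bl x e y -> U y.

Lemma Rmin_gt0 a b : 0 < a -> 0 < b -> 0 < Rmin a b.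
Proof. by move=> ? ?; apply: Rmin_glb_lt. Qed.

Lemma mopen_top K : is_top (mopen K).
Proof.
split.
- by move=> x _; exists 1; [lra|].
- move=> U V hU hV x [/hU [e e0 h] /hV [e' e0' h']].
  exists (Rmin e e'); first exact: Rmin_gt0.
  move=> y hy; split; [apply: h|apply: h']; apply: bl_mono hy; [exact: Rmin_l|exact: Rmin_r].
- move=> F hF x [U FU /(hF _ FU) [e e0 h]]; exists e => // y /h ?; by exists U.
Qed.

Lemma mopen_bl (K : mspace) (x : K) e : mopen K (bl x e).
Proof. by move=> y /bl_open. Qed.

Definition mcts {K K' : mspace} (f : K -> K') := forall x e, 0 < e ->
  exists2 d, 0 < d & forall y, bl x d y -> bl (f x) e (f y).

Lemma mctsP {K K' : mspace} (f : K -> K') : mcts f <-> cont (mopen K) (mopen K') f.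
Proof.
split=> [h V hV x Vx|h x e e0].
  have [e e0 he] := hV _ Vx; have [d d0 hd] := h x e e0.
  by exists d => // y /hd /he.
exact: (h _ (mopen_bl K' (f x) e) x (bl_refl K' _ _ e0)).
Qed.

Lemma mcts_cont {K K' : mspace} (f : K -> K') : mcts f -> cont (mopen K) (mopen K') f.
Proof. by move/mctsP. Qed.

Lemma mcts_id {K : mspace} : mcts (fun x : K => x).
Proof. by move=> x e e0; exists e. Qed.

Lemma mcts_comp {K K' K'' : mspace} (f : K -> K') (g : K' -> K'') :
  mcts f -> mcts g -> mcts (fun x => g (f x)).
Proof. by move=> /mctsP hf /mctsP hg; apply/mctsP; apply: cont_comp hf hg. Qed.

Lemma mcts_const {K K' : mspace} (c : K') : mcts (fun _ : K => c).
Proof. by move=> x e e0; exists 1; [lra|move=> y _; exact: bl_refl]. Qed.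

Program Definition mprod (K K' : mspace) := @MSpace (K * K')%type
  (fun x e y => bl x.1 e y.1 /\ bl x.2 e y.2) _ _ _.
Next Obligation. by move=> K K' x e e0; split; apply: bl_refl. Qed.
Next Obligation. by move=> K K' x e e' y /= h [? ?]; split; apply: bl_mono h _. Qed.
Next Obligation.
move=> K K' x e y /= [/bl_open [a a0 ha] /bl_open [b b0 hb]].
exists (Rmin a b); first exact: Rmin_gt0.
move=> z [h h']; split; [apply: ha|apply: hb].
  by apply: bl_mono h; exact: Rmin_l.
by apply: bl_mono h'; exact: Rmin_r.
Qed.

(** An equality of topologies, so that continuity proved with balls rewrites into the product
    topology in which homotopies are defined. *)
Lemma mopen_prod K K' : mopen (mprod K K') = prod_opens (mopen K) (mopen K').
Proof.
apply/seteqP; split=> W; rewrite prod_opensP; try exact: mopen_top.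
  move=> hW a b /hW [e e0 h]; exists (bl a e), (bl b e).
  by split=> // *; [exact: mopen_bl|exact: mopen_bl|exact: bl_refl|exact: bl_refl|exact: h].
move=> hW [a b] /hW [U [V [hU hV /hU [e e0 he] /hV [d d0 hd] s]]].
exists (Rmin e d); first exact: Rmin_gt0.
move=> [a' b'] [/= h h']; apply: s; [apply: he|apply: hd].
  by apply: bl_mono h; exact: Rmin_l.
by apply: bl_mono h'; exact: Rmin_r.
Qed.

Lemma mcts_pair {K K1 K2 : mspace} (f : K -> K1) (g : K -> K2) : mcts f -> mcts g ->
  @mcts K (mprod K1 K2) (fun x => (f x, g x)).
Proof.
move=> hf hg x e e0; have [a a0 ha] := hf x e e0; have [b b0 hb] := hg x e e0.
exists (Rmin a b); first exact: Rmin_gt0.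
move=> y hy; split; [apply: ha|apply: hb]; apply: bl_mono hy; [exact: Rmin_l|exact: Rmin_r].
Qed.

Lemma mcts_fst {K K' : mspace} : @mcts (mprod K K') K fst.
Proof. by move=> x e e0; exists e => // y []. Qed.

Lemma mcts_snd {K K' : mspace} : @mcts (mprod K K') K' snd.
Proof. by move=> x e e0; exists e => // y []. Qed.

Lemma Rabs_open (x e y : R) : Rabs (y - x) < e ->
  exists2 e', 0 < e' & forall z, Rabs (z - y) < e' -> Rabs (z - x) < e.
Proof.
move=> h; exists (e - Rabs (y - x)); first lra.
move=> z hz; have := Rabs_triang (z - y) (y - x).
replace (z - y + (y - x)) with (z - x) by lra; lra.
Qed.

Program Definition mR := @MSpace R (fun x e y => Rabs (y - x) < e) _ _ _.
Next Obligation. move=> x e e0 /=; by rewrite Rminus_diag Rabs_R0. Qed.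
Next Obligation. move=> x e e' y /= ? ?; lra. Qed.
Next Obligation. exact: Rabs_open. Qed.

Program Definition mI := @MSpace I (fun x e y => Rabs (proj1_sig y - proj1_sig x) < e) _ _ _.
Next Obligation. move=> x e e0 /=; by rewrite Rminus_diag Rabs_R0. Qed.
Next Obligation. move=> x e e' y /= ? ?; lra. Qed.
Next Obligation.
move=> x e y /= /Rabs_open [d d0 h]; by exists d => // z; exact: h.
Qed.

Lemma fin_eps (T : finType) (Q : T -> R -> Prop) :
  (forall i, exists2 e, 0 < e & forall e', 0 < e' <= e -> Q i e') ->
  exists2 e, 0 < e & forall e', 0 < e' <= e -> forall i, Q i e'.
Proof.
move=> h.
suff [e e0 he] : exists2 e, 0 < e & forall e', 0 < e' <= e ->
    forall i, i \in enum T -> Q i e'.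
  by exists e => // e' he' i; apply: he; rewrite ?mem_enum.
elim: (enum T) => [|i s [e e0 he]]; first by exists 1; [lra|].
have [d d0 hd] := h i; exists (Rmin d e); first exact: Rmin_gt0.
move=> e' he' j; have := Rmin_l d e; have := Rmin_r d e => ? ?.
rewrite inE => /orP[/eqP ->|js]; first by apply: hd; lra.
by apply: he => //; lra.
Qed.

(** Coordinatewise balls are chosen so that [mopen (mRk P)] unfolds to [opRk P]: the disk and sphere
    topologies are instances by computation. *)
Program Definition mRk {k} (P : ('I_k -> R) -> Prop) := @MSpace {z | P z}
  (fun x e y => forall i, Rabs (proj1_sig y i - proj1_sig x i) < e) _ _ _.
Next Obligation. move=> k P x e e0 i /=; by rewrite Rminus_diag Rabs_R0. Qed.
Next Obligation. move=> k P x e e' y /= h h' i; have := h' i; lra. Qed.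
Next Obligation.
move=> k P x e y /= h.
have [i|d d0 hd] := @fin_eps 'I_k (fun i d => forall z, Rabs (z - proj1_sig y i) < d ->
  Rabs (z - proj1_sig x i) < e).
  have [d d0 hd] := Rabs_open _ _ _ (h i); exists d => // e' ? z hz; apply: hd; lra.
exists d => // z hz i; apply: (hd d) => //; lra.
Qed.

Lemma opI_top : is_top opI. Proof. exact: (mopen_top mI). Qed.

Lemma mcts_Rk {K : mspace} {k} {P : ('I_k -> R) -> Prop} (f : K -> {z | P z}) :
  (forall i, @mcts K mR (fun x => proj1_sig (f x) i)) -> @mcts K (mRk P) f.
Proof.
move=> h x e e0.
have [i|d d0 hd] := @fin_eps 'I_k (fun i d => forall y, bl x d y ->
  Rabs (proj1_sig (f y) i - proj1_sig (f x) i) < e).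
  have [d d0 hd] := h i x e e0; exists d => // d' hd' y hy; apply: hd.
  apply: bl_mono hy; lra.
by exists d => // y hy i; apply: (hd d) => //; lra.
Qed.

Lemma mcts_coord {k} {P : ('I_k -> R) -> Prop} i :
  @mcts (mRk P) mR (fun x => proj1_sig x i).
Proof. by move=> x e e0; exists e => // y; exact. Qed.

Lemma mcts_I {K : mspace} (f : K -> I) :
  @mcts K mR (fun x => proj1_sig (f x)) -> @mcts K mI f.
Proof. by []. Qed.

Lemma mcts_val : @mcts mI mR (fun x => proj1_sig x).
Proof. by move=> x e e0; exists e. Qed.

Section RealFun.
Context {K : mspace}.
Implicit Types f g : K -> R.
Notation rcts := (@mcts K mR).

Lemma rcts_fun (p : R -> R) f : (forall x, continuity_pt p (f x)) -> rcts f ->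
  rcts (fun x => p (f x)).
Proof.
move=> hp hf x e e0; have [a [a0 ha]] := hp x e e0; have [d d0 hd] := hf x a a0.
exists d => // y /hd /= h; case: (Req_dec (f x) (f y)) => [->|ne].
  by rewrite Rminus_diag Rabs_R0.
by apply: ha.
Qed.

Let continuity_pt_id x : continuity_pt id x.
Proof. exact: derivable_continuous_pt (derivable_pt_id x). Qed.

Lemma rcts_add f g : rcts f -> rcts g -> rcts (fun x => f x + g x).
Proof.
move=> hf hg x e e0; have e2 : 0 < e / 2 by lra.
have [a a0 ha] := hf x _ e2; have [b b0 hb] := hg x _ e2.
exists (Rmin a b); first exact: Rmin_gt0.
move=> y hy; have := ha y (bl_mono _ _ _ _ _ (Rmin_l _ _) hy).
have := hb y (bl_mono _ _ _ _ _ (Rmin_r _ _) hy) => /= h1 h2.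
have := Rabs_triang (f y - f x) (g y - g x).
replace (f y - f x + (g y - g x)) with (f y + g y - (f x + g x)) by lra; lra.
Qed.

Lemma rcts_opp f : rcts f -> rcts (fun x => - f x).
Proof. by apply: rcts_fun => x; apply: continuity_pt_opp; apply: continuity_pt_id. Qed.

Lemma rcts_sub f g : rcts f -> rcts g -> rcts (fun x => f x - g x).
Proof. by move=> hf hg; apply: rcts_add hf (rcts_opp _ hg). Qed.

Lemma rcts_scal c f : rcts f -> rcts (fun x => c * f x).
Proof.
apply: rcts_fun => x; apply: (continuity_pt_mult (fun=> c) id).
  exact: continuity_pt_const.
exact: continuity_pt_id.
Qed.

(** Polarisation reduces the product to squaring, a function of one real variable covered by
    [rcts_fun]. *)
Lemma rcts_mul f g : rcts f -> rcts g -> rcts (fun x => f x * g x).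
Proof.
move=> hf hg.
have sq u : rcts u -> rcts (fun x => u x * u x).
  apply: (rcts_fun (fun t => t * t)) => x.
  by apply: continuity_pt_mult; apply: continuity_pt_id.
have -> : (fun x => f x * g x) =
  (fun x => / 4 * ((f x + g x) * (f x + g x) - (f x - g x) * (f x - g x))).
  by apply/funext => x; lra.
apply: rcts_scal; apply: rcts_sub; apply: sq; [exact: rcts_add|exact: rcts_sub].
Qed.

Lemma rcts_inv f : (forall x, f x <> 0) -> rcts f -> rcts (fun x => / f x).
Proof.
move=> h; apply: rcts_fun => x; apply: (continuity_pt_inv id) (h x).
exact: continuity_pt_id.
Qed.

Lemma rcts_div f g : (forall x, g x <> 0) -> rcts f -> rcts g -> rcts (fun x => f x / g x).
Proof. by move=> h hf hg; apply: rcts_mul hf (rcts_inv _ h hg). Qed.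

Lemma rcts_abs f : rcts f -> rcts (fun x => Rabs (f x)).
Proof. by apply: rcts_fun => x; apply: Rcontinuity_abs. Qed.

Lemma rcts_max f g : rcts f -> rcts g -> rcts (fun x => Rmax (f x) (g x)).
Proof.
move=> hf hg.
have -> : (fun x => Rmax (f x) (g x)) = (fun x => / 2 * (f x + g x + Rabs (f x - g x))).
  by apply/funext => x; rewrite /Rmax /Rabs; case: Rle_dec; case: Rcase_abs; lra.
apply: rcts_scal; apply: rcts_add; [exact: rcts_add|apply: rcts_abs; exact: rcts_sub].
Qed.

Lemma rcts_min f g : rcts f -> rcts g -> rcts (fun x => Rmin (f x) (g x)).
Proof.
move=> hf hg.
have -> : (fun x => Rmin (f x) (g x)) = (fun x => - Rmax (- f x) (- g x)).
  by apply/funext => x; rewrite /Rmax /Rmin; do 2 case: Rle_dec; lra.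
by apply: rcts_opp; apply: rcts_max; apply: rcts_opp.
Qed.

Lemma rcts_sqrt f : (forall x, 0 <= f x) -> rcts f -> rcts (fun x => sqrt (f x)).
Proof. by move=> h; apply: rcts_fun => x; apply: continuity_pt_sqrt. Qed.

Lemma rcts_big (op : R -> R -> R) idx {k} (f : 'I_k -> K -> R) :
  (forall f g, rcts f -> rcts g -> rcts (fun x => op (f x) (g x))) ->
  (forall i, rcts (f i)) -> rcts (fun x => \big[op/idx]_(i < k) f i x).
Proof.
move=> hop hf; elim: (index_enum _) => [|i s IH].
  have -> : (fun x => \big[op/idx]_(i <- [::]) f i x) = fun=> idx.
    by apply/funext => x; rewrite big_nil.
  exact: mcts_const.
have -> : (fun x => \big[op/idx]_(j <- i :: s) f j x) =
    fun x => op (f i x) (\big[op/idx]_(j <- s) f j x).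
  by apply/funext => x; rewrite big_cons.
exact: hop.
Qed.

Lemma mcts_clampI f : rcts f -> @mcts K mI (fun x => clampI (f x)).
Proof.
move=> hf; apply: mcts_I => /=.
by apply: rcts_max; [exact: mcts_const|apply: rcts_min => //; exact: mcts_const].
Qed.

End RealFun.
End Metric.
Arguments bl {m}.

(** * Induction on boxes and compactness *)

Section Induction.
Local Open Scope R_scope.

(** Real induction: the supremum of all t with [P a t] is attained and cannot lie below b. The local
    hypothesis includes degenerate intervals, which gives the start [P a a]. *)
Lemma interval_ind (P : R -> R -> Prop) a b : a <= b ->
  (forall x, a <= x <= b -> exists2 e, 0 < e & forall s t, x - e < s -> t < x + e ->
     a <= s -> s <= t -> t <= b -> P s t) ->
  (forall s m t, a <= s <= m -> m <= t <= b -> P s m -> P m t -> P s t) ->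
  P a b.
Proof.
move=> ab loc glue.
pose S t := (a <= t <= b) /\ P a t.
have Sa : S a.
  split; first lra.
  by have [|e e0 h] := loc a; [lra|apply: h; lra].
have bS : bound S by exists b => t [? _]; lra.
have [c [ub lub]] := completeness S bS (ex_intro _ a Sa).
have ac := ub _ Sa.
have cb : c <= b by apply: lub => t [? _]; lra.
have [|e e0 h] := loc c; first lra.
have [t [[at_ Pt] ct]] : exists t, S t /\ c - e < t.
  apply: contrapT => nt.
  suff : c <= c - e by lra.
  apply: lub => t St; case: (Rle_lt_dec t (c - e)) => // ?.
  by case: nt; exists t.
have tc := ub _ (conj at_ Pt).
(* Half a radius beyond the supremum c, cut off at b: either this is b, or it contradicts that c is
   an upper bound. *)
pose c' := Rmin b (c + e / 2).
have ? : c' <= b by apply: Rmin_l.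
have ? : c' <= c + e / 2 by apply: Rmin_r.
have ? : c <= c' by apply: Rmin_glb; lra.
have Pc' : P a c' by apply: (glue _ t) => //; try lra; apply: h; lra.
have : c' <= c by apply: ub; split; [lra|].
rewrite /c' in Pc' *; move: Pc'; rewrite /Rmin; case: Rle_dec => // ? ? ?; lra.
Qed.

Definition upd {k} (u : 'I_k -> R) d m : 'I_k -> R := fun i => if i == d then m else u i.

Definition is_box {k} (l u : 'I_k -> R) := forall i, 0 <= l i /\ l i <= u i /\ u i <= 1.

(** Compactness of the cube as an induction principle, obtained by running [interval_ind] in one
    coordinate after another. *)
Lemma box_ind {k} (P : ('I_k -> R) -> ('I_k -> R) -> Prop) :
  (forall p : 'I_k -> R, (forall i, 0 <= p i <= 1) -> exists2 e, 0 < e &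
     forall l u, is_box l u -> (forall i, Rabs (l i - p i) < e /\ Rabs (u i - p i) < e) ->
       P l u) ->
  (forall l u d m, is_box l u -> l d <= m <= u d ->
     P l (upd u d m) -> P (upd l d m) u -> P l u) ->
  P (fun=> 0) (fun=> 1).
Proof.
move=> loc glue.
(* Coordinates of index below n range freely, the others stay near p: n = 0 is the local hypothesis
   and n = k the whole cube. *)
have claim n : forall p : 'I_k -> R, (forall i, 0 <= p i <= 1) -> exists2 e, 0 < e &
     forall l u, is_box l u ->
      (forall i : 'I_k, (n <= i)%N -> Rabs (l i - p i) < e /\ Rabs (u i - p i) < e) -> P l u.
  elim: n => [|n IH] p hp.
    by have [e e0 h] := loc p hp; exists e => // l u b hlu; apply: h => // i; apply: hlu.
  case: (ltnP n k) => [nk|kn]; last first.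
    have [e e0 h] := IH p hp; exists e => // l u b hlu; apply: h => // i ni.
    by move: (leq_trans kn ni); rewrite leqNgt ltn_ord.
  pose d := Ordinal nk.
  pose Q s t := exists2 e, 0 < e & forall l u, is_box l u ->
    (forall i : 'I_k, (n < i)%N -> Rabs (l i - p i) < e /\ Rabs (u i - p i) < e) ->
    s <= l d -> u d <= t -> P l u.
  suff [e e0 h] : Q 0 1.
    by exists e => // l u b hlu; have [? [? ?]] := b d; apply: h => //; lra.
  apply: interval_ind; first lra.
    move=> x hx; have [|e e0 h] := IH (upd p d x).
      by move=> i; rewrite /upd; case: eqP.
    exists e => // s t xs tx _ _ _; exists e => // l u b hlu sl ut; apply: h => // i ni.
    rewrite /upd; case: eqP => [->|/eqP id].
      by have := b d; split; apply: Rabs_def1; lra.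
    apply: hlu; rewrite ltn_neqAle ni andbT; apply: contra_neq id => e1.
    exact: val_inj.
  move=> s m t sm mt [e1 e10 h1] [e2 e20 h2]; exists (Rmin e1 e2); first exact: Rmin_gt0.
  move=> l u b hlu sl ut.
  have hlu1 : forall i : 'I_k, (n < i)%N -> Rabs (l i - p i) < e1 /\ Rabs (u i - p i) < e1.
    by move=> i /hlu; have := Rmin_l e1 e2; lra.
  have hlu2 : forall i : 'I_k, (n < i)%N -> Rabs (l i - p i) < e2 /\ Rabs (u i - p i) < e2.
    by move=> i /hlu; have := Rmin_r e1 e2; lra.
  case: (Rle_dec (u d) m) => um; first exact: h1.
  case: (Rle_dec m (l d)) => ml; first exact: h2.
  have ud (i : 'I_k) v : (n < i)%N -> upd v d m i = v i.
    by rewrite /upd; case: eqP => // -> /=; rewrite ltnn.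
  apply: (glue l u d m) => //; first lra.
    apply: h1 => // [i|i ni|]; last by rewrite /upd eqxx; lra.
      by rewrite /upd; have := b i; case: eqP => // ->; lra.
    by rewrite ud //; apply: hlu1.
  apply: h2 => // [i|i ni|]; last by rewrite /upd eqxx; lra.
    by rewrite /upd; have := b i; case: eqP => // ->; lra.
  by rewrite ud //; apply: hlu2.
have [|e e0 h] := claim k (fun=> 0); first by move=> i; lra.
apply: h => [i|i]; first lra.
by rewrite leqNgt ltn_ord.
Qed.

End Induction.

(** * Compactness of cubes and the exponential law for loops *)

Section Cubes.
Local Open Scope R_scope.
Local Open Scope classical_set_scope.

Definition in_cube {k} (x : 'I_k -> R) := forall i, 0 <= x i <= 1.
Definition mC k := mRk (@in_cube k).

Definition in_box {k} (l u : 'I_k -> R) (p : mC k) :=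
  forall i, l i <= proj1_sig p i <= u i.

Lemma in_box_close {k} (p q : mC k) l u e :
  (forall i, Rabs (l i - proj1_sig p i) < e /\ Rabs (u i - proj1_sig p i) < e) ->
  in_box l u q -> bl p e q.
Proof.
move=> h hq i; have [/Rabs_def2 h1 /Rabs_def2 h2] := h i; have := hq i.
by move=> ?; apply: Rabs_def1; lra.
Qed.

Lemma in_box_split {k} l u (d : 'I_k) m p : in_box l u p ->
  in_box l (upd u d m) p \/ in_box (upd l d m) u p.
Proof.
move=> h; case: (Rle_lt_dec (proj1_sig p d) m) => hm; [left|right] => i;
  rewrite /upd; have := h i; case: eqP => // -> ; lra.
Qed.

Lemma in_box_full {k} (p : mC k) : in_box (fun=> 0) (fun=> 1) p.
Proof. by move=> i; exact: (proj2_sig p i). Qed.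

Lemma cube_unif {k} (f : mC k -> R) : @mcts _ mR f -> forall e, 0 < e ->
  exists2 d, 0 < d & forall p q, bl p d q -> Rabs (f q - f p) < e.
Proof.
move=> hf e e0.
suff [d d0 h] : exists2 d, 0 < d & forall p q, in_box (fun=> 0) (fun=> 1) p ->
    bl p d q -> Rabs (f q - f p) < e.
  by exists d => // p q; apply: h; exact: in_box_full.
apply: (box_ind (fun l u => exists2 d, 0 < d & forall p q, in_box l u p ->
    bl p d q -> Rabs (f q - f p) < e)) => [x hx|l u d m b hm [e1 e10 h1] [e2 e20 h2]].
  have e2 : 0 < e / 2 by lra.
  have [d d0 hd] := hf (exist _ x hx) _ e2.
  exists (d / 2); first lra.
  move=> l u b hlu; exists (d / 2); first lra.
  move=> p q /(@in_box_close _ (exist _ x hx)) hp pq; have {}hp := hp _ hlu.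
  have /hd /= h1 : bl (exist _ x hx : mC k) d p by apply: bl_mono hp; lra.
  have /hd /= h2 : bl (exist _ x hx : mC k) d q.
    move=> i; have /= /Rabs_def2 := hp i; have /= /Rabs_def2 := pq i.
    by move=> *; apply: Rabs_def1; lra.
  by move/Rabs_def2: h1; move/Rabs_def2: h2 => *; apply: Rabs_def1; lra.
exists (Rmin e1 e2); first exact: Rmin_gt0.
move=> p q /(in_box_split _ _ d m) [hp|hp] pq; [apply: h1|apply: h2] => //;
  apply: bl_mono pq; [exact: Rmin_l|exact: Rmin_r].
Qed.

Lemma cube_cover {k} (W : nat -> set (mC k)) :
  (forall n m, (n <= m)%N -> W n `<=` W m) -> (forall n, mopen _ (W n)) ->
  (forall p, exists n, W n p) -> exists n, forall p, W n p.
Proof.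
move=> mono op cov.
suff [n h] : exists n, in_box (fun=> 0) (fun=> 1) `<=` W n.
  by exists n => p; apply: h; exact: in_box_full.
apply: (box_ind (fun l u => exists n, in_box l u `<=` W n)) => [x hx|l u d m b hm [n1 h1] [n2 h2]].
  have [n Wn] := cov (exist _ x hx); have [e e0 h] := op n _ Wn.
  by exists e => // l u b hlu; exists n => p hp; apply: h; apply: (in_box_close (exist _ x hx)) hp.
exists (maxn n1 n2) => p /(in_box_split _ _ d m) [/h1|/h2]; apply: mono; [exact: leq_maxl|exact: leq_maxr].
Qed.

Lemma compactI_itv s t : 0 <= s <= t -> t <= 1 ->
  compactI [set x : I | s <= proj1_sig x <= t].
Proof.
move=> st t1 F FO cov.
apply: (interval_ind (fun a b => exists r : seq (set I), List.Forall F r /\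
  [set x : I | a <= proj1_sig x <= b] `<=` \bigcup_(U in [set U | List.In U r]) U)); first lra.
  move=> x hx; have xI : 0 <= x <= 1 by lra.
  have [|U FU Ux] := cov (exist _ x xI); first by [].
  have [e e0 he] := FO _ FU _ Ux; exists e => // a b xa bx _ ab _.
  exists [:: U]; split; first by constructor.
  move=> y /= hy; exists U; first by left.
  by apply: he; apply: Rabs_def1; simpl; lra.
move=> a m b am mb [r [Fr hr]] [r' [Fr' hr']]; exists (r ++ r'); split.
  by apply/List.Forall_app.
move=> y /= hy; case: (Rle_lt_dec (proj1_sig y) m) => ym.
  have [|U Ur Uy] := hr y; first by rewrite /=; lra.
  by exists U => //; apply: List.in_or_app; left.
have [|U Ur Uy] := hr' y; first by rewrite /=; lra.
by exists U => //; apply: List.in_or_app; right.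
Qed.

(** Finitely many of the open sets V cover K, and the corresponding neighbourhoods U of a are
    intersected. All later compact-open arguments rest on this. *)
Lemma tube {A} (OA : set (set A)) (K : set I) (W : set (A * I)) : is_top OA ->
  compactI K -> prod_opens OA opI W -> OA [set a | forall t, K t -> W (a, t)].
Proof.
move=> tA cK; rewrite prod_opensP //; last exact: opI_top; move=> hW.
apply: top_local => // a ha.
pose F := [set V | opI V /\ exists U, [/\ OA U, U a & forall a' t, U a' -> V t -> W (a', t)]].
have [|t Kt|r [Fr Kr]] := cK F; first by move=> V [].
  by have [U [V [? ? ? ? h]]] := hW _ _ (ha t Kt); exists V => //; split=> //; exists U.
suff [U [hU Ua h]] : exists U, [/\ OA U, U a &
    forall a' t V, U a' -> List.In V r -> V t -> W (a', t)].
  exists U; split=> // a' Ua' t /Kr [V /= Vr Vt]; exact: h Vr Vt.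
elim: {Kr} r Fr => [|V r IH] Fr; first by exists setT; split=> //; case: tA.
inversion Fr as [|? ? [_ [U [hU Ua h]]] Fr']; subst.
have [U' [hU' Ua' h']] := IH Fr'.
exists (U `&` U'); split=> //; first by case: tA => _ tI _; apply: tI.
move=> a' t V' [Ua1 Ua2] /= [<-|V'r] Vt; first exact: h.
exact: h' V'r Vt.
Qed.

(** Local compactness of I: the closed interval of half the radius, cut off at 0 and 1, is compact
    and still contains a ball around t. *)
Lemma opI_nbhd (U : set I) t : opI U -> U t -> exists a b, [/\ 0 <= a <= b, b <= 1,
  forall x : I, a <= proj1_sig x <= b -> U x &
  exists2 e, 0 < e & forall x : I, Rabs (proj1_sig x - proj1_sig t) < e -> a <= proj1_sig x <= b].
Proof.
move=> hU /hU [e e0 h]; have t01 := proj2_sig t.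
exists (Rmax 0 (proj1_sig t - e / 2)), (Rmin 1 (proj1_sig t + e / 2)).
have h1 := Rmax_l 0 (proj1_sig t - e / 2); have h2 := Rmax_r 0 (proj1_sig t - e / 2).
have h3 := Rmin_l 1 (proj1_sig t + e / 2); have h4 := Rmin_r 1 (proj1_sig t + e / 2).
have h5 : Rmax 0 (proj1_sig t - e / 2) <= proj1_sig t by apply: Rmax_lub; lra.
have h6 : proj1_sig t <= Rmin 1 (proj1_sig t + e / 2) by apply: Rmin_glb; lra.
split; try lra.
  by move=> x hx; apply: h; apply: Rabs_def1; lra.
exists (e / 2); first lra.
move=> x /Rabs_def2 hx; have x01 := proj2_sig x; simpl in *.
split; [apply: Rmax_lub|apply: Rmin_glb]; lra.
Qed.

Lemma cont_curry {A} (OA : set (set A)) (Y : pspace) (F : A -> loop Y) : is_top OA ->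
  cont (prod_opens OA opI) (popens Y) (fun p => proj1_sig (F p.1) p.2) ->
  cont OA (popens (Omega Y)) F.
Proof.
move=> tA h; apply: cont_gen => // _ [K [U [cK hU ->]]].
exact: (tube _ K _ tA cK (h _ hU)).
Qed.

(** Evaluation is jointly continuous because I is locally compact: on a compact neighbourhood of t
    the condition is a subbasic open set of loops. *)
Lemma cont_uncurry {A} (OA : set (set A)) (Y : pspace) (F : A -> loop Y) : is_top OA ->
  cont OA (popens (Omega Y)) F ->
  cont (prod_opens OA opI) (popens Y) (fun p => proj1_sig (F p.1) p.2).
Proof.
move=> tA h V hV; apply/prod_opensP => //; first exact: opI_top.
move=> a t /= Vat; have [cF _ _] := proj2_sig (F a).
have [c [d [h1 h2 h3 [e e0 h4]]]] := opI_nbhd _ _ (cF _ hV) Vat.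
exists (F @^-1` [set f | forall x : I, c <= proj1_sig x <= d -> V (proj1_sig f x)]),
  [set x : I | Rabs (proj1_sig x - proj1_sig t) < e].
split=> //.
- apply: h; apply: (@sub_gen (loop Y)); exists [set x : I | c <= proj1_sig x <= d], V.
  by split=> //; exact: compactI_itv.
- by move=> x /Rabs_open [e' e0' h']; exists e' => // y; exact: h'.
- by rewrite /= Rminus_diag Rabs_R0.
- by move=> a' t' /= h' /h4; apply: h'.
Qed.

(** Reduces continuity on Q x I to openness of subsets of Q alone. When Q is a quotient this can be
    tested upstairs with [tube], which replaces the fact that a quotient map times I is again a
    quotient map. *)
Lemma cont_prod_quotient {Q B} (OQ : set (set Q)) (OB : set (set B)) (F : Q * I -> B) :
  is_top OQ ->
  (forall K V, compactI K -> OB V -> OQ [set q | forall t, K t -> V (F (q, t))]) ->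
  (forall q, cont opI OB (fun t => F (q, t))) ->
  cont (prod_opens OQ opI) OB F.
Proof.
move=> tQ h hF V hV; apply/prod_opensP => //; first exact: opI_top.
move=> q t Vqt; have [c [d [h1 h2 h3 [e e0 h4]]]] := opI_nbhd _ _ (hF q _ hV) Vqt.
exists [set q' | forall x : I, c <= proj1_sig x <= d -> V (F (q', x))],
  [set x : I | Rabs (proj1_sig x - proj1_sig t) < e].
split=> //.
- by apply: (h [set x : I | c <= proj1_sig x <= d]); first exact: compactI_itv.
- by move=> x /Rabs_open [e' e0' h']; exists e' => // y; exact: h'.
- by rewrite /= Rminus_diag Rabs_R0.
- by move=> a' t' /= h' /h4; apply: h'.
Qed.

End Cubes.

(** * Iterated loop spaces and maps of cubes *)

Section IteratedLoops.
Local Open Scope R_scope.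
Local Open Scope classical_set_scope.

Lemma sig_eq {T} {P : T -> Prop} (x y : {z | P z}) : proj1_sig x = proj1_sig y -> x = y.
Proof. by case: x y => [x hx] [y hy] /= e; subst; congr exist; exact: Prop_irrelevance. Qed.

Definition cbd {k} (p : mC k) := exists i, proj1_sig p i = 0 \/ proj1_sig p i = 1.

Definition cons_fun {k} (t : R) (p : 'I_k -> R) (i : 'I_k.+1) : R :=
  if unlift ord0 i is Some j then p j else t.

Lemma cons_fun0 {k} t (p : 'I_k -> R) : cons_fun t p ord0 = t.
Proof. by rewrite /cons_fun unlift_none. Qed.

Lemma cons_funS {k} t (p : 'I_k -> R) i : cons_fun t p (lift ord0 i) = p i.
Proof. by rewrite /cons_fun liftK. Qed.

Lemma ordSP {k} (P : 'I_k.+1 -> Prop) : P ord0 -> (forall i, P (lift ord0 i)) -> forall i, P i.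
Proof. by move=> h0 hS i; case: (unliftP ord0 i) => [j|] ->. Qed.

Lemma ccons_proof {k} (t : I) (p : mC k) : in_cube (cons_fun (proj1_sig t) (proj1_sig p)).
Proof.
apply: ordSP => [|i]; rewrite ?cons_fun0 ?cons_funS; first exact: (proj2_sig t).
exact: (proj2_sig p i).
Qed.

Definition ccons {k} (t : I) (p : mC k) : mC k.+1 := exist _ _ (ccons_proof t p).
Definition chead {k} (p : mC k.+1) : I := exist _ (proj1_sig p ord0) (proj2_sig p ord0).
Definition ctail {k} (p : mC k.+1) : mC k :=
  exist in_cube (fun i : 'I_k => proj1_sig p (lift ord0 i))
    (fun i => proj2_sig p (lift ord0 i)).

Lemma ccons_eta {k} (p : mC k.+1) : ccons (chead p) (ctail p) = p.
Proof.
by apply: sig_eq; apply/funext; apply: ordSP => [|i] /=; rewrite ?cons_fun0 ?cons_funS.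
Qed.

Lemma chead_cons {k} t (p : mC k) : chead (ccons t p) = t.
Proof. by apply: sig_eq => /=; rewrite cons_fun0. Qed.

Lemma ctail_cons {k} t (p : mC k) : ctail (ccons t p) = p.
Proof. by apply: sig_eq; apply/funext => i /=; rewrite cons_funS. Qed.

Lemma cbd_cons {k} t (p : mC k) : cbd (ccons t p) <-> t = I0 \/ t = I1 \/ cbd p.
Proof.
split=> [[i]|].
  case: (unliftP ord0 i) => [j|] -> /=; rewrite ?cons_fun0 ?cons_funS => h.
    by right; right; exists j.
  by case: h => h; [left|right; left]; apply: sig_eq.
case=> [->|[->|[i h]]].
- by exists ord0; left => /=; rewrite cons_fun0.
- by exists ord0; right => /=; rewrite cons_fun0.
- by exists (lift ord0 i); rewrite /= cons_funS.
Qed.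

Lemma mcts_chead {k} : @mcts (mC k.+1) mI chead.
Proof. exact: mcts_coord. Qed.

Lemma mcts_ctail {k} : @mcts (mC k.+1) (mC k) ctail.
Proof. by apply: mcts_Rk => i; exact: mcts_coord. Qed.

Lemma mcts_ccons {K : mspace} {k} (f : K -> I) (g : K -> mC k) : @mcts K mI f -> @mcts K (mC k) g ->
  @mcts K (mC k.+1) (fun x => ccons (f x) (g x)).
Proof.
move=> hf hg; apply: mcts_Rk; apply: ordSP => [|i] /=.
  have -> : (fun x : K => cons_fun (proj1_sig (f x)) (proj1_sig (g x)) ord0) =
     fun x => proj1_sig (f x) by apply/funext => x; rewrite cons_fun0.
  exact: mcts_comp hf mcts_val.
have -> : (fun x : K => cons_fun (proj1_sig (f x)) (proj1_sig (g x)) (lift ord0 i)) =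
     fun x => proj1_sig (g x) i by apply/funext => x; rewrite cons_funS.
exact: mcts_comp hg (mcts_coord i).
Qed.

Definition cpt0 : mC 0 := exist _ (fun=> 0) (fun i : 'I_0 => let: Ordinal _ h := i in False_ind _ (notF h)).

Definition hrel {W : pspace} {k} (F0 F1 : mC k -> W) := exists H : mC k * I -> W,
  [/\ cont (mopen (mprod (mC k) mI)) (popens W) H, forall p, H (p, I0) = F0 p,
      forall p, H (p, I1) = F1 p & forall p t, cbd p -> H (p, t) = F0 p].

Section Ev.
Variable W : pspace.

(** Uncurrying, with the outermost loop variable as first coordinate. Together with [ev_inj] and
    [ev_lift] it identifies m-fold loops with m-cubes sending the boundary to the base point, in
    families over a parameter space K. *)
Fixpoint ev m : iter m Omega W -> mC m -> W :=
  match m with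
  | 0 => fun w _ => w
  | m'.+1 => fun f p => ev m' (proj1_sig f (chead p)) (ctail p)
  end.

Lemma ev_cts m : forall (K : mspace) (F : K -> iter m Omega W),
  cont (mopen K) (popens (iter m Omega W)) F ->
  cont (mopen (mprod K (mC m))) (popens W) (fun kp => ev m (F kp.1) kp.2).
Proof.
elim: m => [|m IH] K F hF; first exact: cont_comp (mcts_cont _ mcts_fst) hF.
have := cont_uncurry _ _ _ (mopen_top K) hF; rewrite -(mopen_prod K mI) => /IH h.
have g : @mcts (mprod K (mC m.+1)) (mprod (mprod K mI) (mC m))
  (fun kp => ((kp.1, chead kp.2), ctail kp.2)).
  apply: mcts_pair; first apply: mcts_pair.
  - exact: mcts_fst.
  - exact: mcts_comp mcts_snd mcts_chead.
  - exact: mcts_comp mcts_snd mcts_ctail.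
exact: cont_comp (mcts_cont _ g) h.
Qed.

Lemma ev_base m p : ev m (base (iter m Omega W)) p = base W.
Proof. by elim: m p => [|m IH] p //=; exact: IH. Qed.

Lemma ev_bd m f p : cbd p -> ev m f p = base W.
Proof.
elim: m f p => [|m IH] f p; first by case=> [[i hi]].
rewrite -(ccons_eta p) cbd_cons /= chead_cons ctail_cons.
have [_ f0 f1] := proj2_sig f.
case=> [->|[->|]]; [rewrite f0; exact: ev_base|rewrite f1; exact: ev_base|exact: IH].
Qed.

Lemma ev_inj m f g : (forall p, ev m f p = ev m g p) -> f = g.
Proof.
elim: m f g => [|m IH] f g h; first exact: (h cpt0).
apply: sig_eq; apply/funext => t; apply: IH => p.
by have := h (ccons t p); rewrite /= chead_cons ctail_cons.
Qed.

Lemma ev_lift m : forall (K : mspace) (F : K * mC m -> W),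
  cont (mopen (mprod K (mC m))) (popens W) F ->
  (forall k p, cbd p -> F (k, p) = base W) ->
  exists2 F' : K -> iter m Omega W, cont (mopen K) (popens (iter m Omega W)) F' &
    forall k p, ev m (F' k) p = F (k, p).
Proof.
elim: m => [|m IH] K F hF bF.
  exists (fun k => F (k, cpt0)).
    have g : @mcts K (mprod K (mC 0)) (fun k => (k, cpt0)).
      by apply: mcts_pair; [exact: mcts_id|exact: mcts_const].
    exact: cont_comp (mcts_cont _ g) hF.
  by move=> k p; congr (F (_, _)); apply: sig_eq; apply/funext => -[].
have g : @mcts (mprod (mprod K mI) (mC m)) (mprod K (mC m.+1))
  (fun kp => (kp.1.1, ccons kp.1.2 kp.2)).
  apply: mcts_pair; first exact: mcts_comp mcts_fst mcts_fst.
  by apply: mcts_ccons; [exact: mcts_comp mcts_fst mcts_snd|exact: mcts_snd].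
have [|F' cF' eF'] := IH _ _ (cont_comp _ _ _ _ _ (mcts_cont _ g) hF).
  by move=> k p hp; apply: bF; apply/cbd_cons; right; right.
have hl k : is_loop (fun t => F' (k, t)).
  split.
  - have g' : @mcts mI (mprod K mI) (fun t => (k, t)).
      by apply: mcts_pair; [exact: mcts_const|exact: mcts_id].
    exact: cont_comp (mcts_cont _ g') cF'.
  - by apply: ev_inj => p; rewrite eF' ev_base bF //; apply/cbd_cons; left.
  - by apply: ev_inj => p; rewrite eF' ev_base bF //; apply/cbd_cons; right; left.
exists (fun k => exist _ _ (hl k) : Omega (iter m Omega W)).
  apply: cont_curry; first exact: mopen_top.
  rewrite -(mopen_prod K mI) /=.
  have -> : (fun p : K * I => F' (p.1, p.2)) = F' by apply/funext => -[].
  exact: cF'.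
by move=> k p /=; rewrite eF' /= ccons_eta.
Qed.

(** The fundamental group of the (m+1)-fold loop space is the homotopy group of W in degree m+2, so
    null homotopies of (m+2)-cubes suffice. *)
Lemma omega_trivial m :
  (forall F : mC m.+2 -> W, cont (mopen (mC m.+2)) (popens W) F ->
     (forall p, cbd p -> F p = base W) -> hrel F (fun=> base W)) ->
  pi1_trivial (iter m.+1 Omega W).
Proof.
move=> h a.
pose a' : iter m.+2 Omega W := a.
have cF : cont (mopen (mC m.+2)) (popens W) (ev m.+2 a').
  have := ev_cts m.+2 mI (fun=> a') (cont_const _ _ _ opI_top).
  have g : @mcts (mC m.+2) (mprod mI (mC m.+2)) (fun p => (I0, p)).
    by apply: mcts_pair; [exact: mcts_const|exact: mcts_id].
  exact: cont_comp (mcts_cont _ g).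
have [H [cH H0 H1 Hb]] := h _ cF (fun p => ev_bd _ _ p).
(* Regrouping: the first cube coordinate and the homotopy time form the parameter square, and the
   other m+1 coordinates are curried back into loops. *)
have g : @mcts (mprod (mprod mI mI) (mC m.+1)) (mprod (mC m.+2) mI)
  (fun kp => (ccons kp.1.1 kp.2, kp.1.2)).
  apply: mcts_pair; last exact: mcts_comp mcts_fst mcts_snd.
  by apply: mcts_ccons; [exact: mcts_comp mcts_fst mcts_fst|exact: mcts_snd].
have Hbd p t : cbd p -> H (p, t) = base W by move=> hp; rewrite Hb // ev_bd.
have [|F' cF' eF'] := ev_lift m.+1 _ _ (cont_comp _ _ _ _ _ (mcts_cont _ g) cH).
  by move=> k p hp /=; apply: Hbd; apply/cbd_cons; right; right.
exists F'; split.
- by rewrite -(mopen_prod mI mI).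
- move=> s; apply: ev_inj => p; rewrite eF' H0 /=.
  by rewrite -[in LHS](chead_cons s p) !chead_cons !ctail_cons.
- by move=> s; apply: ev_inj => p; rewrite eF' H1 (ev_base m.+1).
- by move=> t; split; apply: ev_inj => p; rewrite eF' (ev_base m.+1) Hbd //=;
    apply/cbd_cons; auto.
Qed.

End Ev.

Section Rel.
Context {W : pspace} {k : nat}.
Implicit Types F : mC k -> W.

Lemma hrel_refl F : cont (mopen (mC k)) (popens W) F -> hrel F F.
Proof.
by move=> cF; exists (fun pt => F pt.1); split=> //; exact: cont_comp (mcts_cont _ mcts_fst) cF.
Qed.

Lemma hrel_bd F0 F1 p : hrel F0 F1 -> cbd p -> F0 p = F1 p.
Proof. by move=> [H [_ _ H1 Hb]] hp; rewrite -H1 Hb. Qed.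

Lemma clampI_id (t : I) : clampI (proj1_sig t) = t.
Proof.
apply: sig_eq => /=; have := proj2_sig t; simpl.
by rewrite /Rmax /Rmin; do 2 case: Rle_dec; lra.
Qed.

Lemma clampI_le0 x : x <= 0 -> clampI x = I0.
Proof. by move=> h; apply: sig_eq; rewrite /= /Rmax /Rmin; do 2 case: Rle_dec; lra. Qed.

Lemma clampI_ge1 x : 1 <= x -> clampI x = I1.
Proof. by move=> h; apply: sig_eq; rewrite /= /Rmax /Rmin; do 2 case: Rle_dec; lra. Qed.

Lemma hrel_sym F0 F1 : hrel F0 F1 -> hrel F1 F0.
Proof.
move=> h; have := h; move=> [H [cH H0 H1 Hb]].
exists (fun pt => H (pt.1, clampI (1 - proj1_sig pt.2))); split.
- have g : @mcts (mprod (mC k) mI) (mprod (mC k) mI)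
      (fun pt => (pt.1, clampI (1 - proj1_sig pt.2))).
    apply: mcts_pair; first exact: mcts_fst.
    apply: mcts_clampI; apply: rcts_sub; first exact: mcts_const.
    exact: mcts_comp mcts_snd mcts_val.
  exact: cont_comp (mcts_cont _ g) cH.
- by move=> p /=; rewrite clampI_ge1 ?H1 //; lra.
- by move=> p /=; rewrite clampI_le0 ?H0 //; lra.
- by move=> p t hp /=; rewrite Hb // (hrel_bd _ _ _ h).
Qed.

Lemma cont_paste {K : mspace} (f : K -> R) (G0 G1 : K -> W) : @mcts K mR f ->
  cont (mopen K) (popens W) G0 -> cont (mopen K) (popens W) G1 ->
  (forall x, f x = 0 -> G0 x = G1 x) ->
  cont (mopen K) (popens W) (fun x => if Rle_dec (f x) 0 then G0 x else G1 x).
Proof.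
move=> cf c0 c1 e V hV x; rewrite /preimage /= => Vx.
have same (G : K -> W) : cont (mopen K) (popens W) G -> V (G x) ->
    exists2 d, 0 < d & forall y, bl x d y -> V (G y).
  by move=> cG; exact: (cG _ hV).
case: (Rtotal_order (f x) 0) Vx => [fx|[fx|fx]]; case: Rle_dec => [le|nle] Vx; try lra.
- have [d d0 hd] := same _ c0 Vx; have [|d' d'0 hd'] := cf x (- f x); first lra.
  exists (Rmin d d'); first exact: Rmin_gt0.
  move=> y hy; have /Rabs_def2 := hd' y (bl_mono _ _ _ _ _ (Rmin_r _ _) hy).
  case: Rle_dec => [? _|] /=; last by simpl; lra.
  exact: hd (bl_mono _ _ _ _ _ (Rmin_l _ _) hy).
- have [d d0 hd] := same _ c0 Vx; have [|d' d'0 hd'] := same _ c1; first by rewrite -e.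
  exists (Rmin d d'); first exact: Rmin_gt0.
  move=> y hy; case: Rle_dec => ? /=; [apply: hd|apply: hd']; apply: bl_mono hy;
    [exact: Rmin_l|exact: Rmin_r].
- have [d d0 hd] := same _ c1 Vx; have [|d' d'0 hd'] := cf x (f x); first lra.
  exists (Rmin d d'); first exact: Rmin_gt0.
  move=> y hy; have /Rabs_def2 := hd' y (bl_mono _ _ _ _ _ (Rmin_r _ _) hy).
  case: Rle_dec => [|? _] /=; first by simpl; lra.
  exact: hd (bl_mono _ _ _ _ _ (Rmin_l _ _) hy).
Qed.

Lemma hrel_trans F0 F1 F2 : hrel F0 F1 -> hrel F1 F2 -> hrel F0 F2.
Proof.
move=> h h'; have := h; have := h'; move=> [H' [cH' H0' H1' Hb']] [H [cH H0 H1 Hb]].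
exists (fun pt => if Rle_dec (2 * proj1_sig pt.2 - 1) 0 then H (pt.1, clampI (2 * proj1_sig pt.2))
  else H' (pt.1, clampI (2 * proj1_sig pt.2 - 1))).
have cv : @mcts (mprod (mC k) mI) mR (fun pt => 2 * proj1_sig pt.2).
  by apply: rcts_scal; exact: mcts_comp mcts_snd mcts_val.
have cv1 : @mcts (mprod (mC k) mI) mR (fun pt => 2 * proj1_sig pt.2 - 1).
  by apply: rcts_sub => //; exact: mcts_const.
have g (f : mC k * I -> R) : @mcts (mprod (mC k) mI) mR f ->
   @mcts (mprod (mC k) mI) (mprod (mC k) mI) (fun pt => (pt.1, clampI (f pt))).
   by move=> hf; apply: mcts_pair; [exact: mcts_fst|exact: mcts_clampI].
split.
- apply: cont_paste => //.
  + exact: cont_comp (mcts_cont _ (g _ cv)) cH.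
  + exact: cont_comp (mcts_cont _ (g _ cv1)) cH'.
  + by move=> [p t] /= e; rewrite clampI_ge1 ?clampI_le0 ?H1 ?H0' //; lra.
- by move=> p; case: Rle_dec => /= [?|]; [rewrite clampI_le0 ?H0 //|]; lra.
- by move=> p; case: Rle_dec => /= [|?]; [|rewrite clampI_ge1 ?H1' //]; lra.
- move=> p t hp; case: Rle_dec => ? /=; first by rewrite Hb.
  by rewrite Hb' // (hrel_bd _ _ _ h).
Qed.

End Rel.

Lemma hrel_map {W W' : pspace} {k} (f : W -> W') (F0 F1 : mC k -> W) :
  cont (popens W) (popens W') f -> hrel F0 F1 ->
  hrel (fun p => f (F0 p)) (fun p => f (F1 p)).
Proof.
move=> cf [H [cH H0 H1 Hb]]; exists (fun pt => f (H pt)); split.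
- exact: cont_comp cH cf.
- by move=> p; rewrite H0.
- by move=> p; rewrite H1.
- by move=> p t hp; rewrite Hb.
Qed.

Definition cube1 (t : I) : mC 1 := ccons t cpt0.

Lemma chead_cube1 t : chead (cube1 t) = t. Proof. exact: chead_cons. Qed.

Lemma cube1K (p : mC 1) : cube1 (chead p) = p.
Proof. by rewrite -[RHS]ccons_eta; congr ccons; apply: sig_eq; apply/funext => -[]. Qed.

Lemma mcts_cube1 : @mcts mI (mC 1) cube1.
Proof. by apply: mcts_ccons; [exact: mcts_id|exact: mcts_const]. Qed.

Lemma hrel_homotopic {W : pspace} (a b : loop W) :
  hrel (fun p => proj1_sig a (chead p)) (fun p => proj1_sig b (@chead 0 p)) <->
  homotopic a b.
Proof.
split=> [[H [cH H0 H1 Hb]]|[H [cH H0 H1 Hb]]].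
  exists (fun st => H (cube1 st.1, st.2)); split.
  - rewrite -(mopen_prod mI mI).
    have g : @mcts (mprod mI mI) (mprod (mC 1) mI) (fun st => (cube1 st.1, st.2)).
      apply: mcts_pair; last exact: mcts_snd.
      exact: mcts_comp mcts_fst mcts_cube1.
    exact: cont_comp (mcts_cont _ g) cH.
  - by move=> s; rewrite H0 chead_cube1.
  - by move=> s; rewrite H1 chead_cube1.
  - have [_ a0 a1] := proj2_sig a.
    by move=> t; split; rewrite /= Hb ?chead_cube1 //; apply/cbd_cons; auto.
exists (fun pt => H (chead pt.1, pt.2)); split=> //.
- have g : @mcts (mprod (mC 1) mI) (mprod mI mI) (fun st => (chead st.1, st.2)).
    apply: mcts_pair; last exact: mcts_snd.
    exact: mcts_comp mcts_fst mcts_chead.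
  rewrite -(mopen_prod mI mI) in cH.
  exact: cont_comp (mcts_cont _ g) cH.
- move=> p t; rewrite -{1}(cube1K p) => /cbd_cons [->|[->|[[]//]]] /=.
  + by have [-> _] := Hb t; have [_ -> _] := proj2_sig a.
  + by have [_ ->] := Hb t; have [_ _ ->] := proj2_sig a.
Qed.

End IteratedLoops.

(** * Attaching cells *)

Section SumSq.
Local Open Scope R_scope.
Context {k : nat}.
Implicit Types x w : 'I_k -> R.

Lemma sumsq_ge0 x : 0 <= sumsq x.
Proof. by rewrite /sumsq; apply: big_ind => [|a b *|i _]; [lra|lra|exact: Rle_0_sqr]. Qed.

Lemma rcts_sumsq {K : mspace} (f : K -> 'I_k -> R) : (forall i, @mcts K mR (fun p => f p i)) ->
  @mcts K mR (fun p => sumsq (f p)).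
Proof.
by move=> hf; apply: rcts_big => [g h|i]; [exact: rcts_add|exact: rcts_mul].
Qed.

Lemma sumsq_scale c x : sumsq (fun i => c * x i) = c * c * sumsq x.
Proof.
rewrite /sumsq; elim: (index_enum _) => [|i s IH]; first by rewrite !big_nil /=; ring.
rewrite !big_cons IH /=; ring.
Qed.

Lemma sumsq_add x w : sumsq (fun i => x i + w i) <= 2 * sumsq x + 2 * sumsq w.
Proof.
rewrite /sumsq; elim: (index_enum _) => [|i s IH]; first by rewrite !big_nil; lra.
rewrite !big_cons /=; simpl in IH; have := Rle_0_sqr (x i - w i); rewrite /Rsqr; lra.
Qed.

Lemma sumsq_coord x i : x i * x i <= sumsq x.
Proof.
rewrite /sumsq; have : i \in index_enum 'I_k by rewrite mem_index_enum.
elim: (index_enum _) => // j s IH; rewrite inE big_cons => /orP[/eqP <-|/IH].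
  have : 0 <= \big[Rplus/R0]_(l <- s) (x l * x l).
    by apply: big_ind => [|a b *|l _]; [lra|lra|exact: Rle_0_sqr].
  by move=> h; rewrite -{1}[x i * x i]Rplus_0_r; apply: Rplus_le_compat_l.
move=> h; apply: Rle_trans h _; rewrite -[X in X <= _]Rplus_0_l.
by apply: Rplus_le_compat_r; exact: Rle_0_sqr.
Qed.

Lemma sumsq_le x c : (forall i, Rabs (x i) <= c) -> sumsq x <= INR k * (c * c).
Proof.
move=> h; have e : size (index_enum 'I_k) = k by rewrite -[RHS](size_enum_ord k) enumT [index_enum _]unlock.
rewrite -[in INR k]e {e}.
rewrite /sumsq; elim: (index_enum _) => [|i s IH]; first by rewrite big_nil /=; lra.
rewrite big_cons; change (size (i :: s)) with (size s).+1; rewrite S_INR.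
have hi := h i; have := Rabs_pos (x i) => hi0.
rewrite Rmult_plus_distr_r Rplus_comm Rmult_1_l; apply: Rplus_le_compat => //.
have -> : x i * x i = Rabs (x i) * Rabs (x i).
  by rewrite -Rabs_mult Rabs_right //; apply: Rle_ge; exact: Rle_0_sqr.
exact: Rmult_le_compat.
Qed.

End SumSq.

(** * Radial extension from the sphere *)

Section Normalize.
Local Open Scope R_scope.
Local Open Scope classical_set_scope.

Lemma sumsq_recl {k} (x : 'I_k.+1 -> R) :
  sumsq x = x ord0 * x ord0 + sumsq (fun i => x (lift ord0 i)).
Proof. by rewrite /sumsq big_ord_recl. Qed.

Context {m : nat}.

Definition mD := mRk (fun x : 'I_m -> R => sumsq x <= R1).
Definition mS := mRk (fun x : 'I_m -> R => sumsq x = R1).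

Lemma normalize_proof (x : 'I_m -> R) : 0 < sumsq x ->
  sumsq (fun i => / sqrt (sumsq x) * x i) = R1.
Proof.
move=> h; rewrite sumsq_scale -Rinv_mult sqrt_sqrt; last lra.
by field; lra.
Qed.

Definition normalize (x : 'I_m -> R) (h : 0 < sumsq x) : sphere m :=
  exist _ _ (normalize_proof x h).

(** Extends f radially; d is the value at the origin, a point that all collars leave out. *)
Definition polar {T} (d : T) (f : sphere m -> T) (x : 'I_m -> R) : T :=
  if Rlt_dec 0 (sumsq x) is left h then f (normalize x h) else d.

Lemma polarE {T} (d : T) f x (h : 0 < sumsq x) : polar d f x = f (normalize x h).
Proof. by rewrite /polar; case: Rlt_dec => // h'; congr f; apply: sig_eq. Qed.

Lemma polar_sphere {T} (d : T) f x (h : sumsq x = R1) : polar d f x = f (exist _ x h).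
Proof.
have h' : 0 < sumsq x by rewrite h; lra.
rewrite (polarE _ _ _ h'); congr f; apply: sig_eq => /=.
by rewrite h sqrt_1 Rinv_1; apply/funext => i; lra.
Qed.

(** The bound 1/4 keeps x away from the origin, so that normalisation is continuous there. *)
Lemma polar_open (f : sphere m -> Prop) (d : Prop) : opS m f ->
  mopen mD [set x | / 4 < sumsq (proj1_sig x) /\ polar d f (proj1_sig x)].
Proof.
move=> of_ x0 [h0 fx0].
pose P x := sumsq x <= R1 /\ / 4 < sumsq (x : 'I_m -> R).
have pos (x : {x | P x}) : 0 < sumsq (proj1_sig x) by case: x => x [/= _]; lra.
have cn : @mcts (mRk P) mS (fun x => normalize (proj1_sig x) (pos x)).
  apply: mcts_Rk => i /=; apply: rcts_mul; last exact: mcts_coord.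
  apply: rcts_inv => [x|].
    by have := sqrt_lt_R0 _ (pos x); lra.
  apply: rcts_sqrt => [x|]; first exact: sumsq_ge0.
  by apply: rcts_sumsq => j; exact: mcts_coord.
have P0 : P (proj1_sig x0) by split=> //; exact: (proj2_sig x0).
have [|e e0 he] := mcts_cont _ cn _ of_ (exist _ _ P0).
  by rewrite /preimage /=; move: fx0; rewrite (polarE _ _ _ (pos (exist _ _ P0))).
have cs : @mcts mD mR (fun x => sumsq (proj1_sig x)).
  by apply: rcts_sumsq => j; exact: mcts_coord.
have [|d1 d10 hd] := cs x0 (sumsq (proj1_sig x0) - / 4); first by simpl in *; lra.
exists (Rmin e d1); first exact: Rmin_gt0.
move=> y hy; have hy4 : / 4 < sumsq (proj1_sig y).
  by have /Rabs_def2 := hd _ (bl_mono _ _ _ _ _ (Rmin_r _ _) hy); simpl; lra.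
have Py : P (proj1_sig y) by split=> //; exact: (proj2_sig y).
split=> //; rewrite (polarE _ _ _ (pos (exist _ _ Py))).
by apply: he; exact: (@bl_mono mD) (Rmin_l _ _) hy.
Qed.

End Normalize.
Arguments mD : clear implicits.
Arguments mS : clear implicits.

Section Attach.
Local Open Scope R_scope.
Local Open Scope classical_set_scope.
Context {A : pspace} {m : nat} {J : Type} {phi : J -> sphere m -> A}.
Hypothesis tA : is_top (popens A).
Hypothesis cphi : forall j, cont (opS m) (popens A) (phi j).
Notation B := (attach phi).

Lemma attach_top : is_top (popens B).
Proof.
case: tA => t1 t2 t3; split.
- by split=> [|j x _]; [|exists 1; [lra|]].
- move=> U V [hU hU'] [hV hV']; split; first exact: t2 hU hV.
  by move=> j; case: (mopen_top (mD m)) => _ h _; exact: h (hU' j) (hV' j).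
- move=> F hF; split.
    apply: top_local => // a [U FU Ua]; have [hU _] := hF _ FU.
    by exists (inl @^-1` (attach_r phi @^-1` U)); split=> // a' Ua'; exists U.
  move=> j x [U FU Ux]; have [_ hU] := hF _ FU; have [e e0 h] := hU j x Ux.
  by exists e => // y /h ?; exists U.
Qed.

Definition cell (j : J) (x : disk m) : B := attach_r phi (inr (j, x)).

Lemma cell_in j x (h : sumsq (proj1_sig x) < R1) : cell j x = inr (j, exist _ (proj1_sig x) h).
Proof. by rewrite /cell /=; case: Rlt_dec => // h'; congr (inr (_, _)); apply: sig_eq. Qed.

Lemma cell_bd j x (h : sumsq (proj1_sig x) = R1) : cell j x = inl (phi j (exist _ (proj1_sig x) h)).
Proof.
rewrite /cell /=; case: Rlt_dec => h'; first by exfalso; move: (h'); rewrite h; exact: Rlt_irrefl.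
by congr (inl (phi _ _)); apply: sig_eq.
Qed.

Lemma ball_cell j (x : ball m) :
  inr (j, x) = cell j (exist _ (proj1_sig x) (Rlt_le _ _ (proj2_sig x))).
Proof. by case: x => x h; rewrite (cell_in j (exist _ x _) h). Qed.

Lemma disk_cases (x : disk m) : sumsq (proj1_sig x) < R1 \/ sumsq (proj1_sig x) = R1.
Proof. by have [] := Rle_lt_or_eq_dec _ _ (proj2_sig x); [left|right]. Qed.

Lemma attach_ind (P : B -> Prop) : (forall a, P (inl a)) -> (forall j x, P (cell j x)) ->
  forall b, P b.
Proof. by move=> h h' [a|[j x]] //; rewrite ball_cell. Qed.

Lemma cell_cts j : cont (mopen (mD m)) (popens B) (cell j).
Proof. by move=> V [_ h]; exact: h. Qed.

Lemma inl_cts : cont (popens A) (popens B) (fun a => inl a : B).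
Proof. by move=> V [h _]. Qed.

Lemma attach_cont {Y} (OY : set (set Y)) (F : B -> Y) :
  cont (popens A) OY (fun a => F (inl a)) ->
  (forall j, cont (mopen (mD m)) OY (fun x => F (cell j x))) -> cont (popens B) OY F.
Proof. by move=> h h' V hV; split; [exact: h|move=> j; exact: h']. Qed.

(** A homotopy out of an adjunction space may be checked on A and on each closed cell: both pieces
    of the quotient topology are handled by the tube lemma. *)
Lemma attach_cont_prod {Y} (OY : set (set Y)) (F : B * I -> Y) :
  cont (prod_opens (popens A) opI) OY (fun p => F (inl p.1, p.2)) ->
  (forall j, cont (mopen (mprod (mD m) mI)) OY (fun p => F (cell j p.1, p.2))) ->
  cont (prod_opens (popens B) opI) OY F.
Proof.
move=> h h'; apply: cont_prod_quotient; first exact: attach_top.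
  move=> K V cK hV; split; first exact: (tube _ _ _ tA cK (h _ hV)).
  move=> j; have := h' j _ hV; rewrite mopen_prod => {}h'.
  exact: (tube _ _ _ (mopen_top (mD m)) cK h').
have sec T (OT : set (set T)) (t : T) : is_top OT ->
    cont opI (prod_opens OT opI) (fun s => (t, s)).
  by move=> tT; apply: cont_pair (opI_top) (cont_const _ _ _ opI_top) (mcts_cont _ (@mcts_id mI)).
apply: attach_ind => [a|j x]; first exact: cont_comp (sec _ _ a tA) h.
have hj := h' j; rewrite mopen_prod in hj.
exact: cont_comp (sec _ _ x (mopen_top (mD m))) hj.
Qed.

(** An open set U of A is in general not open in B, but becomes so once all open cells are added. *)
Definition with_cells (U : set A) : set B := fun b => if b is inl a then U a else True.

Lemma with_cells_open U : popens A U -> popens B (with_cells U).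
Proof.
move=> hU; split=> // j x0.
change (with_cells U (cell j x0) -> exists2 e, 0 < e &
  forall y : mD m, @bl (mD m) x0 e y -> with_cells U (cell j y)).
case: (disk_cases x0) => h0.
  move=> _; have cs : @mcts (mD m) mR (fun x => sumsq (proj1_sig x)).
    by apply: rcts_sumsq => i; exact: mcts_coord.
  have [|d d0 hd] := cs x0 (1 - sumsq (proj1_sig x0)); first by simpl in *; lra.
  exists d => // y /hd /Rabs_def2 /= hy; have hy1 : sumsq (proj1_sig y) < R1 by lra.
  by rewrite (cell_in _ _ hy1).
rewrite (cell_bd _ _ h0) => Ux; have [e e0 he] := cphi j _ hU _ Ux.
exists e => // y hy; case: (disk_cases y) => h1.
  by rewrite (cell_in _ _ h1).
by rewrite (cell_bd _ _ h1); apply: he.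
Qed.

(** A has the subspace topology of B, so a map into A found pointwise is continuous once it is
    continuous into B. *)
Lemma inl_cancel_cts {K} (OK : set (set K)) (F : K -> A) :
  cont OK (popens B) (fun p => inl (F p) : B) -> cont OK (popens A) F.
Proof. by move=> h U /with_cells_open /h. Qed.

(** Holds without any separation axiom on A, since the preimage of the point in the disjoint union
    is one interior point of one disk. *)
Lemma closed_cell_point j x : popens B [set b | b <> inr (j, x)].
Proof.
split.
  have -> : inl @^-1` (attach_r phi @^-1` [set b | b <> inr (j, x)]) = setT.
    by apply/seteqP; split.
  by case: tA.
move=> j' y0; change (cell j' y0 <> inr (j, x) -> exists2 e, 0 < e &
  forall y : mD m, @bl (mD m) y0 e y -> cell j' y <> inr (j, x)) => ne.
case: (pselect (exists i, proj1_sig y0 i <> proj1_sig x i)) => [[i hi]|eqx].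
  exists (Rabs (proj1_sig y0 i - proj1_sig x i)).
    by apply: Rabs_pos_lt; lra.
  move=> y hy; case: (disk_cases y) => h1; last by rewrite (cell_bd _ _ h1).
  rewrite (cell_in _ _ h1) => -[_ e]; move: (hy i); rewrite -e /= Rabs_minus_sym; lra.
have e0 : proj1_sig y0 = proj1_sig x.
  by apply/funext => i; apply: contrapT => ?; apply: eqx; exists i.
have h0 : sumsq (proj1_sig y0) < R1 by rewrite e0; exact: (proj2_sig x).
exists 1; first lra.
move=> y _; case: (disk_cases y) => h1; last by rewrite (cell_bd _ _ h1).
rewrite (cell_in _ _ h1) => -[ej _]; apply: ne; rewrite (cell_in _ _ h0) ej.
by congr (inr (_, _)); apply: sig_eq.
Qed.

End Attach.

(** * Pushing cubes off cells of larger dimension *)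

Section Avoid.
Local Open Scope R_scope.
Local Open Scope classical_set_scope.
Context {k : nat}.

Definition dist1 (p q : mC k) : R :=
  \big[Rplus/R0]_(i < k) Rabs (proj1_sig p i - proj1_sig q i).

Lemma dist1_ge p q i : Rabs (proj1_sig p i - proj1_sig q i) <= dist1 p q.
Proof.
rewrite /dist1; have : i \in index_enum 'I_k by rewrite mem_index_enum.
elim: (index_enum _) => // j s IH; rewrite inE big_cons => /orP[/eqP <-|/IH h].
  rewrite -[X in X <= _]Rplus_0_r; apply: Rplus_le_compat_l.
  by apply: big_ind => [|a b *|l _]; [exact: Rle_refl|lra|exact: Rabs_pos].
rewrite -[X in X <= _]Rplus_0_l; apply: Rplus_le_compat => //; exact: Rabs_pos.
Qed.

Lemma dist1_ge0 p q : 0 <= dist1 p q.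
Proof. by rewrite /dist1; apply: big_ind => [|a b *|l _]; [exact: Rle_refl|lra|exact: Rabs_pos]. Qed.

Lemma dist1_refl p : dist1 p p = 0.
Proof. by rewrite /dist1; apply: (big_ind (fun x => x = 0)) => [|a b -> ->|l _]; rewrite ?Rminus_diag ?Rabs_R0 //; lra. Qed.

Lemma dist1_tri p q r : dist1 p r <= dist1 p q + dist1 q r.
Proof.
rewrite /dist1; elim: (index_enum _) => [|i s IH]; first by rewrite !big_nil; lra.
rewrite !big_cons.
have := Rabs_triang (proj1_sig p i - proj1_sig q i) (proj1_sig q i - proj1_sig r i).
replace (proj1_sig p i - proj1_sig q i + (proj1_sig q i - proj1_sig r i))
  with (proj1_sig p i - proj1_sig r i) by lra.
set a := \big[_/_]_(j <- s) _ in IH *; set b := \big[_/_]_(j <- s) _ in IH *.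
set c := \big[_/_]_(j <- s) _ in IH *.
lra.
Qed.

Lemma dist1_le p q c : (forall i, Rabs (proj1_sig p i - proj1_sig q i) <= c) ->
  dist1 p q <= INR k * c.
Proof.
move=> h; have e : size (index_enum 'I_k) = k by rewrite -[RHS](size_enum_ord k) enumT [index_enum _]unlock.
rewrite -[in INR k]e {e} /dist1; elim: (index_enum _) => [|i s IH]; first by rewrite big_nil /=; lra.
rewrite big_cons; change (size (i :: s)) with (size s).+1; rewrite S_INR.
by rewrite Rmult_plus_distr_r Rplus_comm Rmult_1_l; apply: Rplus_le_compat.
Qed.

(* The witness is the inf-convolution of f with L * dist1. *)
Lemma lipschitz_approx (f : mC k -> R) e : 0 < e -> @mcts _ mR f -> (forall p, Rabs (f p) <= 1) ->
  exists (g : mC k -> R) L, [/\ 0 <= L, forall p, Rabs (g p - f p) <= e &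
    forall p q, g p - g q <= L * dist1 p q].
Proof.
move=> e0 cf bf; have [d d0 hd] := cube_unif _ cf _ e0.
have bf' p : - 1 <= f p <= 1 by have := bf p; rewrite /Rabs; case: Rcase_abs; lra.
(* With slope 2/d the points q not within d of p cost at least 2, the largest possible oscillation
   of f, so they do not lower the infimum below [f p]. *)
pose L := 2 / d; have L0 : 0 < L by apply: Rdiv_lt_0_compat; lra.
have Ld q p : 0 <= L * dist1 p q by apply: Rmult_le_pos; [lra|exact: dist1_ge0].
have inf p : exists c, (forall q, c <= f q + L * dist1 p q) /\
    (forall c', (forall q, c' <= f q + L * dist1 p q) -> c' <= c).
  have [||c [ub lub]] := completeness (fun c => forall q, c <= f q + L * dist1 p q).
  - by exists (f p) => c /(_ p); rewrite dist1_refl; lra.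
  - by exists (- 1) => q; have := bf' q; have := Ld q p; lra.
  exists c; split=> [q|c' hc']; last exact: ub.
  by apply: lub => c' /(_ q).
pose g p := projT1 (cid (inf p)).
have [g1 g2] : (forall p q, g p <= f q + L * dist1 p q) /\
    (forall p c', (forall q, c' <= f q + L * dist1 p q) -> c' <= g p).
  by split=> p; have [] := projT2 (cid (inf p)).
exists g, L; split=> [|p|p q]; first lra.
  have gf : g p <= f p by have := g1 p p; rewrite dist1_refl; lra.
  suff : f p - e <= g p by move=> ?; rewrite Rabs_left1; lra.
  apply: g2 => q; case: (pselect (bl p d q)) => [/hd/Rabs_def2 h|far].
    by have := Ld q p; lra.
  have [i hi] : exists i, ~ Rabs (proj1_sig q i - proj1_sig p i) < d.
    by apply: contrapT => h; apply: far => i; apply: contrapT => h'; apply: h; exists i.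
  have := dist1_ge p q i; rewrite Rabs_minus_sym => h.
  have : L * d <= L * dist1 p q by apply: Rmult_le_compat_l; lra.
  rewrite {1}/L /Rdiv Rmult_assoc Rinv_l; last lra.
  by have := bf' p; have := bf' q; lra.
suff : g p - L * dist1 p q <= g q by lra.
apply: g2 => r; have := g1 p r; have := dist1_tri p q r => h ?.
have : L * dist1 p r <= L * (dist1 p q + dist1 q r) by apply: Rmult_le_compat_l; lra.
lra.
Qed.

Lemma ord_floor n x : 0 <= x <= INR n -> (0 < n)%N ->
  exists v : 'I_n, INR v <= x <= INR v + 1.
Proof.
elim: n => // n IH hx _; rewrite S_INR in hx.
case: (Rle_lt_dec x (INR n)) => xn.
  case: n IH hx xn => [|n] IH hx xn; first by exists ord0; move: xn hx => /=; lra.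
  have [v hv] := IH (conj (proj1 hx) xn) isT.
  by exists (widen_ord (leqnSn _) v).
by exists ord_max => /=; lra.
Qed.

Lemma big_nat_gt (x : R) : exists n : nat, (0 < n)%N /\ x <= INR n.
Proof.
have [n hn] := INR_unbounded x; exists n.+1; split=> //.
by rewrite S_INR; lra.
Qed.

(* Pigeonhole: N^k cubes, each with image too small to be near two grid points, cannot
   come near all M^m grid points when N^k < M^m. *)
Lemma lipschitz_avoid {m} (km : (k < m)%N) (g : 'I_m -> mC k -> R) L e : 0 <= L -> 0 < e ->
  (forall i p q, g i p - g i q <= L * dist1 p q) ->
  exists (z : 'I_m -> R) d, [/\ 0 < d, forall i, Rabs (z i) <= e &
    forall p, exists i, d <= Rabs (g i p - z i)].
Proof.
move=> L0 e0 lip.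
have [c [c0 hc]] := big_nat_gt (2 * L * INR k / e).
(* M grid values per axis, 4d apart, and N subdivisions per side of the cube. Then N^k = c^k M^k <
   M^(k+1) <= M^m, while on a subcube of side 1/N each g i varies by at most Lk/N <= 2d by the
   choice of c. *)
pose M := (c ^ k).+1; pose N := (c * M)%N.
have cR : 0 < INR c by apply: lt_0_INR; apply/ltP.
have MR : 0 < INR M by apply: lt_0_INR; apply/ltP.
have NR : INR N = INR c * INR M by rewrite /N -mult_INR.
have N0 : (0 < N)%N by rewrite muln_gt0 c0.
pose d := e / (4 * INR M).
have d0 : 0 < d by apply: Rdiv_lt_0_compat; lra.
pose z (w : {ffun 'I_m -> 'I_M}) i := 4 * d * INR (w i).
suff [w hw] : exists w, forall p, exists i, d <= Rabs (g i p - z w i).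
  exists (z w), d; split=> // i.
  have wM : INR (w i) <= INR M by apply: le_INR; apply/leP/ltnW.
  have w0 := pos_INR (w i).
  rewrite /z Rabs_right; last by apply/Rle_ge/Rmult_le_pos; lra.
  have : 4 * d * INR (w i) <= 4 * d * INR M by apply: Rmult_le_compat_l; lra.
  have -> : 4 * d * INR M = e by rewrite /d; field; lra.
  by [].
apply: contrapT => none.
have close w : exists p, forall i, Rabs (g i p - z w i) < d.
  apply: contrapT => h; apply: none; exists w => p; apply: contrapT => h'.
  by apply: h; exists p => i; apply: Rnot_le_lt => ?; apply: h'; exists i.
have cellp (p : mC k) : exists v : {ffun 'I_k -> 'I_N},
    forall i, INR (v i) <= INR N * proj1_sig p i <= INR (v i) + 1.
  have h i : exists v : 'I_N, INR v <= INR N * proj1_sig p i <= INR v + 1.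
    apply: ord_floor => //; have [p0 p1] := proj2_sig p i; have N0' := pos_INR N.
    split; first exact: Rmult_le_pos.
    by rewrite -[X in _ <= X]Rmult_1_r; apply: Rmult_le_compat_l.
  by have [v hv] := choice h; exists (finfun v) => i; rewrite ffunE.
pose P w := projT1 (cid (close w)).
have hP w i : Rabs (g i (P w) - z w i) < d by exact: (projT2 (cid (close w))).
pose V w := projT1 (cid (cellp (P w))).
have hV w i : INR (V w i) <= INR N * proj1_sig (P w) i <= INR (V w i) + 1.
  exact: (projT2 (cid (cellp (P w))) i).
(* Grid points approached from the same subcube differ in each coordinate by less than d + 2d + d =
   4d, hence coincide. *)
have injV : injective V.
  move=> w w' eV.
  have NR0 : 0 < INR N by rewrite NR; apply: Rmult_lt_0_compat.
  have near i : Rabs (proj1_sig (P w) i - proj1_sig (P w') i) <= / INR N.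
    have h1 := hV w i; have h2 := hV w' i; rewrite -eV in h2.
    apply: (Rmult_le_reg_l (INR N)) => //; rewrite Rinv_r; last lra.
    rewrite -[X in X * Rabs _](Rabs_right (INR N)); last lra.
    by rewrite -Rabs_mult Rmult_minus_distr_l; apply: Rabs_le; lra.
  have ld : L * dist1 (P w) (P w') <= 2 * d.
    apply: Rle_trans (Rmult_le_compat_l _ _ _ L0 (dist1_le _ _ _ near)) _.
    rewrite NR /d; apply: (Rmult_le_reg_r (2 * INR c * INR M / e)).
      by apply: Rdiv_lt_0_compat => //; apply: Rmult_lt_0_compat; lra.
    have -> : L * (INR k * / (INR c * INR M)) * (2 * INR c * INR M / e) = 2 * L * INR k / e.
      by field; lra.
    have -> : 2 * (e / (4 * INR M)) * (2 * INR c * INR M / e) = INR c by field; lra.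
    exact: hc.
  have ld' : L * dist1 (P w') (P w) <= 2 * d.
    suff -> : dist1 (P w') (P w) = dist1 (P w) (P w') by [].
    by apply: eq_bigr => i _; exact: Rabs_minus_sym.
  apply/ffunP => i; apply: val_inj => /=.
  have /Rabs_def2 h1 := hP w i; have /Rabs_def2 h2 := hP w' i.
  have h3 := lip i (P w) (P w'); have h4 := lip i (P w') (P w).
  have lt a b : z a i - z b i < 4 * d -> (a i <= b i)%N.
    rewrite /z => h; rewrite leqNgt; apply/negP => /ltP/le_INR; rewrite S_INR => h'.
    have : 4 * d * (INR (b i) + 1) <= 4 * d * INR (a i) by apply: Rmult_le_compat_l; lra.
    lra.
  by apply/eqP; rewrite eqn_leq; apply/andP; split; apply: lt; lra.
have := leq_card V injV; rewrite !card_ffun !card_ord leqNgt => /negP; apply.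
rewrite /N expnMn; apply: (@leq_trans (M ^ k.+1)%N); last by rewrite leq_exp2l // ltnS expn_gt0 c0.
by rewrite expnS ltn_pmul2r ?expn_gt0 // /M.
Qed.

(** The perturbed map y + w is g - z, with g a Lipschitz approximation of y and z a value that g
    avoids, each within e/2. The uniform gap d later frees a whole ball around the cell centres. *)
Lemma perturb_avoid {m} (km : (k < m)%N) (y : mC k -> 'I_m -> R) e : 0 < e ->
  (forall i, @mcts _ mR (fun p => y p i)) -> (forall p i, Rabs (y p i) <= 1) ->
  exists (w : mC k -> 'I_m -> R) d, [/\ 0 < d, forall i, @mcts _ mR (fun p => w p i),
    forall p i, Rabs (w p i) <= e & forall p, exists i, d <= Rabs (y p i + w p i)].
Proof.
move=> e0 cy by_; have e2 : 0 < e / 2 by lra.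
have h i := lipschitz_approx (fun p => y p i) _ e2 (cy i) (fun p => by_ p i).
have [g hg] := choice h; have [L hL] := choice hg.
pose L' := \big[Rmax/R0]_(i < m) L i.
have LL i : L i <= L'.
  rewrite /L'; have : i \in index_enum 'I_m by rewrite mem_index_enum.
  elim: (index_enum _) => // j s IH; rewrite inE big_cons => /orP[/eqP <-|/IH hi].
    exact: Rmax_l.
  exact: Rle_trans hi (Rmax_r _ _).
have L'0 : 0 <= L'.
  rewrite /L'; apply: big_ind => [|a b a0 b0|i _]; first exact: Rle_refl.
    exact: Rle_trans a0 (Rmax_l _ _).
  by have [] := hL i.
have lip i p q : g i p - g i q <= L' * dist1 p q.
  have [_ _ hi] := hL i; apply: Rle_trans (hi p q) _.
  by apply: Rmult_le_compat_r; [exact: dist1_ge0|exact: LL].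
have [z [d [d0 hz hd]]] := lipschitz_avoid km g _ _ L'0 e2 lip.
exists (fun p i => g i p - y p i - z i), d; split=> // [i|p i|p].
- apply: rcts_sub; last exact: mcts_const.
  apply: rcts_sub => // p a a0; pose D := (L' + 1) * (INR k + 1).
  have k0 := pos_INR k.
  have D0 : 0 < D by apply: Rmult_lt_0_compat; lra.
  exists (a / D); first exact: Rdiv_lt_0_compat.
  move=> q hq.
  have sm : L' * (INR k * (a / D)) < a.
    have -> : L' * (INR k * (a / D)) = a * ((L' * INR k) / D) by rewrite /Rdiv; ring.
    rewrite -[X in _ < X]Rmult_1_r; apply: Rmult_lt_compat_l => //.
    apply: (Rmult_lt_reg_r D) => //; rewrite /Rdiv Rmult_assoc Rinv_l; last lra.
    rewrite /D; have := Rmult_le_pos _ _ L'0 k0; lra.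
  have near1 : L' * dist1 q p <= L' * (INR k * (a / D)).
    by apply: Rmult_le_compat_l => //; apply: dist1_le => j; apply: Rlt_le; exact: hq.
  have near2 : L' * dist1 p q <= L' * (INR k * (a / D)).
    apply: Rmult_le_compat_l => //; apply: dist1_le => j; rewrite Rabs_minus_sym.
    by apply: Rlt_le; exact: hq.
  by have := lip i q p; have := lip i p q; move=> *; apply: Rabs_def1; lra.
- have [_ hi _] := hL i; have := hi p; have := hz i.
  have := Rabs_triang (g i p - y p i) (- z i); rewrite Rabs_Ropp /Rminus; lra.
- have [i hi] := hd p; exists i.
  by replace (y p i + (g i p - y p i - z i)) with (g i p - z i) by lra.
Qed.

End Avoid.

(** * Radial clipping and a cutoff function *)

Section Clip.
Local Open Scope R_scope.
Context {m : nat}.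
Implicit Types x : 'I_m -> R.

Lemma clip_proof a x : sumsq (fun i => / Rmax a (sqrt (sumsq x)) * x i) <= R1.
Proof.
rewrite sumsq_scale; set s := sumsq x; have s0 : 0 <= s := sumsq_ge0 x.
have r0 := sqrt_pos s; have rr := sqrt_sqrt s s0.
have h := Rmax_r a (sqrt s); set M := Rmax a (sqrt s) in h *.
case: (Rle_lt_dec M 0) => M0.
  have e : sqrt s = 0 by lra.
  by rewrite -rr e; lra.
apply: (Rmult_le_reg_l (M * M)); first exact: Rmult_lt_0_compat.
have -> : M * M * (/ M * / M * s) = s by field; lra.
by rewrite -{1}rr; have := Rmult_le_compat _ _ _ _ r0 r0 h h; lra.
Qed.

(** This is x / max(a, |x|): the identity on the disk for a = 1, while for smaller positive a
    everything of norm at least a lands on the sphere. *)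
Definition clip (a : R) x : disk m :=
  exist (fun x : 'I_m -> R => sumsq x <= R1) _ (clip_proof a x).

Lemma sqrt_le1 s : s <= 1 -> sqrt s <= 1.
Proof. by move=> h; rewrite -sqrt_1; exact: sqrt_le_1_alt. Qed.

Lemma clip1 x : sumsq x <= 1 -> proj1_sig (clip 1 x) = x.
Proof.
move=> h /=; rewrite Rmax_left; last exact: sqrt_le1.
by apply/funext => i; lra.
Qed.

Lemma clip_sphere a x : a <= 1 -> sumsq x = 1 -> proj1_sig (clip a x) = x.
Proof. by move=> ha h /=; rewrite h sqrt_1 Rmax_right //; apply/funext => i; lra. Qed.

Lemma clip_far a x : 0 < a -> a * a <= sumsq x -> sumsq (proj1_sig (clip a x)) = R1.
Proof.
move=> a0 h /=; rewrite Rmax_right; first by apply: normalize_proof; nra.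
by rewrite -(sqrt_square a); [exact: sqrt_le_1_alt|lra].
Qed.

Lemma mcts_clip {K : mspace} (a : K -> R) (f : K -> 'I_m -> R) : (forall p, 0 < a p) ->
  @mcts K mR a -> (forall i, @mcts K mR (fun p => f p i)) ->
  @mcts K (mD m) (fun p => clip (a p) (f p)).
Proof.
move=> a0 ca cf; apply: mcts_Rk => i /=; apply: rcts_mul => //; apply: rcts_inv => [p|].
  by have := a0 p; have := Rmax_l (a p) (sqrt (sumsq (f p))); lra.
apply: rcts_max => //; apply: rcts_sqrt => [p|]; first exact: sumsq_ge0.
exact: rcts_sumsq.
Qed.

(** The argument is a squared norm: the value is 1 within radius 1/4 and 0 beyond radius 1/2, and
    16/3 is the slope between the squares 1/16 and 1/4. *)
Definition bump (s : R) := Rmax 0 (Rmin 1 ((/ 4 - s) * (16 / 3))).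

Lemma bump_01 s : 0 <= bump s <= 1.
Proof.
by split; [exact: Rmax_l|apply: Rmax_lub; [lra|exact: Rmin_l]].
Qed.

Lemma bump0 s : / 4 <= s -> bump s = 0.
Proof.
by move=> h; rewrite /bump Rmax_left //; apply: Rle_trans (Rmin_r _ _) _; lra.
Qed.

Lemma bump1 s : s <= / 16 -> bump s = 1.
Proof. by move=> h; rewrite /bump Rmin_left ?Rmax_right //; lra. Qed.

Lemma rcts_bump {K : mspace} (f : K -> R) : @mcts K mR f -> @mcts K mR (fun p => bump (f p)).
Proof.
move=> cf; apply: rcts_max; first exact: mcts_const.
apply: rcts_min; first exact: mcts_const.
apply: rcts_mul; last exact: mcts_const.
by apply: rcts_sub => //; exact: mcts_const.
Qed.

End Clip.

(** * Moving a cube out of the open cells *)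

Section Push.
Local Open Scope R_scope.
Local Open Scope classical_set_scope.
Context {A : pspace} {m : nat} {J : Type} {phi : J -> sphere m -> A}.
Hypothesis tA : is_top (popens A).
Hypothesis cphi : forall j, cont (opS m) (popens A) (phi j).
Notation B := (attach phi).
Notation cell := (@cell A m J phi).
Notation ball_cell := (@ball_cell A m J phi).

Lemma cell_eq j (x y : disk m) : proj1_sig x = proj1_sig y -> cell j x = cell j y.
Proof. by move=> e; congr (cell j _); apply: sig_eq. Qed.

Lemma cell_nbhd j (x : ball m) e : 0 < e ->
  popens B [set b | exists x' : ball m, b = inr (j, x') /\
    forall i, Rabs (proj1_sig x' i - proj1_sig x i) < e].
Proof.
move=> e0; split.
  have -> : inl @^-1` (attach_r phi @^-1` [set b | exists x' : ball m, b = inr (j, x') /\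
    forall i, Rabs (proj1_sig x' i - proj1_sig x i) < e]) = set0.
    by apply/seteqP; split=> // a [x' []].
  by apply: top_local.
move=> j' y0; set S := [set b | _].
change (S (cell j' y0) -> exists2 e, 0 < e &
  forall y : mD m, @bl (mD m) y0 e y -> S (cell j' y)).
case: (disk_cases y0) => h0; last by rewrite (cell_bd _ _ h0) => -[x' []].
rewrite (cell_in _ _ h0) => -[x' [[-> <-]] /= hx].
have cs : @mcts (mD m) mR (fun x => sumsq (proj1_sig x)).
  by apply: rcts_sumsq => i; exact: mcts_coord.
have [|d d0 hd] := cs y0 (1 - sumsq (proj1_sig y0)); first by simpl in *; lra.
have [i|d' d'0 hd'] := @fin_eps 'I_m (fun i d => forall t, Rabs (t - proj1_sig y0 i) < d ->
    Rabs (t - proj1_sig x i) < e).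
  have [d' d'0 hd'] := Rabs_open _ _ _ (hx i); exists d' => // e' ? t ht.
  by apply: hd'; lra.
exists (Rmin d d'); first exact: Rmin_gt0.
move=> y hy; have /Rabs_def2 /= hy1 := hd _ (bl_mono (mD m) _ _ _ _ (Rmin_l _ _) hy).
have hy2 : sumsq (proj1_sig y) < R1 by lra.
rewrite (cell_in _ _ hy2); exists (exist (fun x : 'I_m -> R => sumsq x < R1) _ hy2); split=> // i /=.
apply: (hd' d'); first lra.
exact: Rlt_le_trans (hy i) (Rmin_r _ _).
Qed.

(** The displacement w is given from outside and may vary with the point of the cube; the bump
    switches it off before the cell boundary is reached. *)
Definition nudge (b : B) (w : 'I_m -> R) : B :=
  match b with
  | inl a => inl a
  | inr (j, x) => cell j (clip 1 (fun i => proj1_sig x i + bump (sumsq (proj1_sig x)) * w i))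
  end.

(** The cell coordinate, cut off so as to be continuous on all of B. One map into R^m serves all
    cells simultaneously, so a single perturbation treats them together. *)
Definition inner (b : B) : 'I_m -> R :=
  if b is inr (j, x) then fun i => bump (sumsq (proj1_sig x)) * proj1_sig x i else fun=> 0.

Lemma inner_cell j (x : disk m) i :
  inner (cell j x) i = bump (sumsq (proj1_sig x)) * proj1_sig x i.
Proof.
case: (disk_cases x) => h; first by rewrite (cell_in _ _ h).
by rewrite (cell_bd _ _ h) h bump0 /=; lra.
Qed.

Lemma inner_cts i : cont (popens B) (mopen mR) (fun b => inner b i).
Proof.
apply: attach_cont; first exact: cont_const.
move=> j; apply: mcts_cont.
have -> : (fun x : disk m => inner (cell j x) i) =
   (fun x => bump (sumsq (proj1_sig x)) * proj1_sig x i).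
  by apply/funext => x; exact: inner_cell.
apply: rcts_mul; last exact: mcts_coord.
by apply: rcts_bump; apply: rcts_sumsq => l; exact: mcts_coord.
Qed.

Lemma inner_le1 b i : Rabs (inner b i) <= 1.
Proof.
case: b => [a|[j x]] /=; first by rewrite Rabs_R0; lra.
have [u0 u1] := bump_01 (sumsq (proj1_sig x)).
have := sumsq_coord (proj1_sig x) i; have := proj2_sig x => /= h1 h2.
rewrite Rabs_mult (Rabs_right (bump _)); last lra.
have : Rabs (proj1_sig x i) <= 1.
  by apply: Rabs_le; split; nra.
have := Rabs_pos (proj1_sig x i) => h3 h4.
by rewrite -(Rmult_1_r 1); apply: Rmult_le_compat.
Qed.

Lemma nudge0 b : nudge b (fun=> 0) = b.
Proof.
case: b => // -[j x] /=; rewrite (ball_cell j x); apply: cell_eq.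
have e : (fun i => proj1_sig x i + bump (sumsq (proj1_sig x)) * 0) = proj1_sig x.
  by apply/funext => i; lra.
by rewrite e clip1 //; have := proj2_sig x => /=; lra.
Qed.

(** B is covered by the open region where the bump vanishes, on which nudging is the identity, and
    the open cells, on which it is a formula in coordinates. *)
Lemma nudge_cts {K : mspace} (F : K -> B) (w : K -> 'I_m -> R) :
  cont (mopen K) (popens B) F -> (forall i, @mcts K mR (fun p => w p i)) ->
  cont (mopen K) (popens B) (fun p => nudge (F p) (w p)).
Proof.
move=> cF cw.
pose far := [set b : B | if b is inr (j, x) then / 4 < sumsq (proj1_sig x) else True].
have far_open : popens B far.
  split; first by case: tA.
  move=> j x0; change (far (cell j x0) -> exists2 e, 0 < e &
    forall y : mD m, @bl (mD m) x0 e y -> far (cell j y)).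
  have far_cell x : far (cell j x) <-> / 4 < sumsq (proj1_sig x).
    case: (disk_cases x) => h; first by rewrite (cell_in _ _ h).
    by rewrite (cell_bd _ _ h) h; split=> //= _; lra.
  rewrite far_cell => h; have cs : @mcts (mD m) mR (fun x => sumsq (proj1_sig x)).
    by apply: rcts_sumsq => i; exact: mcts_coord.
  have [|d d0 hd] := cs x0 (sumsq (proj1_sig x0) - / 4); first by simpl in *; lra.
  by exists d => // y /hd /Rabs_def2 /= hy; rewrite far_cell; lra.
have nudge_far b v : far b -> nudge b v = b.
  case: b => // -[j x] /= hx; rewrite (ball_cell j x); apply: cell_eq.
  have e : (fun i => proj1_sig x i + bump (sumsq (proj1_sig x)) * v i) = proj1_sig x.
    by apply/funext => i; rewrite bump0; lra.
  by rewrite e clip1 //; have := proj2_sig x => /=; lra.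
move=> V hV p; rewrite /preimage /= => Vp.
case: (pselect (far (F p))) => [fp|nfp].
  have [d d0 hd] := cF _ far_open _ fp.
  have [|d' d'0 hd'] := cF _ hV p; first by rewrite /preimage /= -(nudge_far _ (w p) fp).
  exists (Rmin d d'); first exact: Rmin_gt0.
  move=> q hq; rewrite nudge_far.
    exact: hd' (bl_mono _ _ _ _ _ (Rmin_r _ _) hq).
  exact: hd (bl_mono _ _ _ _ _ (Rmin_l _ _) hq).
case eFp : (F p) nfp Vp => [a|[j x]]; first by case.
move=> _ Vp; pose mW := mRk (fun _ : 'I_m -> R => True).
pose G (xw : mprod (mD m) mW) := clip 1 (fun i => proj1_sig xw.1 i +
    bump (sumsq (proj1_sig xw.1)) * proj1_sig xw.2 i).
have cG : @mcts (mprod (mD m) mW) (mD m) G.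
  apply: mcts_clip => [_||i]; [lra|exact: mcts_const|].
  have cx l : @mcts (mprod (mD m) mW) mR (fun xw => proj1_sig xw.1 l).
    exact: mcts_comp mcts_fst (mcts_coord l).
  apply: rcts_add; first exact: cx.
  apply: rcts_mul; last exact: mcts_comp mcts_snd (mcts_coord i).
  by apply: rcts_bump; apply: rcts_sumsq.
pose x' : disk m := exist _ (proj1_sig x) (Rlt_le _ _ (proj2_sig x)).
pose W q : mW := exist (fun=> True) (w q) Logic.I.
have [d d0 hd] := cont_comp _ _ _ _ _ (mcts_cont _ cG) (cell_cts j) _ hV (x', W p) Vp.
have cW : @mcts K mW W by apply: mcts_Rk.
have [d1 d10 hd1] := cW p d d0.
have [|d2 d20 hd2] := cF _ (cell_nbhd j x d d0) p.
  rewrite /preimage /= eFp; exists x; split=> // i.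
  by rewrite Rminus_diag Rabs_R0.
exists (Rmin d1 d2); first exact: Rmin_gt0.
move=> q hq.
have [y [eFq hy]] := hd2 _ (bl_mono _ _ _ _ _ (Rmin_r _ _) hq).
rewrite eFq.
apply: (hd (exist _ (proj1_sig y) (Rlt_le _ _ (proj2_sig y)), W q)); split=> //.
exact: hd1 (bl_mono _ _ _ _ _ (Rmin_l _ _) hq).
Qed.

(** Running a from 1 downwards deforms the cell outwards and carries all points of norm at least a
    to its boundary. *)
Definition spread (b : B) (a : R) : B :=
  if b is inr (j, x) then cell j (clip a (proj1_sig x)) else b.

Lemma spread_cell j (x : disk m) a : a <= 1 -> spread (cell j x) a = cell j (clip a (proj1_sig x)).
Proof.
move=> ha; case: (disk_cases x) => h; first by rewrite (cell_in _ _ h).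
rewrite (cell_bd _ _ h) /=.
have h' : sumsq (proj1_sig (clip a (proj1_sig x))) = R1.
  by rewrite clip_sphere.
rewrite (cell_bd _ _ h'); congr (inl (phi _ _)); apply: sig_eq => /=.
by have /= -> := clip_sphere a _ ha h.
Qed.

(* A k-cube can be pushed off m-cells when k < m: first nudge it away from the centres
   of the cells, then spread each punctured cell radially onto its boundary. *)
Lemma push_off_cells {k} (F : mC k -> B) : (k < m)%N -> cont (mopen (mC k)) (popens B) F ->
  (forall p, cbd p -> exists a, F p = inl a) ->
  exists2 F' : mC k -> A, cont (mopen (mC k)) (popens A) F' & hrel F (fun p => inl (F' p) : B).
Proof.
move=> km cF bF.
(* Makes |w|^2 at most m e^2 <= 1/64, small against the radii 1/4 and 1/2 of the bump. *)
pose e := / (8 * (INR m + 1)).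
have m0 := pos_INR m.
have e0 : 0 < e by apply: Rinv_0_lt_compat; lra.
have [i|p i|w [d [d0 cw bw hd]]] := perturb_avoid km (fun p => inner (F p)) e e0.
- exact/mctsP/(cont_comp _ _ _ _ _ cF (inner_cts i)).
- exact: inner_le1.
have wsmall p : sumsq (w p) <= / 64.
  apply: Rle_trans (sumsq_le _ _ (bw p)) _.
  have -> : INR m * (e * e) = (INR m / ((INR m + 1) * (INR m + 1))) * / 64.
    by rewrite /e; field; lra.
  rewrite -[X in _ <= X]Rmult_1_l; apply: Rmult_le_compat_r; first lra.
  apply: (Rmult_le_reg_r ((INR m + 1) * (INR m + 1))); first by nra.
  rewrite /Rdiv Rmult_assoc Rinv_l; nra.
pose F1 p := nudge (F p) (w p).
have h1 : hrel F F1.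
  exists (fun pt => nudge (F pt.1) (fun i => proj1_sig pt.2 * w pt.1 i)); split.
  - apply: nudge_cts => [|i]; first exact: cont_comp (mcts_cont _ mcts_fst) cF.
    by apply: rcts_mul; [exact: mcts_comp mcts_snd mcts_val|exact: mcts_comp mcts_fst (cw i)].
  - move=> p /=; have -> : (fun i => R0 * w p i) = fun=> 0 by apply/funext => i; lra.
    exact: nudge0.
  - by move=> p; congr nudge; apply/funext => i /=; lra.
  - by move=> p t /bF /= [a ->].
have cF1 : cont (mopen (mC k)) (popens B) F1 by exact: nudge_cts.
(* Squared radius of a ball around each centre that F1 avoids. From within radius 1/4 the bump is 1
   and the perturbation gives d * d; from further out, 1/16 < 2 |v|^2 + 2/64 gives 1/64. *)
pose h := Rmin (d * d) (/ 64).
have h0 : 0 < h by apply: Rmin_gt0; [exact: Rmult_lt_0_compat|lra].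
have hh : h <= / 64 := Rmin_r _ _.
have hdd : h <= d * d := Rmin_l _ _.
have F1far p j (x : ball m) : F1 p = inr (j, x) -> h <= sumsq (proj1_sig x).
  rewrite /F1; have := hd p; have := wsmall p; case: (F p) => [//|[j' y]] /= ws [i hi].
  set v := fun i => _ => ev.
  have [y0 y1] : 0 <= sumsq (proj1_sig y) /\ sumsq (proj1_sig y) < 1.
    by split; [exact: sumsq_ge0|exact: (proj2_sig y)].
  have [u0 u1] := bump_01 (sumsq (proj1_sig y)).
  have uw : sumsq (fun i => bump (sumsq (proj1_sig y)) * w p i) <= / 64.
    rewrite sumsq_scale; have := sumsq_ge0 (w p) => ?; nra.
  have v1 : sumsq v < 1.
    case: (Rle_lt_dec (/ 4) (sumsq (proj1_sig y))) => y4.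
      suff -> : v = proj1_sig y by [].
      by apply/funext => l; rewrite /v bump0 //; lra.
    by have := sumsq_add (proj1_sig y) (fun i => bump (sumsq (proj1_sig y)) * w p i); rewrite -/v; lra.
  have cv : proj1_sig (clip 1 v) = v by apply: clip1; lra.
  have v1' : sumsq (proj1_sig (clip 1 v)) < R1 by rewrite cv.
  have ex : proj1_sig x = v.
    by move: ev; rewrite (cell_in _ _ v1') => -[_ <-].
  rewrite ex; case: (Rle_lt_dec (sumsq (proj1_sig y)) (/ 16)) => y16.
    have := sumsq_coord v i; move: hi; rewrite /v bump1 // !Rmult_1_l.
    set t := proj1_sig y i + w p i => hi ?.
    have : d * d <= Rabs t * Rabs t by apply: Rmult_le_compat; lra.
    by rewrite -Rabs_mult Rabs_right; [lra|exact/Rle_ge/Rle_0_sqr].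
  have : sumsq (proj1_sig y) <= 2 * sumsq v +
      2 * sumsq (fun i => (-1) * (bump (sumsq (proj1_sig y)) * w p i)).
    apply: Rle_trans (sumsq_add _ _); right; congr sumsq; apply/funext => l.
    by rewrite /v; ring.
  by rewrite (sumsq_scale (-1)); lra.
pose a := sqrt h.
have a0 : 0 < a by exact: sqrt_lt_R0.
have aa : a * a = h by apply: sqrt_sqrt; lra.
have a1 : a <= 1 by apply: sqrt_le1; lra.
pose at_ t := 1 - t + t * a.
have at0 (t : I) : 0 < at_ (proj1_sig t).
  rewrite /at_; case: t => t /= [t0 t1].
  by have := Rmult_le_compat_l t _ _ t0 a1; have := Rmult_le_pos t _ t0 (Rlt_le _ _ a0); nra.
have at1 (t : I) : at_ (proj1_sig t) <= 1.
  by rewrite /at_; case: t => t /= [t0 t1]; have := Rmult_le_compat_l t _ _ t0 a1; lra.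
have cs : cont (prod_opens (popens B) opI) (popens B) (fun bt => spread bt.1 (at_ (proj1_sig bt.2))).
  apply: attach_cont_prod => //.
    apply: cont_comp (cont_fst _ _ opI_top) _; exact: inl_cts.
  move=> j; have -> : (fun p : disk m * I => spread (cell j p.1, p.2).1 (at_ (proj1_sig (cell j p.1, p.2).2))) =
    (fun p => cell j (clip (at_ (proj1_sig p.2)) (proj1_sig p.1))).
    by apply/funext => p; exact: spread_cell.
  apply: cont_comp _ (cell_cts j); apply: mcts_cont.
  have ct : @mcts (mprod (mD m) mI) mR (fun p => proj1_sig p.2).
    exact: mcts_comp mcts_snd mcts_val.
  apply: mcts_clip => [p||i]; first exact: at0.
    apply: rcts_add; last by apply: rcts_mul => //; exact: mcts_const.
    by apply: rcts_sub => //; exact: mcts_const.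
  exact: mcts_comp mcts_fst (mcts_coord i).
have F2A p : exists a', spread (F1 p) a = inl a'.
  case e1 : (F1 p) => [a'|[j x]]; first by exists a'.
  have far : sumsq (proj1_sig (clip a (proj1_sig x))) = R1.
    by apply: clip_far => //; rewrite aa; exact: F1far e1.
  by rewrite /= (cell_bd _ _ far); eexists.
have [F' eF'] := choice F2A.
have h2 : hrel F1 (fun p => inl (F' p) : B).
  exists (fun pt => spread (F1 pt.1) (at_ (proj1_sig pt.2))); split.
  - have c1 : cont (mopen (mprod (mC k) mI)) (prod_opens (popens B) opI) (fun pt => (F1 pt.1, pt.2)).
      apply: cont_pair; first exact: mopen_top.
        exact: cont_comp (mcts_cont _ mcts_fst) cF1.
      exact: mcts_cont _ mcts_snd.
    exact: cont_comp c1 cs.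
  - move=> p /=; have -> : at_ R0 = 1 by rewrite /at_; lra.
    case: (F1 p) => // -[j x] /=; rewrite (ball_cell j x); apply: cell_eq.
    by rewrite clip1 //; have := proj2_sig x => /=; lra.
  - by move=> p /=; have -> : at_ R1 = a by rewrite /at_; lra.
  - by move=> p t /bF /= [a' ea]; rewrite /F1 ea.
exists F'; last exact: hrel_trans h1 h2.
apply: (inl_cancel_cts cphi).
have -> : (fun p => inl (F' p) : B) = fun p => spread (F1 p) (at_ (proj1_sig I1)).
  by apply/funext => p; rewrite -eF' /= /at_; congr spread; lra.
have c1 : cont (mopen (mC k)) (prod_opens (popens B) opI) (fun p => (F1 p, I1)).
  by apply: cont_pair => //; [exact: mopen_top|apply: cont_const; exact: mopen_top].
exact: cont_comp c1 cs.
Qed.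

End Push.

(** * Flat bundles and holonomy *)

Section LocallyConstant.
Local Open Scope R_scope.

Lemma locconst_I {T} (f : I -> T) :
  (forall t, exists2 d, 0 < d & forall s : I, @bl mI t d s -> f s = f t) -> f I0 = f I1.
Proof.
move=> lc.
suff : f (clampI 0) = f (clampI 1).
  by rewrite (clampI_le0 0) ?(clampI_ge1 1) //; lra.
apply: (interval_ind (fun s t => f (clampI s) = f (clampI t))) => [|x hx|s m t _ _ -> //].
  lra.
have [d d0 hd] := lc (clampI x); exists d => // s t xs tx s0 st t1.
have cl y : 0 <= y <= 1 -> proj1_sig (clampI y) = y.
  by move=> hy; rewrite /= /Rmax /Rmin; do 2 case: Rle_dec; lra.
by rewrite !hd //; apply: Rabs_def1; rewrite !cl; lra.
Qed.

Lemma seg_proof {k} (p q : mC k) (t : I) :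
  in_cube (fun i => proj1_sig p i + proj1_sig t * (proj1_sig q i - proj1_sig p i)).
Proof.
move=> i; have := proj2_sig p i; have := proj2_sig q i; case: t => t /= [t0 t1] hq hp.
by split; nra.
Qed.

Definition seg {k} (p q : mC k) (t : I) : mC k := exist in_cube _ (seg_proof p q t).

Lemma seg0 {k} (p q : mC k) : seg p q I0 = p.
Proof. by apply: sig_eq; apply/funext => i /=; lra. Qed.

Lemma seg1 {k} (p q : mC k) : seg p q I1 = q.
Proof. by apply: sig_eq; apply/funext => i /=; lra. Qed.

Lemma mcts_seg {k} (p q : mC k) : @mcts mI (mC k) (seg p q).
Proof.
apply: mcts_Rk => i /=; apply: rcts_add; first exact: mcts_const.
by apply: rcts_mul; [exact: mcts_val|exact: mcts_const].
Qed.

Lemma seg_bl {k} (p q : mC k) d t : bl p d q -> bl p d (seg p q t).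
Proof.
move=> h i /=; have /= /Rabs_def2 := h i; case: t => t /= [t0 t1] hi.
by apply: Rabs_def1; nra.
Qed.

Lemma locconst_comp {K K' : mspace} {T} (f : K' -> T) (g : K -> K') : mcts g ->
  (forall t, exists2 d, 0 < d & forall s, bl t d s -> f s = f t) ->
  (forall t, exists2 d, 0 < d & forall s, bl t d s -> f (g s) = f (g t)).
Proof.
move=> cg lf t; have [d d0 hd] := lf (g t); have [d' d'0 hd'] := cg t d d0.
by exists d' => // s /hd' /hd.
Qed.

Lemma locconst_cube {k} {T} (f : mC k -> T) :
  (forall t, exists2 d, 0 < d & forall s, bl t d s -> f s = f t) -> forall p q, f p = f q.
Proof.
move=> lf p q; rewrite -(seg0 p q) -[in RHS](seg1 p q).
exact: locconst_I (locconst_comp f _ (mcts_seg p q) lf).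
Qed.

End LocallyConstant.

Section Flat.
Local Open Scope R_scope.
Local Open Scope classical_set_scope.
Variables (G : Type) (OG : set (set G)) (mul : G -> G -> G) (inv : G -> G) (e : G).
Hypothesis hG : is_topgroup OG mul inv e.
Notation "x ** y" := (mul x y) (at level 40, left associativity).

Lemma gA x y z : x ** (y ** z) = x ** y ** z. Proof. by case: hG => -[]. Qed.
Lemma g1l x : e ** x = x. Proof. by case: hG => -[]. Qed.
Lemma g1r x : x ** e = x. Proof. by case: hG => -[]. Qed.
Lemma gVl x : inv x ** x = e. Proof. by case: hG => -[]. Qed.
Lemma gVr x : x ** inv x = e. Proof. by case: hG => -[]. Qed.
Lemma gK x y : inv x ** (x ** y) = y. Proof. by rewrite gA gVl g1l. Qed.
Lemma gKV x y : x ** (inv x ** y) = y. Proof. by rewrite gA gVr g1l. Qed.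
Lemma gKr x y : y ** x ** inv x = y. Proof. by rewrite -gA gVr g1r. Qed.
Lemma gKVr x y : y ** inv x ** x = y. Proof. by rewrite -gA gVl g1r. Qed.
Lemma gI x y z : x ** y = x ** z -> y = z.
Proof. by move=> h; rewrite -(gK x y) h gK. Qed.
Lemma gIr x y z : y ** x = z ** x -> y = z.
Proof. by move=> h; rewrite -(gKr x y) h gKr. Qed.
Lemma g_inv1 : inv e = e. Proof. by rewrite -[LHS]g1r gVl. Qed.
Lemma gVM x y : inv (x ** y) = inv y ** inv x.
Proof. by apply: (gI (x ** y)); rewrite gVr gA gKr gVr. Qed.

Lemma OG_top : is_top OG. Proof. by case: hG => _ []. Qed.

Lemma OG_mul a b W : OG W -> W (a ** b) -> exists W1 W2,
  [/\ OG W1, OG W2, W1 a, W2 b & forall x y, W1 x -> W2 y -> W (x ** y)].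
Proof.
have [_ [tG cm _]] := hG.
by move=> hW Wab; have /prod_opensP := cm _ hW; apply; [exact: tG|exact: tG|exact: Wab].
Qed.

(* A chart (U, u) is a trivialisation over U of a flat G-bundle whose total space is Y x G
   as a set; transition functions are continuous and constant along paths. *)
Definition chart (Y : Type) := (set Y * (Y -> G))%type.

(** The last clause asks for constancy along paths lying in the overlap, not for local constancy on
    it: Y need not be locally path connected, and transition functions may vary from one path
    component to another. *)
Definition is_flat (Y : pspace) (C : set (chart Y)) : Prop :=
  [/\ is_top (popens Y), forall c, C c -> popens Y c.1,
      forall y, exists2 c, C c & c.1 y,
      forall c c' W, C c -> C c' -> OG W ->
        popens Y [set y | [/\ c.1 y, c'.1 y & W (inv (c.2 y) ** c'.2 y)]] &
      forall c c' (g : I -> Y), C c -> C c' -> cont opI (popens Y) g ->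
        (forall t, c.1 (g t) /\ c'.1 (g t)) ->
        inv (c.2 (g I0)) ** c'.2 (g I0) = inv (c.2 (g I1)) ** c'.2 (g I1)].

(** A horizontal lift: in each chart the fibre coordinate of (F p, L p) is locally constant. Neither
    L nor [c.2] is continuous in general; only their product is controlled. Left translation by G
    preserves lifts. *)
Definition flift {Y : pspace} (C : set (chart Y)) {K : mspace} (F : K -> Y) (L : K -> G) :=
  forall p c, C c -> c.1 (F p) -> exists2 d, 0 < d &
    forall q, bl p d q -> L q ** c.2 (F q) = L p ** c.2 (F p).

Section FlatTheory.
Context {Y : pspace} {C : set (chart Y)}.
Hypothesis hC : is_flat Y C.

Lemma flift_comp {K K' : mspace} (F : K' -> Y) L (g : K -> K') : mcts g ->
  flift C F L -> flift C (fun x => F (g x)) (fun x => L (g x)).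
Proof.
move=> cg hL p c Cc cp; have [d d0 hd] := hL _ c Cc cp; have [d' d'0 hd'] := cg p d d0.
by exists d' => // q /hd' /hd.
Qed.

Lemma flift_mul {K : mspace} (F : K -> Y) L g : flift C F L -> flift C F (fun x => g ** L x).
Proof.
by move=> hL p c Cc cp; have [d d0 hd] := hL p c Cc cp; exists d => // q /hd h; rewrite -!gA h.
Qed.

Lemma flift_ratio {K : mspace} (F : K -> Y) L L' : cont (mopen K) (popens Y) F ->
  flift C F L -> flift C F L' -> forall p, exists2 d, 0 < d & forall q, bl p d q ->
    L q ** inv (L' q) = L p ** inv (L' p).
Proof.
move=> cF hL hL' p; have [_ _ cov _ _] := hC; have [c Cc cp] := cov (F p).
have [d d0 hd] := hL _ c Cc cp; have [d' d'0 hd'] := hL' _ c Cc cp.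
have key x y u : x ** inv y = (x ** u) ** inv (y ** u) by rewrite gVM gA gKr.
exists (Rmin d d'); first exact: Rmin_gt0.
move=> q hq; rewrite (key _ _ (c.2 (F q))) hd ?hd' -?key //; apply: bl_mono hq;
  [exact: Rmin_r|exact: Rmin_l].
Qed.

Lemma flift_unique {k} (F : mC k -> Y) L L' : cont (mopen (mC k)) (popens Y) F ->
  flift C F L -> flift C F L' -> forall p q, inv (L p) ** L q = inv (L' p) ** L' q.
Proof.
move=> cF hL hL' p q; have := locconst_cube _ (flift_ratio _ _ _ cF hL hL') q p.
move=> h; rewrite -(gKVr (L' q) (L q)) h -gA gK.
by [].
Qed.

(** Balls in a cube contain the segments to their centre, which turns constancy along paths in Y
    into local constancy on the cube. *)
Lemma transition_const {k} (F : mC k -> Y) c c' p : cont (mopen (mC k)) (popens Y) F ->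
  C c -> C c' -> c.1 (F p) -> c'.1 (F p) -> exists2 d, 0 < d &
  forall q, bl p d q -> inv (c.2 (F q)) ** c'.2 (F q) = inv (c.2 (F p)) ** c'.2 (F p).
Proof.
move=> cF Cc Cc' cp cp'; have [_ op _ _ path] := hC.
have [d d0 hd] := cF _ (op _ Cc) _ cp; have [d' d'0 hd'] := cF _ (op _ Cc') _ cp'.
exists (Rmin d d'); first exact: Rmin_gt0.
move=> q hq.
have := path c c' (fun t => F (seg p q t)) Cc Cc'; rewrite seg0 seg1 => <- //.
  exact: cont_comp (mcts_cont _ (mcts_seg p q)) cF.
move=> t; have ht := seg_bl _ _ _ t hq; split; [apply: hd|apply: hd']; apply: bl_mono ht;
  [exact: Rmin_l|exact: Rmin_r].
Qed.

(** Over a small box inside a chart, [inv (c.2 (F q))] is a lift. Lifts over the two halves of a box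
    differ by a constant left factor on the common face, which is convex, so translating one of them
    makes them fit. *)
Lemma flift_cube {k} (F : mC k -> Y) : cont (mopen (mC k)) (popens Y) F ->
  exists L, flift C F L.
Proof.
move=> cF; have [tY op cov _ _] := hC.
suff [L hL] : exists L : mC k -> G, forall p c, in_box (fun=> 0) (fun=> 1) p -> C c -> c.1 (F p) ->
    exists2 d, 0 < d & forall q, in_box (fun=> 0) (fun=> 1) q -> bl p d q ->
      L q ** c.2 (F q) = L p ** c.2 (F p).
  exists L => p c Cc cp; have [d d0 hd] := hL p c (in_box_full p) Cc cp.
  by exists d => // q; apply: hd; exact: in_box_full.
apply: (box_ind (fun l u => exists L : mC k -> G, forall p c, in_box l u p -> C c -> c.1 (F p) ->
    exists2 d, 0 < d & forall q, in_box l u q -> bl p d q ->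
      L q ** c.2 (F q) = L p ** c.2 (F p))) => [x hx|l u d m b hm [L1 h1] [L2 h2]].
  have [c Cc cx] := cov (F (exist in_cube x hx)).
  have [d d0 hd] := cF _ (op _ Cc) _ cx.
  exists d => // l u b hlu; exists (fun q => inv (c.2 (F q))) => p c' bp Cc' cp'.
  have cp : c.1 (F p) by apply: hd; exact: (in_box_close (exist in_cube x hx)) hlu bp.
  have [d' d'0 hd'] := transition_const _ _ _ _ cF Cc Cc' cp cp'.
  by exists d' => // q _; exact: hd'.
have hp0 : in_cube (upd l d m).
  by move=> i; rewrite /upd; have := b i; have := b d; case: eqP => [->|_]; lra.
have [p0 ep0] : exists p0 : mC k, proj1_sig p0 = upd l d m by exists (exist in_cube _ hp0).
pose face (p : mC k) := in_box l (upd u d m) p /\ in_box (upd l d m) u p.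
have faceE p : face p <-> in_box l u p /\ proj1_sig p d = m.
  rewrite /face; split=> [[f1 f2]|[f1 f2]].
    have f1d := f1 d; have f2d := f2 d; rewrite /upd eqxx in f1d f2d.
    split; last by lra.
    by move=> i; have := f1 i; have := f2 i; rewrite /upd; case: eqP => [->|_]; lra.
  by split=> i; have := f1 i; rewrite /upd; case: eqP => [->|_]; lra.
have f0 : face p0.
  by apply/faceE; split=> [i|]; rewrite ep0 /upd ?eqxx //; have := b i; case: eqP => [->|_]; lra.
have fconst p : face p -> L2 p ** inv (L1 p) = L2 p0 ** inv (L1 p0).
  move=> fp.
  have fs t : face (seg p0 p t).
    move: f0 fp => /faceE [f1 f2] /faceE [f3 f4]; apply/faceE; split; last first.
      by rewrite /= f2 f4; lra.
    by move=> i; have := f1 i; have := f3 i; case: t => t /= [t0 t1]; nra.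
  suff h : forall t, exists2 r, 0 < r & forall s : I, @bl mI t r s ->
      L2 (seg p0 p s) ** inv (L1 (seg p0 p s)) = L2 (seg p0 p t) ** inv (L1 (seg p0 p t)).
    have := locconst_I (fun t => L2 (seg p0 p t) ** inv (L1 (seg p0 p t))) h.
    by rewrite seg0 seg1 => ->.
  move=> t; have [fa fb] := fs t; have [c Cc cp] := cov (F (seg p0 p t)).
  have [r1 r10 hr1] := h1 _ c fa Cc cp; have [r2 r20 hr2] := h2 _ c fb Cc cp.
  have [r r0 hr] := mcts_seg p0 p t (Rmin r1 r2) (Rmin_gt0 _ _ r10 r20).
  have key x y v : x ** inv y = (x ** v) ** inv (y ** v) by rewrite gVM gA gKr.
  exists r => // s /hr hs; have [fa' fb'] := fs s.
  rewrite (key _ _ (c.2 (F (seg p0 p s)))) hr1 ?hr2 -?key //; apply: bl_mono hs;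
    [exact: Rmin_r|exact: Rmin_l].
pose g := L2 p0 ** inv (L1 p0).
exists (fun q => if Rle_dec (proj1_sig q d) m then g ** L1 q else L2 q) => p c bp Cc cp.
have lo q : in_box l u q -> proj1_sig q d <= m -> in_box l (upd u d m) q.
  by move=> bq hq i; have := bq i; rewrite /upd; case: eqP => [->|_]; lra.
have hi q : in_box l u q -> m <= proj1_sig q d -> in_box (upd l d m) u q.
  by move=> bq hq i; have := bq i; rewrite /upd; case: eqP => [->|_]; lra.
case: (Rtotal_order (proj1_sig p d) m) => [pm|[pm|pm]].
- have [|r r0 hr] := h1 p c _ Cc cp; first by apply: lo => //; lra.
  exists (Rmin r (m - proj1_sig p d)); first by apply: Rmin_gt0; lra.
  move=> q bq hq; have /Rabs_def2 := hq d.
  have := Rmin_r r (m - proj1_sig p d) => ? ?.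
  case: Rle_dec => ? /=; last lra; case: Rle_dec => ? /=; last lra.
  rewrite -!gA hr //; first by apply: lo.
  by apply: bl_mono hq; exact: Rmin_l.
- have [|r1 r10 hr1] := h1 p c _ Cc cp; first by apply: lo => //; lra.
  have [|r2 r20 hr2] := h2 p c _ Cc cp; first by apply: hi => //; lra.
  exists (Rmin r1 r2); first exact: Rmin_gt0.
  have gp : g ** L1 p = L2 p by rewrite /g -(fconst p) ?gKVr //; apply/faceE.
  move=> q bq hq; case: (Rle_dec (proj1_sig p d) m) => ? /=; last lra.
  case: Rle_dec => qm /=.
    rewrite -!gA hr1 //; first exact: lo.
    by apply: bl_mono hq; exact: Rmin_l.
  rewrite gp hr2 //; first by apply: hi => //; lra.
  by apply: bl_mono hq; exact: Rmin_r.
- have [|r r0 hr] := h2 p c _ Cc cp; first by apply: hi => //; lra.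
  exists (Rmin r (proj1_sig p d - m)); first by apply: Rmin_gt0; lra.
  move=> q bq hq; have /Rabs_def2 := hq d.
  have := Rmin_r r (proj1_sig p d - m) => ? ?.
  case: Rle_dec => ? /=; first lra; case: Rle_dec => ? /=; first lra.
  rewrite hr //; first by apply: hi => //; lra.
  by apply: bl_mono hq; exact: Rmin_l.
Qed.

Lemma flift_I (a : I -> Y) : cont opI (popens Y) a -> exists L, @flift Y C mI a L.
Proof.
move=> ca; have [L hL] := flift_cube _ (cont_comp _ _ _ _ _ (mcts_cont _ (@mcts_chead 0)) ca).
exists (fun t => L (cube1 t)); have := flift_comp _ _ _ mcts_cube1 hL.
by have -> : (fun x => a (chead (cube1 x))) = a by apply/funext => t; rewrite chead_cube1.
Qed.

(** The expression is unchanged by left translation of the lift, hence independent of the chosen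
    one; e stands for paths without a lift, and by [flift_I] continuous paths have one. *)
Definition hol (a : I -> Y) : G :=
  if pselect (exists L, @flift Y C mI a L) is left h
  then inv (projT1 (cid h) I0) ** projT1 (cid h) I1 else e.

Lemma holE a L : cont opI (popens Y) a -> @flift Y C mI a L -> hol a = inv (L I0) ** L I1.
Proof.
move=> ca hL; rewrite /hol; case: pselect => [h|[]]; last by exists L.
have h1 := flift_comp _ _ _ (@mcts_chead 0) (projT2 (cid h)).
have h2 := flift_comp _ _ _ (@mcts_chead 0) hL.
have := flift_unique _ _ _ (cont_comp _ _ _ _ _ (mcts_cont _ (@mcts_chead 0)) ca) h1 h2
  (cube1 I0) (cube1 I1).
by rewrite !chead_cube1.
Qed.

Lemma lift_base_const (L : I -> G) : @flift Y C mI (fun=> base Y) L -> L I0 = L I1.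
Proof.
move=> hL; have [_ _ cov _ _] := hC; have [c Cc cb] := cov (base Y).
apply: locconst_I => t; have [d d0 hd] := hL t c Cc cb.
by exists d => // s /hd /gIr.
Qed.

(** A lift over the whole square is constant on the two sides mapped to the base point, so its
    restrictions over a and b have the same end values. *)
Lemma hol_homotopic (a b : loop Y) : homotopic a b -> hol (proj1_sig a) = hol (proj1_sig b).
Proof.
move=> [H [cH H0 H1 Hb]]; rewrite -(mopen_prod mI mI) in cH.
have [ca a0 a1] := proj2_sig a; have [cb b0 b1] := proj2_sig b.
have g : @mcts (mC 2) (mprod mI mI) (fun p => (chead p, chead (ctail p))).
  by apply: mcts_pair; [exact: mcts_chead|exact: mcts_comp mcts_ctail mcts_chead].
have [L' hL'] := flift_cube _ (cont_comp _ _ _ _ _ (mcts_cont _ g) cH).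
pose L st := L' (ccons st.1 (cube1 st.2)).
have hL : @flift Y C (mprod mI mI) H L.
  have g' : @mcts (mprod mI mI) (mC 2) (fun st => ccons st.1 (cube1 st.2)).
    by apply: mcts_ccons; [exact: mcts_fst|exact: mcts_comp mcts_snd mcts_cube1].
  have := flift_comp _ _ _ g' hL'.
  have -> // : (fun x : I * I => H (chead (ccons x.1 (cube1 x.2)),
     chead (ctail (ccons x.1 (cube1 x.2))))) = H.
  by apply/funext => -[s t]; rewrite chead_cons ctail_cons chead_cube1.
have row t : @mcts mI (mprod mI mI) (fun s => (s, t)).
  by apply: mcts_pair; [exact: mcts_id|exact: mcts_const].
have col s : @mcts mI (mprod mI mI) (fun t => (s, t)).
  by apply: mcts_pair; [exact: mcts_const|exact: mcts_id].
have La := flift_comp _ _ _ (row I0) hL; have Lb := flift_comp _ _ _ (row I1) hL.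
have L0 := flift_comp _ _ _ (col I0) hL; have L1 := flift_comp _ _ _ (col I1) hL.
rewrite (_ : (fun x => H (x, I0)) = proj1_sig a) in La; last exact/funext.
rewrite (_ : (fun x => H (x, I1)) = proj1_sig b) in Lb; last exact/funext.
rewrite (_ : (fun x => H (I0, x)) = fun=> base Y) in L0; last by apply/funext => t; have [] := Hb t.
rewrite (_ : (fun x => H (I1, x)) = fun=> base Y) in L1; last by apply/funext => t; have [] := Hb t.
by rewrite (holE _ _ ca La) (holE _ _ cb Lb) (lift_base_const _ L0) (lift_base_const _ L1).
Qed.

Lemma hol_concat (a b c : loop Y) : (forall t, proj1_sig c t = concat a b t) ->
  hol (proj1_sig c) = hol (proj1_sig a) ** hol (proj1_sig b).
Proof.
move=> hc; have [ca a0 a1] := proj2_sig a; have [cb b0 b1] := proj2_sig b.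
have [cc c0 c1] := proj2_sig c; have [L hL] := flift_I _ cc.
pose f (t : I) := clampI (/ 2 * proj1_sig t); pose g (t : I) := clampI (/ 2 * proj1_sig t + / 2).
have cf : @mcts mI mI f by apply: mcts_clampI; apply: rcts_scal; exact: mcts_val.
have cg : @mcts mI mI g.
  apply: mcts_clampI; apply: rcts_add; last exact: mcts_const.
  by apply: rcts_scal; exact: mcts_val.
have fE t : proj1_sig (f t) = / 2 * proj1_sig t.
  by case: t => t [t0 t1]; rewrite /f /= /Rmax /Rmin; do 2 case: Rle_dec; lra.
have gE t : proj1_sig (g t) = / 2 * proj1_sig t + / 2.
  by case: t => t [t0 t1]; rewrite /g /= /Rmax /Rmin; do 2 case: Rle_dec; lra.
have La := flift_comp _ _ _ cf hL; have Lb := flift_comp _ _ _ cg hL.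
rewrite (_ : (fun x => proj1_sig c (f x)) = proj1_sig a) in La; last first.
  apply/funext => t; rewrite hc /concat fE; case: Rle_dec => h /=; last first.
    by case: h; case: t => t /= [t0 t1]; lra.
  rewrite -[in RHS](clampI_id t); congr (proj1_sig a (clampI _)); lra.
rewrite (_ : (fun x => proj1_sig c (g x)) = proj1_sig b) in Lb; last first.
  apply/funext => t; rewrite hc /concat gE; case: Rle_dec => h /=; last first.
    rewrite -[in RHS](clampI_id t); congr (proj1_sig b (clampI _)); lra.
  have t0 : proj1_sig t = 0 by case: t h => t /= [t0 t1]; lra.
  have -> : t = I0 by apply: sig_eq.
  by rewrite b0 clampI_ge1 // /=; lra.
rewrite (holE _ _ ca La) (holE _ _ cb Lb) (holE _ _ cc hL).
have -> : f I0 = I0 by apply: sig_eq; rewrite fE /=; lra.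
have -> : g I1 = I1 by apply: sig_eq; rewrite gE /=; lra.
have -> : f I1 = g I0 by apply: sig_eq; rewrite fE gE /=; lra.
by rewrite -!gA gKV.
Qed.

Lemma eval_open t V : popens Y V ->
  popens (Omega Y) [set a : loop Y | V (proj1_sig a t)].
Proof.
move=> hV; apply: sub_gen; have t01 := proj2_sig t.
exists [set x : I | proj1_sig t <= proj1_sig x <= proj1_sig t], V; split=> //.
  by apply: compactI_itv; simpl in *; lra.
apply/seteqP; split=> a /= h => [x hx|]; last by apply: h; lra.
by have -> : x = t by apply: sig_eq; lra.
Qed.

Lemma hol_cts : cont (popens (Omega Y)) OG (fun a : loop Y => hol (proj1_sig a)).
Proof.
have [tY op cov trans _] := hC.
have tO : is_top (popens (Omega Y)) by exact: gen_top.
have [_ tI _] := tO.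
have cl (a : loop Y) : cont opI (popens Y) (proj1_sig a) by have [] := proj2_sig a.
have [L hL] := choice (fun a : loop Y => flift_I _ (cl a)).
have hE a : hol (proj1_sig a) = inv (L a I0) ** L a I1 by apply: holE.
(* Transport along a from s to t, read in the chart c at s and c' at t. It is multiplicative when
   the interval is divided, which allows induction on intervals although the lifts [L a] are chosen
   independently for different loops. *)
pose T s t (c c' : chart Y) (a : loop Y) :=
  inv (c.2 (proj1_sig a s)) ** (inv (L a s) ** L a t) ** c'.2 (proj1_sig a t).
(* The charts and W are quantified inside, because dividing an interval brings in a new chart at the
   midpoint and splits W by continuity of multiplication. On an interval inside one chart c2, T is a
   product of two transition functions at its ends. *)
have local a0 : forall c c' W, C c -> C c' -> c.1 (proj1_sig a0 (clampI 0)) ->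
   c'.1 (proj1_sig a0 (clampI 1)) -> OG W -> W (T (clampI 0) (clampI 1) c c' a0) ->
   exists N, [/\ popens (Omega Y) N, N a0 & forall a, N a -> W (T (clampI 0) (clampI 1) c c' a)].
  apply: (interval_ind (fun s t => forall c c' W, C c -> C c' -> c.1 (proj1_sig a0 (clampI s)) ->
    c'.1 (proj1_sig a0 (clampI t)) -> OG W -> W (T (clampI s) (clampI t) c c' a0) ->
    exists N, [/\ popens (Omega Y) N, N a0 & forall a, N a -> W (T (clampI s) (clampI t) c c' a)]));
    first lra; last first.
    move=> s m t sm mt h1 h2 c c' W Cc Cc' cs ct hW WT.
    have [c2 Cc2 cm] := cov (proj1_sig a0 (clampI m)).
    have split_ a : T (clampI s) (clampI t) c c' a =
       T (clampI s) (clampI m) c c2 a ** T (clampI m) (clampI t) c2 c' a.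
      by rewrite /T -!gA; congr (_ ** (_ ** _)); rewrite !gKV.
    rewrite split_ in WT; have [W1 [W2 [hW1 hW2 Wa Wb hWW]]] := OG_mul _ _ _ hW WT.
    have [N1 [hN1 Na1 N1a]] := h1 _ _ _ Cc Cc2 cs cm hW1 Wa.
    have [N2 [hN2 Na2 N2a]] := h2 _ _ _ Cc2 Cc' cm ct hW2 Wb.
    exists (N1 `&` N2); split=> //; first exact: tI.
    by move=> a [/N1a ? /N2a ?]; rewrite split_; apply: hWW.
  move=> x hx; have [c2 Cc2 cx] := cov (proj1_sig a0 (clampI x)).
  have [d d0 hd] := cl a0 _ (op _ Cc2) _ cx.
  have clE y : 0 <= y <= 1 -> proj1_sig (clampI y) = y.
    by move=> hy; rewrite /= /Rmax /Rmin; do 2 case: Rle_dec; lra.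
  exists d => // s t xs tx s0 st t1 c c' W Cc Cc' cs ct hW WT.
  have near (y : I) : s <= proj1_sig y <= t -> c2.1 (proj1_sig a0 y).
    by move=> hy; apply: hd; rewrite clE //; apply: Rabs_def1; lra.
  have lin (a : loop Y) : (forall y : I, s <= proj1_sig y <= t -> c2.1 (proj1_sig a y)) ->
    T (clampI s) (clampI t) c c' a =
    (inv (c.2 (proj1_sig a (clampI s))) ** c2.2 (proj1_sig a (clampI s))) **
    (inv (c2.2 (proj1_sig a (clampI t))) ** c'.2 (proj1_sig a (clampI t))).
    move=> ha; pose y (r : I) := clampI (s + proj1_sig r * (t - s)).
    have cy : @mcts mI mI y.
      apply: mcts_clampI; apply: rcts_add; first exact: mcts_const.
      by apply: rcts_mul; [exact: mcts_val|exact: mcts_const].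
    have yst r : s <= proj1_sig (y r) <= t.
      by case: r => r [r0 r1]; rewrite clE /=; nra.
    have y0 : y I0 = clampI s by congr clampI => /=; lra.
    have y1 : y I1 = clampI t by congr clampI => /=; lra.
    have := locconst_I (fun r => L a (y r) ** c2.2 (proj1_sig a (y r))).
    rewrite y0 y1 => E.
    suff h : inv (L a (clampI s)) ** L a (clampI t) =
        c2.2 (proj1_sig a (clampI s)) ** inv (c2.2 (proj1_sig a (clampI t))).
      by rewrite /T h -!gA.
    apply: (gI (L a (clampI s))); rewrite gKV gA E ?gKr // => r.
    exact: (flift_comp _ _ _ cy (hL a) r c2 Cc2 (ha _ (yst r))).
  have near0 : forall y : I, s <= proj1_sig y <= t -> c2.1 (proj1_sig a0 y) by exact: near.
  have c2s : c2.1 (proj1_sig a0 (clampI s)) by apply: near; rewrite clE; lra.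
  have c2t : c2.1 (proj1_sig a0 (clampI t)) by apply: near; rewrite clE; lra.
  rewrite lin // in WT; have [W1 [W2 [hW1 hW2 Wa Wb hWW]]] := OG_mul _ _ _ hW WT.
  exists ([set a : loop Y | forall y : I, s <= proj1_sig y <= t -> c2.1 (proj1_sig a y)] `&`
    ([set a : loop Y | [/\ c.1 (proj1_sig a (clampI s)), c2.1 (proj1_sig a (clampI s)) &
       W1 (inv (c.2 (proj1_sig a (clampI s))) ** c2.2 (proj1_sig a (clampI s)))]] `&`
     [set a : loop Y | [/\ c2.1 (proj1_sig a (clampI t)), c'.1 (proj1_sig a (clampI t)) &
       W2 (inv (c2.2 (proj1_sig a (clampI t))) ** c'.2 (proj1_sig a (clampI t)))]])).
  split=> //.
    apply: (tI).
      apply: sub_gen; exists [set y : I | s <= proj1_sig y <= t], c2.1.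
      by split=> //; [apply: compactI_itv; lra|exact: op].
    apply: (tI).
      exact: (eval_open (clampI s) _ (trans _ _ _ Cc Cc2 hW1)).
    exact: (eval_open (clampI t) _ (trans _ _ _ Cc2 Cc' hW2)).
  by move=> a [h1 [[_ _ h2] [_ _ h3]]]; rewrite lin //; apply: hWW.
apply/contP => // a0 W hW Wa0.
have [c Cc cb] := cov (base Y); pose u := c.2 (base Y).
have b0 (a : loop Y) : proj1_sig a I0 = base Y by have [] := proj2_sig a.
have b1 (a : loop Y) : proj1_sig a I1 = base Y by have [] := proj2_sig a.
have e0 : clampI 0 = I0 by apply: clampI_le0; lra.
have e1 : clampI 1 = I1 by apply: clampI_ge1; lra.
have TE a : T I0 I1 c c a = inv u ** hol (proj1_sig a) ** u by rewrite /T b0 b1 hE.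
have uT a : u ** (T I0 I1 c c a) ** inv u = hol (proj1_sig a) by rewrite TE !gA gVr g1l gKr.
have := local a0 c c [set g | W (u ** g ** inv u)] Cc Cc; rewrite e0 e1 b0 b1.
case=> //.
- apply: top_local OG_top _ => g /= Wg.
  have [W1 [W2 [hW1 _ Wa Wb hWW]]] := OG_mul _ _ _ hW Wg.
  have [W3 [W4 [_ hW4 Wc Wd hWW']]] := OG_mul _ _ _ hW1 Wa.
  by exists W4; split=> // x Wx; apply: hWW Wb; apply: hWW'.
- by rewrite /= uT.
- by move=> N [hN Na Nh]; exists N; split=> // a /Nh /=; rewrite uT.
Qed.

End FlatTheory.
End Flat.

(** * Open collars inside attached cells *)

Section Collar.
Local Open Scope R_scope.
Local Open Scope classical_set_scope.
Context {A : pspace} {m : nat} {J : Type} {phi : J -> sphere m -> A}.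
Hypothesis cphi : forall j, cont (opS m) (popens A) (phi j).
Notation B := (attach phi).
Notation cell := (@cell A m J phi).

Definition collar (U : set A) (P : J -> set (sphere m)) : set B := fun b =>
  match b with
  | inl a => U a
  | inr (j, x) => / 4 < sumsq (proj1_sig x) /\ polar False (P j) (proj1_sig x)
  end.

Lemma polar_mono (P P' : set (sphere m)) x : P `<=` P' -> polar False P x -> polar False P' x.
Proof. by rewrite /polar; case: Rlt_dec => // h s; exact: s. Qed.

(** P may be larger than the trace of U on the spheres. With U empty this yields open sets lying
    entirely inside the open cells. *)
Lemma collar_open U P : popens A U -> (forall j, opS m (P j)) ->
  (forall j s, U (phi j s) -> P j s) -> popens B (collar U P).
Proof.
move=> hU hP UP; split=> // j x0; change (collar U P (cell j x0) -> exists2 e, 0 < e &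
    forall y : mD m, @bl (mD m) x0 e y -> collar U P (cell j y)).
case: (disk_cases x0) => h0.
  rewrite (cell_in _ _ h0) => hx0; have [d d0 hd] := polar_open _ False (hP j) x0 hx0.
  have cs : @mcts (mD m) mR (fun x => sumsq (proj1_sig x)).
    by apply: rcts_sumsq => i; exact: mcts_coord.
  have [|d' d'0 hd'] := cs x0 (1 - sumsq (proj1_sig x0)); first by simpl in *; lra.
  exists (Rmin d d'); first exact: Rmin_gt0.
  move=> y hy; have /Rabs_def2 /= hy1 := hd' _ (bl_mono (mD m) _ _ _ _ (Rmin_r _ _) hy).
  have hy2 : sumsq (proj1_sig y) < R1 by lra.
  rewrite (cell_in _ _ hy2); exact: (hd _ (bl_mono (mD m) _ _ _ _ (Rmin_l _ _) hy)).
rewrite (cell_bd _ _ h0) => Ux.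
have [|d d0 hd] := polar_open _ False (cphi j _ hU) x0.
  by split; [rewrite h0; lra|rewrite (polar_sphere _ _ _ h0)].
exists d => // y /hd [y4 hy]; case: (disk_cases y) => h1.
  by rewrite (cell_in _ _ h1); split=> //; apply: polar_mono hy => s /= /UP.
by rewrite (cell_bd _ _ h1); move: hy; rewrite (polar_sphere _ _ _ h1).
Qed.

End Collar.

(** * Extending a flat bundle over attached cells *)

Section FlatAttach.
Local Open Scope R_scope.
Local Open Scope classical_set_scope.
Variables (G : Type) (OG : set (set G)) (mul : G -> G -> G) (inv : G -> G) (e : G).
Hypothesis hG : is_topgroup OG mul inv e.
Notation "x ** y" := (mul x y) (at level 40, left associativity).
Notation flat := (is_flat G OG mul inv).
Notation lift := (flift G mul).
Variables (Y : pspace) (C : set (chart G Y)) (m : nat).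
Hypothesis hC : flat Y C.

Definition fsphere := {f : sphere m -> Y | cont (opS m) (popens Y) f /\
  exists L : mS m -> G, lift C (f : mS m -> Y) L}.

Definition fphi (j : fsphere) : sphere m -> Y := proj1_sig j.
Definition flattach : pspace := attach fphi.

Definition flifting (j : fsphere) : sphere m -> G := projT1 (cid (proj2 (proj2_sig j))).

Lemma fliftingP j : lift C (fphi j : mS m -> Y) (flifting j).
Proof. exact: (projT2 (cid (proj2 (proj2_sig j)))). Qed.

Lemma fphi_cts j : cont (opS m) (popens Y) (fphi j).
Proof. exact: (proj1 (proj2_sig j)). Qed.

(** The left factor [flifting j s] cancels in the transition between two extended charts. It also
    makes the transition to [cell_chart], which has coordinate e, locally constant on the collar, by
    the very definition of a lift. *)
Definition ext_chart (c : chart G Y) : chart G flattach :=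
  (collar c.1 (fun j s => c.1 (fphi j s)),
   fun b : flattach => match b with
     | inl a => c.2 a
     | inr (j, x) => polar e (fun s => flifting j s ** c.2 (fphi j s)) (proj1_sig x)
     end).

Definition cell_chart : chart G flattach := (with_cells set0, fun=> e).

Definition flattach_charts : set (chart G flattach) :=
  [set c' | (exists2 c, C c & c' = ext_chart c) \/ c' = cell_chart].

Definition retr (b : flattach) : Y :=
  match b with inl a => a | inr (j, x) => polar (base Y) (fphi j) (proj1_sig x) end.

Lemma collar_retr U b : collar U (fun j s => U (fphi j s)) b -> U (retr b).
Proof.
by case: b => [//|[j x]] /= [h]; have h0 : 0 < sumsq (proj1_sig x) by [lra|];
  rewrite !(polarE _ _ _ h0).
Qed.

(** The second alternative is the centre of a cell, where no radial direction exists and no collar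
    reaches. *)
Lemma ext_chart_ratio c c' b : inv ((ext_chart c).2 b) ** (ext_chart c').2 b =
  inv (c.2 (retr b)) ** c'.2 (retr b) \/ (ext_chart c).2 b = e /\ ~ collar setT (fun _ _ => True) b.
Proof.
case: b => [a|[j x]] /=; first by left.
rewrite /polar; case: Rlt_dec => h; last by right; split=> // -[].
by left; rewrite (gVM _ _ _ _ _ hG) -(gA _ _ _ _ _ hG) (gK _ _ _ _ _ hG).
Qed.

Lemma collarT U P (b : flattach) : collar U P b -> collar setT (fun _ _ => True) b.
Proof.
case: b => [//|[j x]] /= [h hp]; split=> //; exact: polar_mono hp.
Qed.

Lemma lift_value_open j c g : C c ->
  opS m [set s | c.1 (fphi j s) /\ flifting j s ** c.2 (fphi j s) = g].
Proof.
move=> Cc s [/= cs es]; have [_ op _ _ _] := hC.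
have [d d0 hd] := fliftingP j s c Cc cs; have [d' d'0 hd'] := fphi_cts j _ (op _ Cc) s cs.
exists (Rmin d d'); first exact: Rmin_gt0.
move=> y hy; split; first exact: (hd' _ (bl_mono (mS m) _ _ _ _ (Rmin_r _ _) hy)).
by rewrite (hd _ (bl_mono (mS m) _ _ _ _ (Rmin_l _ _) hy)).
Qed.

Lemma lift_test_open j c (P : set G) : C c ->
  opS m [set s | c.1 (fphi j s) /\ P (flifting j s ** c.2 (fphi j s))].
Proof.
move=> Cc s [/= cs es]; have [d d0 hd] := lift_value_open j c _ Cc s (conj cs erefl).
by exists d => // y /hd [? ->].
Qed.

Lemma cells_collar_open c (P : set G) : C c -> popens flattach
  [set b | [/\ (ext_chart c).1 b, cell_chart.1 b & P ((ext_chart c).2 b)]].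
Proof.
move=> Cc; have [tY _ _ _ _] := hC.
have := collar_open fphi_cts set0 _ (top_local _ tY (fun _ => False_ind _))
  (fun j => lift_test_open j c P Cc) (fun _ _ => False_ind _).
congr (popens _ _); apply/seteqP; split=> -[a|[j x]] //=; try by case.
  by move=> [h]; have h0 : 0 < sumsq (proj1_sig x) by [lra|]; rewrite !(polarE _ _ _ h0) => -[].
by move=> [[h]]; have h0 : 0 < sumsq (proj1_sig x) by [lra|]; rewrite !(polarE _ _ _ h0).
Qed.

Lemma flattach_flat : flat flattach flattach_charts.
Proof.
have [tY op cov trans path] := hC.
have tB : is_top (popens flattach) by exact: attach_top.
have set0_open : popens Y set0 by apply: top_local.
have cells_open : popens flattach cell_chart.1 by exact: (with_cells_open fphi_cts).
have collar_open' U : popens Y U -> popens flattach (collar U (fun j s => U (fphi j s))).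
  by move=> hU; apply: (collar_open fphi_cts) => // j; exact: fphi_cts.
split=> //.
- by move=> c [[c' Cc' ->]|-> //]; apply: collar_open'; exact: op.
- move=> [a|d]; last by exists cell_chart; [right|].
  by have [c Cc ca] := cov a; exists (ext_chart c) => //; left; exists c.
- move=> c c' W [[c1 Cc1 ->]|->] [[c2 Cc2 ->]|->] hW.
  + have := collar_open' _ (trans _ _ _ Cc1 Cc2 hW); congr (popens _ _).
    apply/seteqP; split=> b.
      move=> hb; have hT := collarT _ _ _ hb; have := collar_retr _ _ hb => -[h1 h2 h3].
      have [E|[_ //]] := ext_chart_ratio c1 c2 b; split; rewrite ?E //; move: hb;
        case: (b) => [a []//|[j x]] /= [x4 hx]; split=> //; apply: polar_mono hx => s /= [] //.
    move=> [h1 h2 h3]; have hT := collarT _ _ _ h1.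
    have [E|[_ //]] := ext_chart_ratio c1 c2 b; rewrite E in h3.
    case: b h1 h2 h3 {hT E} => [a|[j x]] //= [x4]; have h0 : 0 < sumsq (proj1_sig x) by lra.
    by rewrite !(polarE _ _ _ h0) => hx [_ hx'] h3; split.
  + have := cells_collar_open c1 (fun g => W (inv g ** e)) Cc1.
    by congr (popens _ _); apply/seteqP; split.
  + have := cells_collar_open c2 (fun g => W (inv e ** g)) Cc2.
    by congr (popens _ _); apply/seteqP; split=> b [].
  + case: (pselect (W (inv e ** e))) => hWe.
      by congr (popens _ _): cells_open; apply/seteqP; split=> // b [].
    by apply: top_local => // b [].
(* Between an extended chart and the cell chart the coordinate is locally constant along g. Between
   two extended charts g is projected to Y along radii, where the path condition of C applies. *)
- have case2 c (g : I -> flattach) : C c -> cont opI (popens flattach) g ->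
      (forall t, (ext_chart c).1 (g t) /\ cell_chart.1 (g t)) ->
      (ext_chart c).2 (g I0) = (ext_chart c).2 (g I1).
    move=> Cc cg hg; apply: (locconst_I (fun t => (ext_chart c).2 (g t))) => t.
    have [h1 h2] := hg t.
    have [|d d0 hd] := cg _ (cells_collar_open c (fun x => x = (ext_chart c).2 (g t)) Cc) t.
      by split.
    by exists d => // s /hd [].
  move=> c c' g [[c1 Cc1 ->]|->] [[c2 Cc2 ->]|->] cg hg //.
  + have rg t : collar setT (fun _ _ => True) (g t) by have [/collarT] := hg t.
    have E t : inv ((ext_chart c1).2 (g t)) ** (ext_chart c2).2 (g t) =
        inv (c1.2 (retr (g t))) ** c2.2 (retr (g t)).
      by have [->|[_ /(_ (rg t))]] := ext_chart_ratio c1 c2 (g t).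
    rewrite !E; apply: (path c1 c2 (fun t => retr (g t))) => //.
      move=> U hU; have := cg _ (collar_open' _ hU); congr (opI _).
      apply/seteqP; split=> t; rewrite /preimage /=; first exact: collar_retr.
      move: (rg t); case: (g t) => [//|[j x]] /= [x4 _] hx; split=> //.
      by have h0 : 0 < sumsq (proj1_sig x) by [lra|]; move: hx; rewrite !(polarE _ _ _ h0).
    by move=> t; have [/collar_retr ? /collar_retr ?] := hg t.
  + by rewrite (case2 c1).
  + by rewrite (case2 c2) // => t; have [] := hg t.
Qed.

Lemma lift_inl {K : mspace} (F : K -> Y) (L : K -> G) :
  flift G mul flattach_charts (fun p => inl (F p) : flattach) L <-> lift C F L.
Proof.
split=> hL p c.
  by move=> Cc cp; apply: (hL p (ext_chart c)) => //; left; exists c.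
by move=> [[c' Cc' ->]|->] //= cp; apply: hL.
Qed.

End FlatAttach.

(** * Filling spheres *)

Section CubeSphere.
Local Open Scope R_scope.
Context {k : nat}.
Implicit Types (u : 'I_k -> R) (x : 'I_k.+1 -> R) (p : mC k).

Definition supn u : R := \big[Rmax/R0]_(i < k) Rabs (u i).

Lemma supn_ge u i : Rabs (u i) <= supn u.
Proof.
rewrite /supn; have : i \in index_enum 'I_k by rewrite mem_index_enum.
elim: (index_enum _) => // j s IH; rewrite inE big_cons => /orP[/eqP <-|/IH hi].
  exact: Rmax_l.
exact: Rle_trans hi (Rmax_r _ _).
Qed.

Lemma supn_ge0 u : 0 <= supn u.
Proof.
rewrite /supn; apply: big_ind => [|a b ha hb|i _]; [lra| |exact: Rabs_pos].
exact: Rle_trans ha (Rmax_l _ _).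
Qed.

Lemma supn_le u c : 0 <= c -> (forall i, Rabs (u i) <= c) -> supn u <= c.
Proof. by move=> c0 h; rewrite /supn; apply: (big_ind (fun r => r <= c)) => [|a b *|i _] //; exact: Rmax_lub. Qed.

Lemma supn_attained u : 0 < supn u -> exists i, Rabs (u i) = supn u.
Proof.
move=> h; apply: contrapT => ne.
have : supn u = 0 \/ exists i, Rabs (u i) = supn u.
  rewrite /supn; apply: (big_ind (fun r => r = 0 \/ exists i, Rabs (u i) = r)) => [|a b ha hb|i _].
  - by left.
  - by rewrite /Rmax; case: Rle_dec.
  - by right; exists i.
by case=> [h0|//]; lra.
Qed.

Lemma supn_scale c u : 0 <= c -> supn (fun i => c * u i) = c * supn u.
Proof.
move=> c0; rewrite /supn; elim: (index_enum _) => [|i s IH]; first by rewrite !big_nil; lra.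
by rewrite !big_cons IH Rabs_mult (Rabs_right c) ?RmaxRmult //; exact: Rle_ge.
Qed.

Lemma rcts_supn {K : mspace} (f : K -> 'I_k -> R) : (forall i, @mcts K mR (fun q => f q i)) ->
  @mcts K mR (fun q => supn (f q)).
Proof. by move=> h; apply: rcts_big => [g g'|i]; [exact: rcts_max|exact: rcts_abs]. Qed.

Definition tail x : 'I_k -> R := fun i => x (lift ord0 i).
(** The unit sphere of this norm is a double cone: the two graphs (depth p, centred p) and (-depth
    p, centred p) over the cube, glued along its boundary. *)
Definition polnorm x : R := supn (tail x) + Rabs (x ord0).

Lemma polnorm_ge0 x : 0 <= polnorm x.
Proof. by apply: Rplus_le_le_0_compat; [exact: supn_ge0|exact: Rabs_pos]. Qed.

Lemma to_cube_proof x : in_cube (fun i => / 2 * (1 + tail x i / polnorm x)).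
Proof.
move=> i; suff h : - 1 <= tail x i / polnorm x <= 1 by split; lra.
have h1 : Rabs (tail x i) <= polnorm x.
  by have := supn_ge (tail x) i; have := Rabs_pos (x ord0); rewrite /polnorm; lra.
case: (Rle_lt_or_eq_dec _ _ (polnorm_ge0 x)) => [h0|h0].
  have e : tail x i / polnorm x * polnorm x = tail x i by field; lra.
  move: h1 e h0; set y := tail x i / _; set n := polnorm x; rewrite /Rabs; case: Rcase_abs => ? ? e h0.
    by split; nra.
  by split; nra.
by rewrite -h0 /Rdiv Rinv_0; lra.
Qed.

(* The inverse of p |-> (1 - |2p - 1|_oo, 2p - 1) up to radial rescaling, which identifies
   each closed hemisphere of S^k with the cube and the equator with its boundary. *)
Definition to_cube x : mC k := exist in_cube _ (to_cube_proof x).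

Lemma polnorm_sphere x : sumsq x = 1 -> 0 < polnorm x.
Proof.
move=> h; case: (Rle_lt_or_eq_dec _ _ (polnorm_ge0 x)) => // h0; exfalso.
have s0 := supn_ge0 (tail x); have a0 := Rabs_pos (x ord0); rewrite /polnorm in h0.
have x0 : x = fun=> 0.
  apply/funext; apply: ordSP => [|i] /=.
    by have : Rabs (x ord0) = 0 by [lra]; rewrite /Rabs; case: Rcase_abs; lra.
  have st : supn (tail x) = 0 by lra.
  have := supn_ge (tail x) i; rewrite st /tail /Rabs; case: Rcase_abs; lra.
move: h; rewrite x0 => h.
have := sumsq_scale 0 (fun _ : 'I_k.+1 => 0); rewrite (_ : (fun i => 0 * 0) = fun=> 0); first lra.
by apply/funext => i; lra.
Qed.

Lemma mcts_to_cube : @mcts (mS k.+1) (mC k) (fun x : mS k.+1 => to_cube (proj1_sig x)).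
Proof.
apply: mcts_Rk => i /=; apply: rcts_scal; apply: rcts_add; first exact: mcts_const.
apply: rcts_div => [x||].
- by have := polnorm_sphere _ (proj2_sig x); lra.
- exact: mcts_coord.
apply: rcts_add; first by apply: rcts_supn => j; exact: mcts_coord.
by apply: rcts_abs; exact: mcts_coord.
Qed.

Lemma to_cube_equator x : sumsq x = 1 -> x ord0 = 0 -> cbd (to_cube x).
Proof.
move=> h x0; have := polnorm_sphere _ h.
have -> : polnorm x = supn (tail x) by rewrite /polnorm x0 Rabs_R0; lra.
move=> sp; have [i hi] := supn_attained _ sp; exists i => /=.
rewrite /polnorm x0 Rabs_R0 Rplus_0_r -hi.
have : Rabs (tail x i) <> 0 by lra.
rewrite /Rabs; case: Rcase_abs => ? ?; [left|right]; field; lra.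
Qed.

Definition centred p : 'I_k -> R := fun i => 2 * proj1_sig p i - 1.
Definition depth p : R := 1 - supn (centred p).
(** The Euclidean norm of (depth p, centred p); dividing by it moves the double cone onto the round
    sphere. *)
Definition height p : R := sqrt (depth p * depth p + sumsq (centred p)).

Lemma centred_le1 p i : Rabs (centred p i) <= 1.
Proof. by rewrite /centred; have := proj2_sig p i; move=> /= ?; apply: Rabs_le; lra. Qed.

Lemma depth_ge0 p : 0 <= depth p.
Proof. by have := supn_le (centred p) 1 Rle_0_1 (centred_le1 p); rewrite /depth; lra. Qed.

Lemma depth0 p : cbd p <-> depth p = 0.
Proof.
split=> [[i hi]|h].
  have : Rabs (centred p i) = 1.
    rewrite /centred; case: hi => ->; rewrite /Rabs; case: Rcase_abs; lra.
  by have := supn_ge (centred p) i; have := depth_ge0 p; rewrite /depth; lra.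
have [|i hi] := supn_attained (centred p); first by rewrite /depth in h; lra.
exists i; move: hi h; rewrite /depth /centred => <-; rewrite /Rabs; case: Rcase_abs; lra.
Qed.

Lemma height_sq p : height p * height p = depth p * depth p + sumsq (centred p).
Proof.
by rewrite /height; apply: sqrt_sqrt; apply: Rplus_le_le_0_compat; [exact: Rle_0_sqr|exact: sumsq_ge0].
Qed.

Lemma height_gt0 p : 0 < height p.
Proof.
apply: sqrt_lt_R0; have h1 := sumsq_ge0 (centred p); have h2 := Rle_0_sqr (depth p).
case: (Rle_lt_or_eq_dec _ _ (Rplus_le_le_0_compat _ _ h2 h1)) => // h0; exfalso.
rewrite /Rsqr in h0 h2; move: h0 h1 h2; set D := depth p => h0 h1 h2.
have d0 : depth p = 0 by rewrite -/D; nra.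
have /depth0 [i hi] := d0.
have s0 : sumsq (centred p) = 0 by nra.
have := sumsq_coord (centred p) i; rewrite s0 /centred; case: hi => ->; lra.
Qed.

(** The vertical chord from the point over p in the upper hemisphere at t = 0 to its mirror image at
    t = 1; over the boundary of the cube it degenerates to a point of the equator. *)
Definition sweep p (t : R) : 'I_k.+1 -> R :=
  cons_fun ((1 - 2 * t) * depth p / height p) (fun i => / height p * centred p i).

Lemma sumsq_sweep p t : sumsq (sweep p t) =
  1 - (1 - (1 - 2 * t) * (1 - 2 * t)) * (depth p * depth p) / (height p * height p).
Proof.
rewrite sumsq_recl [sweep p t ord0]cons_fun0.
have -> : (fun i => sweep p t (lift ord0 i)) = fun i => / height p * centred p i.
  by apply/funext => i; rewrite /sweep cons_funS.
rewrite sumsq_scale; have := height_sq p; have := height_gt0 p; set h := height p => h0 hh.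
have -> : sumsq (centred p) = h * h - depth p * depth p by lra.
by field; lra.
Qed.

Lemma sweep_sphere p t : t = 0 \/ t = 1 \/ cbd p -> sumsq (sweep p t) = 1.
Proof.
have h0 := height_gt0 p.
rewrite sumsq_sweep => -[->|[->|/depth0 ->]]; field; lra.
Qed.

Lemma to_cube_sweep p t : t = 0 \/ t = 1 \/ cbd p -> to_cube (sweep p t) = p.
Proof.
move=> ht; have h0 := height_gt0 p; have d0 := depth_ge0 p.
have tl i : tail (sweep p t) i = / height p * centred p i by rewrite /tail /sweep cons_funS.
have i0 : 0 < / height p by exact: Rinv_0_lt_compat.
have E : polnorm (sweep p t) = / height p.
  rewrite /polnorm (_ : tail (sweep p t) = fun i => / height p * centred p i); last exact/funext.
  rewrite supn_scale; last lra.
  rewrite {1}/sweep cons_fun0.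
  have -> : Rabs ((1 - 2 * t) * depth p / height p) = depth p / height p.
    have dh : 0 <= depth p / height p by apply: Rmult_le_pos; lra.
    case: ht => [->|[->|/depth0 ->]].
    - by rewrite Rabs_right; [field|]; lra.
    - by rewrite Rabs_left1; [field|]; lra.
    - by rewrite Rmult_0_r /Rdiv Rmult_0_l Rabs_R0.
  by rewrite /depth; field; lra.
apply: sig_eq; apply/funext => i /=; rewrite E tl /centred; field; lra.
Qed.

(** For t in I the chord lies in the disk, so [clip 1] is the identity on it and supplies the proof
    of membership. *)
Lemma mcts_sweep : @mcts (mprod (mC k) mI) (mD k.+1)
  (fun pt => clip 1 (sweep pt.1 (proj1_sig pt.2))).
Proof.
have cc i : @mcts (mC k) mR (fun p => centred p i).
  apply: rcts_sub; last exact: mcts_const.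
  by apply: rcts_scal; exact: mcts_coord.
have cd : @mcts (mC k) mR depth.
  by apply: rcts_sub; [exact: mcts_const|exact: rcts_supn].
have ch : @mcts (mC k) mR (fun p => / height p).
  apply: rcts_inv => [p|]; first by have := height_gt0 p; lra.
  apply: rcts_sqrt => [p|].
    by rewrite -height_sq; exact: Rle_0_sqr.
  by apply: rcts_add; [exact: rcts_mul|exact: rcts_sumsq].
have pull (f : mC k -> R) : @mcts (mC k) mR f -> @mcts (mprod (mC k) mI) mR (fun pt => f pt.1).
  by move=> cf; exact: mcts_comp mcts_fst cf.
apply: mcts_clip => [_||]; [lra|exact: mcts_const|apply: ordSP => [|i]].
  rewrite (_ : (fun pt : mprod (mC k) mI => _) =
    fun pt => (1 - 2 * proj1_sig pt.2) * depth pt.1 / height pt.1); last first.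
    by apply/funext => pt; exact: cons_fun0.
  apply: rcts_mul; last exact: (pull _ ch).
  apply: rcts_mul; last exact: (pull _ cd).
  apply: rcts_sub; first exact: mcts_const.
  by apply: rcts_scal; exact: mcts_comp mcts_snd mcts_val.
rewrite (_ : (fun pt : mprod (mC k) mI => _) =
  fun pt => / height pt.1 * centred pt.1 i); last first.
  by apply/funext => pt; exact: cons_funS.
by apply: rcts_mul; [exact: (pull _ ch)|exact: (pull _ (cc i))].
Qed.

End CubeSphere.

(** * Homotopies across an attached cell *)

Section Fill.
Local Open Scope R_scope.
Local Open Scope classical_set_scope.
Variables (G : Type) (OG : set (set G)) (mul : G -> G -> G) (inv : G -> G) (e : G).
Hypothesis hG : is_topgroup OG mul inv e.
Notation "x ** y" := (mul x y) (at level 40, left associativity).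
Notation flat := (is_flat G OG mul inv).
Notation lift := (flift G mul).
Context {Y : pspace} {C : set (chart G Y)}.
Hypothesis hC : flat Y C.

Lemma flift_paste {K : mspace} (f : K -> R) (F0 F1 : K -> Y) L0 L1 : @mcts K mR f ->
  lift C F0 L0 -> lift C F1 L1 -> (forall x, f x = 0 -> F0 x = F1 x /\ L0 x = L1 x) ->
  lift C (fun x => if Rle_dec (f x) 0 then F0 x else F1 x)
         (fun x => if Rle_dec (f x) 0 then L0 x else L1 x).
Proof.
move=> cf h0 h1 E p c Cc; case: (Rtotal_order (f p) 0) => [fp|[fp|fp]];
  case: Rle_dec => [le|nle] cp; try lra.
- have [d d0 hd] := h0 _ _ Cc cp; have [|d' d'0 hd'] := cf p (- f p); first lra.
  exists (Rmin d d'); first exact: Rmin_gt0.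
  move=> y hy; have /Rabs_def2 := hd' y (bl_mono _ _ _ _ _ (Rmin_r _ _) hy).
  case: Rle_dec => [? _|] /=; last by simpl; lra.
  exact: hd (bl_mono _ _ _ _ _ (Rmin_l _ _) hy).
- have [d d0 hd] := h0 _ _ Cc cp; have [e1 e2] := E _ fp.
  have cp1 : c.1 (F1 p) by rewrite -e1.
  have [d' d'0 hd'] := h1 _ _ Cc cp1.
  exists (Rmin d d'); first exact: Rmin_gt0.
  move=> y hy; case: Rle_dec => ? /=.
    exact: hd (bl_mono _ _ _ _ _ (Rmin_l _ _) hy).
  rewrite e1 e2; exact: hd' (bl_mono _ _ _ _ _ (Rmin_r _ _) hy).
- have [d d0 hd] := h1 _ _ Cc cp; have [|d' d'0 hd'] := cf p (f p); first lra.
  exists (Rmin d d'); first exact: Rmin_gt0.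
  move=> y hy; have /Rabs_def2 := hd' y (bl_mono _ _ _ _ _ (Rmin_r _ _) hy).
  case: Rle_dec => [|? _] /=; first by simpl; lra.
  exact: hd (bl_mono _ _ _ _ _ (Rmin_l _ _) hy).
Qed.

(* Two cubes with compatible lifts are the hemispheres of a liftable sphere. *)
Lemma fill_cube {k} (F0 F1 : mC k -> Y) L0 L1 :
  cont (mopen (mC k)) (popens Y) F0 -> cont (mopen (mC k)) (popens Y) F1 ->
  lift C F0 L0 -> lift C F1 L1 -> (forall p, cbd p -> F0 p = F1 p /\ L0 p = L1 p) ->
  hrel (fun p => inl (F0 p) : flattach G mul Y C k.+1) (fun p => inl (F1 p)).
Proof.
move=> c0 c1 h0 h1 E.
(* F0 is placed on the upper hemisphere, where the chords of [sweep] begin, and F1 on the lower one;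
   crossing the cell along the chords is then the homotopy. *)
pose phi (x : 'I_k.+1 -> R) := if Rle_dec (x ord0) 0 then F1 (to_cube x) else F0 (to_cube x).
pose f (x : mS k.+1) := phi (proj1_sig x).
have cv : @mcts (mS k.+1) mR (fun x => proj1_sig x ord0) by exact: mcts_coord.
have eq0 (x : mS k.+1) : proj1_sig x ord0 = 0 -> F1 (to_cube (proj1_sig x)) = F0 (to_cube (proj1_sig x)) /\
    L1 (to_cube (proj1_sig x)) = L0 (to_cube (proj1_sig x)).
  by move=> hx; have [] := E _ (to_cube_equator _ (proj2_sig x) hx).
have cf : cont (opS k.+1) (popens Y) f.
  apply: (cont_paste (K := mS k.+1) (fun x : mS k.+1 => proj1_sig x ord0)
    (fun x : mS k.+1 => F1 (to_cube (proj1_sig x))) (fun x : mS k.+1 => F0 (to_cube (proj1_sig x))) cv).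
  - exact: cont_comp (mcts_cont _ mcts_to_cube) c1.
  - exact: cont_comp (mcts_cont _ mcts_to_cube) c0.
  - by move=> x /eq0 [].
have lf : exists L : mS k.+1 -> G, lift C (f : mS k.+1 -> Y) L.
  eexists; apply: (flift_paste (fun x : mS k.+1 => proj1_sig x ord0)
    (fun x : mS k.+1 => F1 (to_cube (proj1_sig x))) (fun x : mS k.+1 => F0 (to_cube (proj1_sig x)))
    (fun x : mS k.+1 => L1 (to_cube (proj1_sig x))) (fun x : mS k.+1 => L0 (to_cube (proj1_sig x))) cv) => //.
  - exact: flift_comp mcts_to_cube h1.
  - exact: flift_comp mcts_to_cube h0.
pose j : fsphere G mul Y C k.+1 := exist _ f (conj cf lf).
have onS p t : t = 0 \/ t = 1 \/ cbd p ->
    cell (phi := fphi G mul Y C k.+1) j (clip 1 (sweep p t)) = inl (phi (sweep p t)).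
  move=> h; have hs := sweep_sphere _ _ h.
  have hc : proj1_sig (clip 1 (sweep p t)) = sweep p t by apply: clip1; rewrite hs; lra.
  have hs' : sumsq (proj1_sig (clip 1 (sweep p t))) = R1 by rewrite hc.
  by rewrite (cell_bd _ _ hs') /fphi /= /f [proj1_sig _]hc.
have phi1 p t : t = 1 \/ cbd p -> phi (sweep p t) = F1 p.
  move=> h; have h' : t = 0 \/ t = 1 \/ cbd p by right.
  rewrite /phi to_cube_sweep //; case: Rle_dec => //= np; exfalso; apply: np.
  rewrite /sweep cons_fun0; have h0' := height_gt0 p; have d0 := depth_ge0 p.
  have i0 : 0 < / height p by exact: Rinv_0_lt_compat.
  case: h => [->|/depth0 ->]; last by rewrite /Rdiv; lra.
  have := Rmult_le_pos _ _ d0 (Rlt_le _ _ i0); rewrite /Rdiv; lra.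
have phi0 p : phi (sweep p 0) = F0 p.
  case: (Rle_lt_or_eq_dec _ _ (depth_ge0 p)) => d0; last first.
    have bp : cbd p by apply/depth0.
    by rewrite phi1; [have [] := E _ bp|right].
  rewrite /phi to_cube_sweep; last by left.
  case: Rle_dec => //= np; exfalso; move: np; rewrite /sweep cons_fun0.
  have i0 : 0 < / height p by apply/Rinv_0_lt_compat/height_gt0.
  have := Rmult_lt_0_compat _ _ d0 i0; rewrite /Rdiv; lra.
exists (fun pt => cell (phi := fphi G mul Y C k.+1) j (clip 1 (sweep pt.1 (proj1_sig pt.2)))); split.
- exact: cont_comp (mcts_cont _ mcts_sweep) (cell_cts j).
- by move=> p; rewrite onS /=; [rewrite phi0|left].
- by move=> p; rewrite onS /=; [rewrite phi1 //; left|right; left].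
- move=> p t bp; rewrite onS /=; last by right; right.
  by rewrite phi1; [have [-> _] := E _ bp|right].
Qed.

(** Two segments in the boundary join p to the corner z: if coordinate i of p is 0 or 1, move
    another coordinate j to 0 and then go straight to z inside that face. The second coordinate is
    why the dimension is at least 2. *)
Lemma lift_bd_const {k} (F : mC k.+2 -> Y) L : lift C F L ->
  (forall p, cbd p -> F p = base Y) -> forall p q, cbd p -> cbd q -> L p = L q.
Proof.
move=> hL bF.
pose z : mC k.+2 := exist in_cube (fun=> 0) (fun _ => conj (Rle_refl 0) Rle_0_1).
have move_ p q : (forall t, cbd (seg p q t)) -> L p = L q.
  move=> h; have := flift_comp G mul _ _ _ (mcts_seg p q) hL.
  rewrite (_ : (fun x => F (seg p q x)) = fun=> base Y); last by apply/funext => t; exact: bF.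
  by move=> /(lift_base_const _ _ _ _ _ hG hC); rewrite seg0 seg1.
suff toz p : cbd p -> L p = L z by move=> p q /toz -> /toz ->.
move=> [i hi].
have [j ji] : exists j : 'I_k.+2, j != i.
  case: (eqVneq i ord0) => [->|i0]; first by exists ord_max.
  by exists ord0; rewrite eq_sym.
have hp' : in_cube (upd (proj1_sig p) j 0).
  by move=> l; rewrite /upd; case: eqP => _; [lra|exact: (proj2_sig p l)].
pose p' : mC k.+2 := exist in_cube _ hp'.
rewrite (move_ p p') => [|t]; last first.
  exists i; rewrite /= /upd eq_sym (negbTE ji).
  by case: hi => ->; [left|right]; lra.
apply: move_ => t; exists j; left; rewrite /= /upd eqxx; lra.
Qed.

(** No condition on holonomy arises in dimension at least 2: the lift of F is constant on the
    boundary, hence matches a constant lift of the constant cube. *)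
Lemma fill_trivial {k} (F : mC k.+2 -> Y) : cont (mopen (mC k.+2)) (popens Y) F ->
  (forall p, cbd p -> F p = base Y) ->
  hrel (fun p => inl (F p) : flattach G mul Y C k.+3) (fun=> inl (base Y)).
Proof.
move=> cF bF; have [L hL] := flift_cube _ _ _ _ _ hG hC _ cF.
pose z : mC k.+2 := exist in_cube (fun=> 0) (fun _ => conj (Rle_refl 0) Rle_0_1).
have bz : cbd z by exists ord0; left.
apply: (fill_cube _ _ L (fun=> L z) cF) => //.
- exact: cont_const (mopen_top _).
- by move=> p c Cc cp; exists 1; [lra|].
- by move=> p bp; split; [exact: bF|exact: (lift_bd_const _ _ hL bF)].
Qed.

End Fill.

(** * The generalized wedge of circles *)

Section Suspension.
Local Open Scope R_scope.
Local Open Scope classical_set_scope.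
Variable X : space.
Hypothesis tX : is_top (sopens X).

Lemma susp_top : is_top (popens (susp X)).
Proof.
have [t1 t2 t3] := prod_opens_top (sopens X) opI; split.
- exact: t1.
- by move=> U V; exact: t2.
- move=> F hF; rewrite /= preimage_bigcup.
  have -> : \bigcup_(i in F) (@susp_r X @^-1` i) =
     \bigcup_(V in [set V | exists2 U, F U & V = @susp_r X @^-1` U]) V.
    apply/seteqP; split=> [p [U FU Up]|p [_ [U FU ->] Up]]; last by exists U.
    by exists (@susp_r X @^-1` U) => //; exists U.
  by apply: t3 => _ [U FU ->]; exact: hF.
Qed.

Lemma susp_r_cts : cont (prod_opens (sopens X) opI) (popens (susp X)) (@susp_r X).
Proof. by []. Qed.

Lemma susp_r_end x (t : I) : proj1_sig t = 0 \/ proj1_sig t = 1 -> @susp_r X (x, t) = None.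
Proof. by rewrite /susp_r /= => h; do 2 case: Rlt_dec => //; move=> *; exfalso; lra. Qed.

Lemma susp_r_in x (t : I) (h : Rlt R0 (proj1_sig t) /\ Rlt (proj1_sig t) R1) :
  @susp_r X (x, t) = Some (x, exist _ (proj1_sig t) h).
Proof.
by case: h => h1 h2; rewrite /susp_r /=; do 2 case: Rlt_dec => // ?; congr (Some (_, _)); apply: sig_eq.
Qed.

Lemma I_cases (t : I) : (proj1_sig t = 0 \/ proj1_sig t = 1) \/ (Rlt R0 (proj1_sig t) /\ Rlt (proj1_sig t) R1).
Proof.
case: t => t /= [/Rle_lt_or_eq_dec [h|<-]]; last by left; left.
by move=> /Rle_lt_or_eq_dec [h'|->]; [right|left; right].
Qed.

Lemma box_open (O : set X) (B : set I) : sopens X O -> opI B ->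
  prod_opens (sopens X) opI [set p : X * I | O p.1 /\ B p.2].
Proof. by move=> hO hB; apply: sub_gen; exists O, B. Qed.

Definition slab (O : set X) (a b : R) : set (susp X) := fun z =>
  if z is Some (x, s) then O x /\ a < proj1_sig s < b else False.

Lemma itv_open (a b : R) : opI [set t : I | a < proj1_sig t < b].
Proof.
move=> t /= [h1 h2]; exists (Rmin (proj1_sig t - a) (b - proj1_sig t)).
  by apply: Rmin_gt0; lra.
move=> s /Rabs_def2; have := Rmin_l (proj1_sig t - a) (b - proj1_sig t).
by have := Rmin_r (proj1_sig t - a) (b - proj1_sig t) => ? ? /=; lra.
Qed.

Lemma slab_open O a b : sopens X O -> 0 <= a -> b <= 1 -> popens (susp X) (slab O a b).
Proof.
move=> hO a0 b1; have := box_open _ _ hO (itv_open a b); congr (prod_opens _ _ _).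
apply/seteqP; split=> -[x t]; rewrite /preimage /=.
  move=> [Ox tab]; have h : Rlt R0 (proj1_sig t) /\ Rlt (proj1_sig t) R1 by lra.
  by rewrite (susp_r_in _ _ h).
by case: (I_cases t) => h; [rewrite susp_r_end|rewrite (susp_r_in _ _ h)].
Qed.

Definition meridian_fun (x : X) (t : I) : susp X := @susp_r X (x, t).

Lemma meridian_proof x : is_loop (meridian_fun x).
Proof.
split; [|by rewrite /meridian_fun susp_r_end //=; left|by rewrite /meridian_fun susp_r_end //=; right].
apply: cont_comp _ susp_r_cts; apply: cont_pair opI_top _ _; first exact: cont_const opI_top.
exact: mcts_cont _ (@mcts_id mI).
Qed.

Definition meridian x : loop (susp X) := exist _ _ (meridian_proof x).

Lemma meridian_cts : cont (sopens X) (popens (Omega (susp X))) meridian.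
Proof. by apply: cont_curry. Qed.

Variables (G : Type) (OG : set (set G)) (mul : G -> G -> G) (inv : G -> G) (e : G).
Hypothesis hG : is_topgroup OG mul inv e.
Notation "x ** y" := (mul x y) (at level 40, left associativity).
Notation flat := (is_flat G OG mul inv).
Notation lift := (flift G mul).
Variable q : X -> G.
Hypothesis cq : cont (sopens X) OG q.
Hypothesis qpath : forall g : I -> X, cont opI (sopens X) g -> q (g I0) = q (g I1).

(** Two charts suffice: one omits the level 1/2, the other the collapsed point. Their transition is
    trivial below the level 1/2 and given by q above it, so going once around the circle of x picks
    up q x. *)
Definition pole_fun (z : susp X) : G :=
  if z is Some (x, s) then (if Rlt_dec (proj1_sig s) (/ 2) then e else q x) else e.
Definition pole_chart : chart G (susp X) :=
  ([set z | if z is Some (x, s) then proj1_sig s <> / 2 else True], pole_fun).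
Definition belt_chart : chart G (susp X) := ([set z | z <> None], fun=> e).
Definition susp_charts : set (chart G (susp X)) := [set c | c = pole_chart \/ c = belt_chart].

Lemma pole_open : popens (susp X) pole_chart.1.
Proof.
have hB : opI [set t : I | proj1_sig t <> / 2].
  move=> t /= ht; exists (Rabs (proj1_sig t - / 2)); first by apply: Rabs_pos_lt; lra.
  by move=> y hy ey; move: hy; rewrite ey Rabs_minus_sym; lra.
have [tX1 _ _] := tX.
have := box_open _ _ tX1 hB; congr (prod_opens _ _ _).
apply/seteqP; split=> -[x t]; rewrite /preimage /=.
  by move=> [_ h]; case: (I_cases t) => h'; [rewrite susp_r_end|rewrite (susp_r_in _ _ h')].
by case: (I_cases t) => h; [split=> //; lra|rewrite (susp_r_in _ _ h)].
Qed.

Lemma pole_belt_open (P : set G) : OG P -> OG [set g | P (inv g)] -> forall P', (P' = P \/ P' = [set g | P (inv g)]) ->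
  popens (susp X) [set z | [/\ pole_chart.1 z, belt_chart.1 z & P' (pole_fun z)]].
Proof.
move=> hP hP' P' eP'; have oP' : OG P' by case: eP' => ->.
have [tX1 _ _] := tX.
apply: top_local susp_top _ => -[[x s]|[_ []//]] [/= hs _ Pz].
case: s hs Pz => s [s0 s1] /= hs; case: Rlt_dec => h Pz.
  exists (slab setT 0 (/ 2)); split=> //; first by apply: slab_open => //; lra.
  by move=> [[x' s']|//] /= [_ hs']; split=> //; [lra|case: Rlt_dec => //=; lra].
exists (slab (q @^-1` P') (/ 2) 1); split=> /=.
- by apply: slab_open; [exact: cq|lra|lra].
- by split=> //; lra.
- by move=> [[x' s']|//] /= [qx hs']; split=> //; [lra|case: Rlt_dec => //=; lra].
Qed.

Lemma belt_open : popens (susp X) belt_chart.1.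
Proof.
have [tX1 _ _] := tX; have := slab_open setT 0 1 tX1 (Rle_refl _) (Rle_refl _).
congr (popens (susp X) _); apply/seteqP; split=> -[[x [s hs]]|] //=.
Qed.

(** The point where q must be constant along paths of X: a path in the overlap stays on one side of
    the level 1/2 and projects to a path in X. *)
Lemma pole_path (g : I -> susp X) : cont opI (popens (susp X)) g ->
  (forall t, pole_chart.1 (g t) /\ belt_chart.1 (g t)) -> pole_fun (g I0) = pole_fun (g I1).
Proof.
move=> cg hg.
have some t : exists xs, g t = Some xs.
  by have [_] := hg t; rewrite /=; case: (g t) => // xs _; exists xs.
have [f hf] := choice some; have [tX1 _ _] := tX.
have cf : cont opI (sopens X) (fun t => (f t).1).
  move=> O hO t Ot; have [|d d0 hd] := cg _ (slab_open O 0 1 hO (Rle_refl _) (Rle_refl _)) t.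
    move: Ot; rewrite /preimage /= hf; case: (f t) => x [s [h0 h1]] Ox; split=> //=; lra.
  exists d => // y /hd; rewrite /preimage /= hf; case: (f y) => x s /= [].
  by [].
have side : (proj1_sig (f I0).2 < / 2) = (proj1_sig (f I1).2 < / 2).
  apply: (locconst_I (fun t => proj1_sig (f t).2 < / 2)) => t.
  have [ht _] := hg t; rewrite hf /= in ht.
  case: (f t) (hf t) ht => x s ft ht /=.
  case: (Rlt_dec (proj1_sig s) (/ 2)) => h.
    have [|d d0 hd] := cg _ (slab_open setT 0 (/ 2) tX1 (Rle_refl _) ltac:(lra)) t.
      by rewrite /preimage /= ft; case: s {ft ht} h => s [? ?] /= ?; split=> //; lra.
    exists d => // y /hd; rewrite /preimage /= hf; case: (f y) => x' s' /= [_ hs'].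
    by apply/propext; split; lra.
  have [|d d0 hd] := cg _ (slab_open setT (/ 2) 1 tX1 ltac:(lra) (Rle_refl _)) t.
    by rewrite /preimage /= ft; case: s {ft} ht h => s [? ?] /= ht h; split=> //; lra.
  exists d => // y /hd; rewrite /preimage /= hf; case: (f y) => x' s' /= [_ hs'].
  by apply/propext; split; lra.
rewrite !hf /=; have := qpath _ cf; move: side.
case: (f I0) => x0 s0; case: (f I1) => x1 s1 /= side qe.
by case: Rlt_dec => h0; case: Rlt_dec => h1 //; [case: h1; rewrite -side|case: h0; rewrite side].
Qed.

Lemma susp_flat : flat (susp X) susp_charts.
Proof.
have [tG cm cinv] : [/\ is_top OG, cont (prod_opens OG OG) OG (fun p => p.1 ** p.2) & cont OG OG inv].
  by case: hG => _ [].
have ie := g_inv1 _ _ _ _ _ hG.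
have vv x : inv x ** x = e by exact: (gVl _ _ _ _ _ hG).
have const_open c (P : Prop) : popens (susp X) c ->
    popens (susp X) [set y | [/\ c y, c y & P]].
  move=> hc; case: (pselect P) => hP.
    by congr (popens (susp X) _): hc; apply/seteqP; split=> // y [].
  by apply: top_local susp_top _ => y [].
split.
- exact: susp_top.
- by move=> c [->|->]; [exact: pole_open|exact: belt_open].
- by move=> [[x s]|]; [exists belt_chart; [right|]|exists pole_chart; [left|]].
- move=> c c' W [->|->] [->|->] hW /=.
  + have := const_open _ (W e) pole_open; congr (popens (susp X) _).
    by apply/seteqP; split=> y [] ? ? h; split=> //; move: h; rewrite vv.
  + have := pole_belt_open W hW (cinv _ hW) _ (or_intror erefl).
    congr (popens (susp X) _); apply/seteqP.
    by split=> y [] ? ? h; split=> //; move: h; rewrite (g1r _ _ _ _ _ hG).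
  + have := pole_belt_open W hW (cinv _ hW) _ (or_introl erefl).
    congr (popens (susp X) _); apply/seteqP.
    by split=> y [] ? ? h; split=> //; move: h; rewrite ie (g1l _ _ _ _ _ hG).
  + have := const_open _ (W e) belt_open; congr (popens (susp X) _).
    by apply/seteqP; split=> y [] ? ? h; split=> //; move: h; rewrite vv.
- move=> c c' g [->|->] [->|->] cg hg; rewrite ?vv //=.
  + by rewrite (pole_path g cg).
  + by rewrite (pole_path g cg) // => t; have [] := hg t.
Qed.

(** The lift jumps only at t = 1. The belt chart omits that end, and in the pole chart the jump of L
    to q x is balanced by the drop of [pole_fun] from q x to e. *)
Lemma meridian_lift x : @flift G mul (susp X) susp_charts mI (meridian_fun x)
  (fun t => if Rlt_dec (proj1_sig t) 1 then e else q x).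
Proof.
have oe := g1l _ _ _ _ _ hG; have eo := g1r _ _ _ _ _ hG.
have val (t : I) : (if Rlt_dec (proj1_sig t) 1 then e else q x) ** pole_fun (meridian_fun x t) =
    if Rlt_dec (proj1_sig t) (/ 2) then e else q x.
  have ht := proj2_sig t; rewrite /= in ht.
  case: (I_cases t) => h.
    by rewrite /meridian_fun susp_r_end //=; do 2 case: Rlt_dec => ? /=; rewrite ?oe ?eo //; lra.
  rewrite /meridian_fun (susp_r_in _ _ h) /=; case: Rlt_dec => ? /=; last lra.
  exact: oe.
move=> t c [->|->] /= hc.
  have ht : proj1_sig t <> / 2.
    case: (I_cases t) => h; first lra.
    by move: hc; rewrite /meridian_fun (susp_r_in _ _ h).
  exists (Rabs (proj1_sig t - / 2)); first by apply: Rabs_pos_lt; lra.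
  move=> s hs; rewrite !val.
  move: hs; rewrite /Rabs; do 2 case: Rcase_abs => ?; move=> hs; do 2 case: Rlt_dec => ? //=; exfalso; lra.
have [h|h] := I_cases t; first by move: hc; rewrite /meridian_fun susp_r_end.
exists (1 - proj1_sig t); first lra.
move=> s /Rabs_def2 /= hs; do 2 case: Rlt_dec => ? //=; exfalso; lra.
Qed.

Lemma meridian_hol x : hol G mul inv e (C := susp_charts) (meridian_fun x) = q x.
Proof.
have [cm _ _] := meridian_proof x.
rewrite (holE _ _ _ _ _ hG susp_flat _ _ cm (meridian_lift x)) /=.
case: Rlt_dec => h /=; last lra.
by case: Rlt_dec => h' /=; [lra|rewrite (g_inv1 _ _ _ _ _ hG) (g1l _ _ _ _ _ hG)].
Qed.

End Suspension.

(** * Every space as a quotient of a totally path-disconnected one *)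

Section Resolution.
Local Open Scope classical_set_scope.
Variables (G : Type) (OG : set (set G)).
Hypothesis tG : is_top OG.

(* Every space is the quotient, by res_map, of a totally path-disconnected space: for each x in G
   take a limit point (x, None) of isolated points (x, Some (g, n)) with (g, n) -> (x, oo). *)
Definition res_car : Type := (G * option (G * nat))%type.
Definition res_opens : set (set res_car) := fun U => forall x, U (x, None) ->
  exists N n0, [/\ OG N, N x & forall g n, N g -> (n0 <= n)%N -> U (x, Some (g, n))].
Definition res : space := Space res_car res_opens.
Definition res_map (p : res) : G := if p.2 is Some (g, n) then g else p.1.

Lemma res_top : is_top (sopens res).
Proof.
case: (tG) => t1 t2 t3; split.
- by move=> x _; exists setT, 0.
- move=> U V hU hV x [/hU [N [n [oN Nx hN]]] /hV [M [m [oM Mx hM]]]].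
  exists (N `&` M), (maxn n m); split=> //; first exact: t2.
  by move=> g l [Ng Mg]; rewrite geq_max => /andP[nl ml]; split; [apply: hN|apply: hM].
- move=> F hF x [U FU /(hF _ FU) [N [n [oN Nx hN]]]].
  by exists N, n; split=> // g l Ng nl; exists U => //; apply: hN.
Qed.

Lemma res_map_cts : cont (sopens res) OG res_map.
Proof. by move=> V hV x Vx; exists V, 0. Qed.

(** An open set around [(x, None)] contains [(x, Some (g, n))] for all g in a neighbourhood N of x
    and n large; these points map onto N. *)
Lemma res_map_quotient V : sopens res (res_map @^-1` V) -> OG V.
Proof.
move=> h; apply: top_local => // x Vx; have [N [n [oN Nx hN]]] := h x Vx.
by exists N; split=> // g Ng; exact: (hN g n Ng).
Qed.

Lemma clopen_path (S : set res) (g : I -> res) : sopens res S -> sopens res (~` S) ->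
  cont opI (sopens res) g -> S (g I0) = S (g I1).
Proof.
move=> oS oS' cg; apply: (locconst_I (fun t => S (g t))) => t.
case: (pselect (S (g t))) => St.
  by have [d d0 hd] := cg _ oS t St; exists d => // y /hd Sy; apply/propext.
have [d d0 hd] := cg _ oS' t St; exists d => // y /hd Sy; apply/propext.
by split=> // h; case: Sy.
Qed.

Lemma res_map_path (g : I -> res) : cont opI (sopens res) g -> res_map (g I0) = res_map (g I1).
Proof.
move=> cg; have [t1 _ _] := tG.
have first_ : (g I0).1 = (g I1).1.
  suff E : ((g I0).1 = (g I0).1) = ((g I1).1 = (g I0).1) by apply: esym; rewrite -E.
  by apply: (clopen_path [set p | p.1 = (g I0).1] g _ _ cg) => x /= xe; exists setT, 0.
(* The counter n makes each isolated point closed as well: the neighbourhood of a limit point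
   starting at n+1 omits it. A path thus cannot enter or leave an isolated point. *)
have iso x y n : (g I0 = (x, Some (y, n))) = (g I1 = (x, Some (y, n))).
  apply: (clopen_path [set p | p = (x, Some (y, n))] g _ _ cg) => //.
  by move=> x' _; exists setT, n.+1; split=> // y' n' _ nn [_ _ en]; rewrite en ltnn in nn.
case e0 : (g I0) first_ iso => [x0 [[y0 n0]|]] first_ iso.
  have E := iso x0 y0 n0.
  by have -> : g I1 = (x0, Some (y0, n0)) by rewrite -E.
case e1 : (g I1) first_ iso => [x1 [[y1 n1]|]] //= first_ iso.
by have := iso x1 y1 n1 => /esym E; have : (x0, None) = (x1, Some (y1, n1)) by rewrite -E.
Qed.

End Resolution.

(** * The tower of cell attachments and its union *)

Section Tower.
Local Open Scope classical_set_scope.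
Variables (G : Type) (OG : set (set G)) (mul : G -> G -> G) (inv : G -> G) (e : G).
Hypothesis hG : is_topgroup OG mul inv e.
Notation "x ** y" := (mul x y) (at level 40, left associativity).
Notation flat := (is_flat G OG mul inv).
Notation lift := (flift G mul).
Notation hol := (hol G mul inv e).

Record flat_space := FlatSpace {
  fs_car :> pspace;
  fs_charts : set (chart G fs_car);
  fs_flat : flat fs_car fs_charts }.
Arguments fs_charts : clear implicits.

Definition attach_all (Y : flat_space) (m : nat) : flat_space :=
  @FlatSpace (flattach G mul Y (fs_charts Y) m) (flattach_charts G mul e Y (fs_charts Y) m)
    (flattach_flat G OG mul inv e hG Y (fs_charts Y) m (fs_flat Y)).

Variable Y0 : flat_space.

(** The charts travel with the space because the next attaching maps are those liftable for them.
    Passing from stage n to stage n+1 attaches cells of dimension n+2, so stage 1 is the space with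
    2-cells. *)
Fixpoint tower n : flat_space := if n is n'.+1 then attach_all (tower n') n'.+2 else Y0.
Notation T := tower.
Notation ch n := (fs_charts (T n)).

Definition cells_at n : Type := (fsphere G mul (T n) (ch n) n.+2 * ball n.+2)%type.

Definition inc n (y : T n) : T n.+1 := inl y.

Lemma T_top n : is_top (popens (T n)). Proof. by have [] := fs_flat (T n). Qed.

Lemma inc_cts n : cont (popens (T n)) (popens (T n.+1)) (@inc n).
Proof. exact: inl_cts. Qed.

Lemma lift_inc n {K : mspace} (F : K -> T n) L :
  lift (ch n.+1) (fun p => inc n (F p)) L <-> lift (ch n) F L.
Proof. exact: lift_inl. Qed.

(* T n.+1 is by definition T n plus the open cells of stage n, so the union of the tower is
   T 0 plus all open cells. *)
Definition colim_car : Type := (T 0 + {n & cells_at n})%type.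

Fixpoint into n : T n -> colim_car :=
  match n return T n -> colim_car with
  | 0 => fun y => inl y
  | n'.+1 => fun z => match z with inl y => into n' y | inr d => inr (existT cells_at n' d) end
  end.

Definition colim : pspace :=
  @PSpace colim_car (fun U => forall n, popens (T n) (into n @^-1` U)) (inl (base Y0)).

Definition stage (w : colim_car) : nat := if w is inr (existT n _) then n.+1 else 0.

Lemma stage_into n y : (stage (into n y) <= n)%N.
Proof. by elim: n y => [|n IH] // [y|d] //=; exact: leqW. Qed.

Lemma into_inj n : injective (into n).
Proof.
elim: n => [y y' [] //|n IH] [y|d] [y'|d'] /=.
- by move=> /IH ->.
- by move=> h; have := stage_into n y; rewrite h /= ltnn.
- by move=> h; have := stage_into n y'; rewrite -h /= ltnn.
- move=> /(congr1 (fun w => if w is inr x then x else existT cells_at n d)) /= h.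
  by rewrite (inj_pair2_eq_dec _ PeanoNat.Nat.eq_dec _ _ _ _ h).
Qed.

Lemma into_up n m y : (n <= m)%N -> exists y', into m y' = into n y.
Proof.
elim: m => [|m IH]; first by rewrite leqn0 => /eqP n0; subst; exists y.
rewrite leq_eqVlt => /orP[/eqP nm|/IH [y' <-]]; first by subst; exists y.
by exists (inc m y').
Qed.

Lemma into_surj n w : (stage w <= n)%N -> exists y, into n y = w.
Proof.
case: w => [y|[m d]] h; first exact: (into_up 0 n y).
exact: (into_up m.+1 n (inr d)).
Qed.

Lemma colim_open N (U : set colim) :
  (forall n, (N <= n)%N -> popens (T n) (into n @^-1` U)) -> popens colim U.
Proof.
move=> h n; have [k] : exists k, (N <= n + k)%N by exists N; exact: leq_addl.
elim: k n => [|k IH] n hn; first by apply: h; rewrite -[n]addn0.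
by have := inc_cts n _ (IH n.+1 _); apply; rewrite addSnnS.
Qed.

Lemma colim_top : is_top (popens colim).
Proof.
split.
- by move=> n; have [] := T_top n.
- by move=> U V hU hV n; have [_ t _] := T_top n; exact: t (hU n) (hV n).
- move=> F hF n; apply: top_local (T_top n) _ => y [U FU Uy].
  by exists (into n @^-1` U); split=> [|//|y' ?]; [exact: hF|exists U].
Qed.

Lemma into_cts n : cont (popens (T n)) (popens colim) (into n).
Proof. by move=> U; exact. Qed.

Lemma into_base n : into n (base (T n)) = base colim.
Proof. by elim: n => //= n ->. Qed.

(** Each stage has the subspace topology of the union: an open set of stage n stays open when the
    open cells of all later stages are added. *)
Lemma into_cancel_cts n {K} (OK : set (set K)) (F : K -> T n) :
  cont OK (popens colim) (fun p => into n (F p) : colim) -> cont OK (popens (T n)) F.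
Proof.
move=> cF U hU.
suff hV : popens colim [set w | forall y, into n y = w -> U y].
  have := cF _ hV; congr (OK _); apply/seteqP; split=> p /=; first exact.
  by move=> Up y /into_inj ->.
apply: (colim_open n); elim=> [|m IH].
  rewrite leqn0 => /eqP n0; subst; congr (popens (T 0) _): hU; apply/seteqP.
  by split=> y => [Uy y' /into_inj -> //|]; apply.
rewrite leq_eqVlt => /orP[/eqP nm|nm].
  subst; congr (popens (T m.+1) _): hU; apply/seteqP.
  by split=> y => [Uy y' /into_inj -> //|]; apply.
have := with_cells_open (fphi_cts G mul (T m) (ch m) m.+2) _ (IH nm).
congr (popens (T m.+1) _); apply/seteqP; split=> -[y|d] //= _ y' ey.
by have := stage_into n y'; rewrite ey /= leqNgt nm.
Qed.

Lemma colim_closed_point w : (0 < stage w)%N -> popens colim [set w' | w' <> w].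
Proof.
case: w => [//|[n d]] _; apply: (colim_open n.+1); elim=> // m IH.
rewrite leq_eqVlt => /orP[/eqP [nm]|nm].
  subst; have : popens (T m.+1) [set b : T m.+1 | b <> inr (d.1, d.2)].
    exact: closed_cell_point (T_top m) _ _.
  congr (popens (T m.+1) _); apply/seteqP; split=> -[y|d'] //= h.
  - by move=> ey; have := stage_into m y; rewrite ey /= ltnn.
  - move=> /(congr1 (fun w => if w is inr x then x else existT cells_at m d)) /= ed.
    by apply: h; rewrite (inj_pair2_eq_dec _ PeanoNat.Nat.eq_dec _ _ _ _ ed); case: (d).
  - by move=> -[ed]; apply: h; rewrite ed -surjective_pairing.
have := with_cells_open (fphi_cts G mul (T m) (ch m) m.+2) _ (IH nm).
congr (popens (T m.+1) _); apply/seteqP; split=> -[y|d'] //= _.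
move=> /(congr1 stage) /= [em]; by rewrite em ltnn in nm.
Qed.

Lemma colim_avoid (z : nat -> colim) N m : (forall n, (n < stage (z n))%N) ->
  popens colim [set w | forall n, (N <= n < m)%N -> w <> z n].
Proof.
move=> hz; elim: m => [|m IH].
  have [t _ _] := colim_top; congr (popens colim _): t; apply/seteqP.
  by split=> // w _ n; rewrite ltn0 andbF.
have [_ t _] := colim_top.
have := t _ _ IH (colim_closed_point (z m) (leq_ltn_trans (leq0n m) (hz m))).
case: (leqP N m) => Nm; last first.
  move=> _; congr (popens colim _): IH; apply/seteqP.
  split=> w /= h n /andP[Nn nm]; apply: h; rewrite Nn /=.
    by move: nm; rewrite ltnS leq_eqVlt => /orP[/eqP nm|//]; rewrite leqNgt nm Nm in Nn.
  exact: leqW.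
congr (popens colim _); apply/seteqP; split=> w /=.
  move=> [h1 h2] n /andP[Nn]; rewrite ltnS leq_eqVlt => /orP[/eqP -> //|nm].
  by apply: h1; rewrite Nn.
move=> h; split=> [n /andP[Nn nm]|]; last by apply: h; rewrite Nm /=.
by apply: h; rewrite Nn leqW.
Qed.

(* Compactness: points in open cells of unboundedly many stages would form a closed
   discrete set. *)
Lemma cube_stage {k} (F : mC k -> colim) : cont (mopen (mC k)) (popens colim) F ->
  exists n, forall p, (stage (F p) <= n)%N.
Proof.
move=> cF; apply: contrapT => none.
have far n : exists p, (n < stage (F p))%N.
  apply: contrapT => h; apply: none; exists n => p.
  by rewrite leqNgt; apply/negP => ?; apply: h; exists p.
have [P hP] := choice far.
pose V N := [set w : colim | forall n, (N <= n)%N -> w <> F (P n)].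
have oV N : popens colim (V N).
  (* At stage m only the finitely many n < m matter, since [F (P n)] lies in a stage beyond n. *)
  move=> m; have := colim_avoid (fun n => F (P n)) N m hP m; congr (popens (T m) _).
  apply/seteqP; split=> y /= h n => [Nn ey|/andP[Nn _]]; last exact: h.
  have nm : (n < m)%N by apply: leq_trans (hP n) _; rewrite -ey; exact: stage_into.
  by apply: (h n) => //; rewrite Nn.
have [||p|N hN] := cube_cover (fun N p => V N (F p)).
- by move=> N M NM p h n Mn; apply: h; exact: leq_trans Mn.
- by move=> N; exact: (cF _ (oV N)).
- exists (stage (F p)) => n pn ep; have := hP n; rewrite -ep ltnNge.
  by rewrite pn.
- exact: (hN (P N) N (leqnn N)).
Qed.

Lemma factor_stage {k} (F : mC k -> colim) : cont (mopen (mC k)) (popens colim) F ->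
  exists n, forall m, (n <= m)%N ->
    exists2 F' : mC k -> T m, cont (mopen (mC k)) (popens (T m)) F' & forall p, into m (F' p) = F p.
Proof.
move=> cF; have [n hn] := cube_stage F cF; exists n => m nm.
have [F' hF'] := choice (fun p => into_surj m _ (leq_trans (hn p) nm)).
exists F' => //; apply: into_cancel_cts.
by rewrite (_ : (fun p => _) = F) //; apply/funext.
Qed.

Definition restrict n (c : chart G colim) : chart G (T n) :=
  (into n @^-1` c.1, fun y => c.2 (into n y)).

(** Only late restrictions are prescribed. This admits charts born at some stage, such as one that
    begins as the chart of the open cells just attached. *)
Definition colim_charts : set (chart G colim) :=
  [set c | exists N, forall n, (N <= n)%N -> ch n (restrict n c)].

(** Recursion along a dependent family started at an arbitrary n; the entries below n are the
    defaults d. *)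
Lemma thread (A : nat -> Type) (f : forall n, A n -> A n.+1) (d : forall n, A n) n (c : A n) :
  exists s : forall n, A n, s n = c /\ forall m, (n <= m)%N -> s m.+1 = f m (s m).
Proof.
elim: n A f d c => [|n IH] A f d c.
  exists (fix s m := if m is m'.+1 then f m' (s m') else c); by [].
have [s [sn hs]] := IH (fun n => A n.+1) (fun n => f n.+1) (fun n => d n.+1) c.
by exists (fun m => match m return A m with 0 => d 0 | m'.+1 => s m' end); split=> // -[//|m]; exact: hs.
Qed.

(** Iterating [ext_chart] does not change a chart on earlier points, so the successive extensions
    define one chart on the union. *)
Lemma chart_extends n (c : chart G (T n)) : ch n c ->
  exists2 c' : chart G colim, colim_charts c' & restrict n c' = c.
Proof.
move=> Cc.
have [s [sn hs]] := thread (fun m => chart G (T m))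
  (fun m => ext_chart G mul e (T m) (ch m) m.+2) (fun m => (set0, fun=> e)) n c.
have Cs m : (n <= m)%N -> ch m (s m).
  elim: m => [|m IH]; first by rewrite leqn0 => /eqP n0; subst.
  rewrite leq_eqVlt => /orP[/eqP nm|nm]; first by subst.
  by rewrite hs //; left; exists (s m) => //; exact: IH.
have compat m2 : forall m1 y1 y2, (n <= m1 <= m2)%N -> into m1 y1 = into m2 y2 ->
    (s m1).1 y1 = (s m2).1 y2 /\ (s m1).2 y1 = (s m2).2 y2.
  elim: m2 => [|m2 IH] m1 y1 y2 /andP[nm1].
    by rewrite leqn0 => /eqP m10; subst => /into_inj ->.
  rewrite leq_eqVlt => /orP[/eqP m12|]; first by subst => /into_inj ->.
  rewrite ltnS => m12; have nm2 := leq_trans nm1 m12; rewrite hs //.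
  case: y2 => [y2|d] /= ey; first by apply: IH => //; rewrite nm1.
  by have := stage_into m1 y1; rewrite ey /= leqNgt ltnS m12.
have compat' m1 m2 y1 y2 : (n <= m1)%N -> (n <= m2)%N -> into m1 y1 = into m2 y2 ->
    (s m1).1 y1 = (s m2).1 y2 /\ (s m1).2 y1 = (s m2).2 y2.
  move=> n1 n2 ey; case: (leqP m1 m2) => m12; first by apply: compat => //; rewrite n1.
  by have [|-> ->] := compat m1 m2 y2 y1 _ (esym ey); first by rewrite n2 ltnW.
have val w : exists v : Prop * G, forall m y, (n <= m)%N -> into m y = w ->
    (s m).1 y = v.1 /\ (s m).2 y = v.2.
  case: (pselect (exists my : {m & T m}, (n <= projT1 my)%N /\ into _ (projT2 my) = w)).
    move=> [[m y] /= [nm <-]]; exists ((s m).1 y, (s m).2 y) => m' y' nm' ey.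
    exact: compat'.
  by move=> ne; exists (False, e) => m y nm ey; case: ne; exists (existT _ m y).
have [v hv] := choice val.
have rs m : (n <= m)%N -> restrict m ((fun w => (v w).1), (fun w => (v w).2)) = s m.
  move=> nm; rewrite [RHS]surjective_pairing; congr pair; apply/funext => y /=;
    by have [E1 E2] := hv (into m y) m y nm erefl; rewrite ?E1 ?E2.
exists ((fun w => (v w).1), (fun w => (v w).2)); last by rewrite rs.
by exists n => m nm; rewrite rs //; exact: Cs.
Qed.

Lemma colim_flat : flat colim colim_charts.
Proof.
split.
- exact: colim_top.
- move=> c [N hN]; apply: (colim_open N) => n Nn.
  by have [_ op _ _ _] := fs_flat (T n); exact: (op _ (hN n Nn)).
- move=> w; have [y <-] := into_surj (stage w) w (leqnn _).
  have [_ _ cov _ _] := fs_flat (T (stage w)); have [c Cc cy] := cov y.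
  have [c' Cc' rc] := chart_extends _ c Cc; exists c' => //.
  by move: cy; rewrite -rc.
- move=> c c' W [N hN] [N' hN'] hW; apply: (colim_open (maxn N N')) => n; rewrite geq_max => /andP[Nn Nn'].
  by have [_ _ _ trans _] := fs_flat (T n); exact: (trans _ _ _ (hN n Nn) (hN' n Nn') hW).
- move=> c c' g [N hN] [N' hN'] cg hg.
  (* A path has compact image in the sense of [cube_stage], so it runs in one stage, chosen late
     enough for both charts to restrict to charts there. *)
  have [n hn] := factor_stage _ (cont_comp _ _ _ _ _ (mcts_cont _ (@mcts_chead 0)) cg).
  pose m := maxn n (maxn N N').
  have [F cF hF] := hn m (leq_maxl _ _).
  have Nm : (N <= m)%N by apply: leq_trans (leq_maxr _ _); exact: leq_maxl.
  have Nm' : (N' <= m)%N by apply: leq_trans (leq_maxr _ _); exact: leq_maxr.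
  have [_ _ _ _ path] := fs_flat (T m).
  have gE t : g t = into m (F (cube1 t)) by rewrite hF chead_cube1.
  have := path _ _ (fun t => F (cube1 t)) (hN m Nm) (hN' m Nm').
  rewrite /= -!gE; apply; first exact: cont_comp (mcts_cont _ mcts_cube1) cF.
  by move=> t; rewrite /preimage /= -!gE.
Qed.

(** A chart of the union is known to be a chart only from some stage N on, so F is first moved up N
    stages, which leaves its lift unchanged. *)
Lemma lift_into n {K : mspace} (F : K -> T n) L : lift (ch n) F L ->
  lift colim_charts (fun p => into n (F p) : colim) L.
Proof.
move=> hL p c [N hN] cp.
have [F' hF' hL'] : exists2 F' : K -> T (n + N), forall q, into (n + N) (F' q) = into n (F q) &
    lift (ch (n + N)) F' L.
  elim: N {hN} => [|N [F' h1 h2]].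
    by rewrite addn0; exists F.
  rewrite addnS; exists (fun q => inc _ (F' q)) => //.
  exact/lift_inc.
have [|d d0 hd] := hL' p _ (hN (n + N) (leq_addl _ _)).
  by rewrite /= hF'.
by exists d => // q /hd /=; rewrite !hF'.
Qed.

Lemma raise_stage {k} n m (F : mC k -> T n) : (n <= m)%N ->
  cont (mopen (mC k)) (popens (T n)) F -> (forall p, cbd p -> F p = base (T n)) ->
  exists F' : mC k -> T m, [/\ cont (mopen (mC k)) (popens (T m)) F',
    forall p, cbd p -> F' p = base (T m) &
    hrel (fun p => into n (F p) : colim) (fun p => into m (F' p))].
Proof.
move=> nm cF bF; have [F' hF'] := choice (fun p => into_up n m (F p) nm).
have ciF : cont (mopen (mC k)) (popens colim) (fun p => into n (F p)) by exact: cont_comp cF (into_cts n).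
exists F'; rewrite (_ : (fun p => into m (F' p)) = fun p => into n (F p)); last exact/funext.
split; last exact: hrel_refl.
  by apply: into_cancel_cts; rewrite (_ : (fun p => into m (F' p)) = fun p => into n (F p)) //; exact/funext.
by move=> p bp; apply: into_inj; rewrite hF' bF // !into_base.
Qed.

(** The bound on k says exactly that all cells attached after stage m have dimension greater than k,
    so the cube descends one stage at a time. *)
Lemma push_stage {k} n m (F : mC k -> T n) : (k < m.+2)%N ->
  cont (mopen (mC k)) (popens (T n)) F -> (forall p, cbd p -> F p = base (T n)) ->
  exists F' : mC k -> T m, [/\ cont (mopen (mC k)) (popens (T m)) F',
    forall p, cbd p -> F' p = base (T m) &
    hrel (fun p => into n (F p) : colim) (fun p => into m (F' p))].
Proof.
move=> km; elim: n F => [|n IH] F cF bF; first exact: raise_stage.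
case: (leqP n.+1 m) => nm; first exact: raise_stage.
have kn : (k < n.+2)%N by apply: leq_trans km _; rewrite ltnS.
have [p /bF bp|F1 cF1 h1] := push_off_cells (T_top n) (fphi_cts G mul (T n) (ch n) n.+2) F kn cF.
  by exists (base (T n)).
have bF1 p : cbd p -> F1 p = base (T n).
  by move=> bp; have := hrel_bd _ _ _ h1 bp; rewrite bF // => -[].
have [F' [cF' bF' h2]] := IH F1 cF1 bF1; exists F'; split=> //.
exact: hrel_trans (hrel_map (W' := colim) _ _ _ (into_cts n.+1) h1) h2.
Qed.

Lemma push_colim {k} m (F : mC k -> colim) : (k < m.+2)%N ->
  cont (mopen (mC k)) (popens colim) F -> (forall p, cbd p -> F p = base colim) ->
  exists F' : mC k -> T m, [/\ cont (mopen (mC k)) (popens (T m)) F',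
    forall p, cbd p -> F' p = base (T m) & hrel F (fun p => into m (F' p) : colim)].
Proof.
move=> km cF bF; have [n hn] := factor_stage F cF; have [F1 cF1 eF1] := hn n (leqnn n).
have [p bp|F' [cF' bF' h]] := push_stage n m F1 km cF1.
  by apply: into_inj; rewrite eF1 bF // into_base.
exists F'; split=> //; move: h; rewrite (_ : (fun p => into n (F1 p)) = F) //; exact/funext.
Qed.

(** The numbers fit tightly: a (k+2)-cube descends to stage k+1, and the next stage attaches cells
    of dimension k+3, those which [fill_trivial] uses. *)
Lemma colim_trivial k (F : mC k.+2 -> colim) : cont (mopen (mC k.+2)) (popens colim) F ->
  (forall p, cbd p -> F p = base colim) -> hrel F (fun=> base colim).
Proof.
move=> cF bF; have [F' [cF' bF' h]] := push_colim k.+1 F (ltnSn _) cF bF.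
have h' := fill_trivial _ _ _ _ _ hG (fs_flat (T k.+1)) F' cF' bF'.
have := hrel_map (W' := colim) _ _ _ (into_cts k.+2) h'.
by move=> h2; apply: hrel_trans h _; move: h2; rewrite /= into_base.
Qed.

End Tower.

(** * The topology on the fundamental group *)

Section FreeGroupTopology.
Local Open Scope classical_set_scope.
Variables (G : Type) (OG : set (set G)) (mul : G -> G -> G) (inv : G -> G) (e : G).
Hypothesis hG : is_topgroup OG mul inv e.
Notation "x ** y" := (mul x y) (at level 40, left associativity).

Definition letter_val (a : letter G) : G := if a.1 then a.2 else inv a.2.
Definition word_val (w : seq (letter G)) : G := foldr (fun a acc => letter_val a ** acc) e w.

Lemma mGE (u : FG G) : mG mul inv e u = word_val (proj1_sig u).
Proof. by []. Qed.

Lemma word_val_push a w : word_val (push G a w) = letter_val a ** word_val w.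
Proof.
case: w => [//|b w] /=; case: asboolP => // -[]; rewrite /letter_val.
case: a b => [s x] [s' y] /= -> ->; case: s => /=.
  by rewrite (gKV _ _ _ _ _ hG).
by rewrite (gK _ _ _ _ _ hG).
Qed.

Lemma word_val_reduce w : word_val (reduce G w) = word_val w.
Proof. by elim: w => //= a w IH; rewrite word_val_push IH. Qed.

Lemma word_val_cat u v : word_val (u ++ v) = word_val u ** word_val v.
Proof.
elim: u => /= [|a u ->]; first by rewrite (g1l _ _ _ _ _ hG).
exact: (gA _ _ _ _ _ hG).
Qed.

Lemma mG_mul u v : mG mul inv e (FG_mul G u v) = mG mul inv e u ** mG mul inv e v.
Proof. by rewrite !mGE word_val_reduce word_val_cat. Qed.

Lemma mG_inv u : mG mul inv e (FG_inv G u) = inv (mG mul inv e u).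
Proof.
rewrite !mGE word_val_reduce; elim: (proj1_sig u) => [|a w IH] /=.
  by rewrite (g_inv1 _ _ _ _ _ hG).
rewrite rev_cons -cats1 word_val_cat IH /= (g1r _ _ _ _ _ hG) (gVM _ _ _ _ _ hG).
congr (_ ** _); case: a => -[] x //=; rewrite /letter_val /=.
by apply: (gI _ _ _ _ _ hG (inv x)); rewrite (gVl _ _ _ _ _ hG) (gVr _ _ _ _ _ hG).
Qed.

Lemma mG_of x : mG mul inv e (FG_of G x) = x.
Proof. by rewrite mGE /= (g1r _ _ _ _ _ hG). Qed.

(** For a group topology OG, pulling back along [mG] gives a group topology on the free group with
    continuous generators, hence one inclusion. Conversely the generator map is a continuous section
    of [mG]. *)
Lemma tau_fixed (O : set (set G)) : O `<=` OG -> OG `<=` O ->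
  forall U, OG U <-> tau_opens mul inv e O U.
Proof.
have tG := OG_top _ _ _ _ _ hG; have [t1 t2 t3] := tG.
have cinv : cont OG OG inv by case: hG => _ [].
move=> OOG OGO U; split=> hU.
  pose m := mG mul inv e.
  pose P := [set V : set (FG G) | exists2 U', OG U' & V = m @^-1` U'].
  have tP : is_top P.
    split; first by exists setT.
    - by move=> _ _ [V hV ->] [V' hV' ->]; exists (V `&` V'); first exact: t2.
    - move=> F hF; exists (\bigcup_(V in [set V | OG V /\ F (m @^-1` V)]) V).
        by apply: t3 => V [].
      apply/seteqP; split=> [w [V FV Vw]|w [V [_ FV] Vw]]; last by exists (m @^-1` V).
      have [V' hV' eV] := hF _ FV; exists V'; first by split=> //; rewrite -eV.
      by rewrite eV in Vw.
  apply: (@sub_gen (FG G)); exists P; split; last by exists U.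
    split=> //.
      move=> _ [V hV ->]; apply/prod_opensP => // u v; rewrite /preimage /= /m mG_mul => Vuv.
      have [W1 [W2 [hW1 hW2 Wu Wv hW]]] := OG_mul _ _ _ _ _ hG _ _ _ hV Vuv.
      exists (m @^-1` W1), (m @^-1` W2); split=> //; [by exists W1|by exists W2|].
      by move=> u' v' ? ?; rewrite mG_mul; apply: hW.
    move=> _ [V hV ->]; exists (inv @^-1` V); first exact: cinv.
    by apply/seteqP; split=> u; rewrite /preimage /= /m mG_inv.
  move=> _ [V hV ->]; apply: OGO; rewrite (_ : _ @^-1` _ = V) //.
  by apply/seteqP; split=> x; rewrite /preimage /= /m mG_of.
have -> : U = FG_of G @^-1` (mG mul inv e @^-1` U).
  by apply/seteqP; split=> x; rewrite /preimage /= mG_of.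
apply: (hU [set V | OG (FG_of G @^-1` V)]); last first.
  by move=> V [O1 [_ cO OV]]; apply: OOG; exact: cO.
split=> //= [V V' hV hV'|F hF]; first exact: t2.
rewrite preimage_bigcup.
have -> : \bigcup_(V in F) (FG_of G @^-1` V) =
    \bigcup_(V in [set V | exists2 V', F V' & V = FG_of G @^-1` V']) V.
  apply/seteqP; split=> [x [V FV Vx]|x [_ [V FV ->] Vx]]; last by exists V.
  by exists (FG_of G @^-1` V) => //; exists V.
by apply: t3 => _ [V FV ->]; exact: hF.
Qed.

End FreeGroupTopology.

(** * Holonomy as an isomorphism of topological groups *)

Section Fundamental.
Local Open Scope classical_set_scope.
Variables (G : Type) (OG : set (set G)) (mul : G -> G -> G) (inv : G -> G) (e : G).
Hypothesis hG : is_topgroup OG mul inv e.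
Notation "x ** y" := (mul x y) (at level 40, left associativity).
Notation flat := (is_flat G OG mul inv).
Notation lift := (flift G mul).
Notation hol C := (@hol G mul inv e _ C).
Context {Y W : pspace} {C : set (chart G Y)} {CW : set (chart G W)}.
Hypothesis (hC : flat Y C) (hW : flat W CW).
Variables (X : space) (q : X -> G) (l : X -> loop Y).
Hypothesis (tX : is_top (sopens X)) (cl : cont (sopens X) (popens (Omega Y)) l).
Hypothesis (hl : forall x, hol C (proj1_sig (l x)) = q x).
Hypothesis (surj : forall g, exists x, q x = g).
Hypothesis (quot : forall V, sopens X (q @^-1` V) -> OG V).
Notation A := (flattach G mul Y C 2).
Variable (i : A -> W).
Hypothesis (ci : cont (popens A) (popens W) i) (bi : i (base A) = base W).
Notation i0 := (fun y : Y => i (inl y)).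
Hypothesis (li : forall (K : mspace) (F : K -> Y) L, lift C F L -> lift CW (fun p => i0 (F p)) L).
Hypothesis (push : forall F : mC 1 -> W, cont (mopen (mC 1)) (popens W) F ->
  (forall p, cbd p -> F p = base W) ->
  exists F' : mC 1 -> Y, [/\ cont (mopen (mC 1)) (popens Y) F',
    forall p, cbd p -> F' p = base Y & hrel F (fun p => i0 (F' p))]).

Let ci0 : cont (popens Y) (popens W) i0.
Proof. by apply: cont_comp ci; exact: inl_cts. Qed.

Let map_loop_proof (a : loop Y) : is_loop (fun t => i0 (proj1_sig a t)).
Proof.
have [ca a0 a1] := proj2_sig a; split; first exact: cont_comp ca ci0.
  by rewrite a0.
by rewrite a1.
Qed.

Let map_loop (a : loop Y) : loop W := exist _ _ (map_loop_proof a).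

Lemma hol_map (a : loop Y) : hol CW (proj1_sig (map_loop a)) = hol C (proj1_sig a).
Proof.
have [ca _ _] := proj2_sig a; have [cb _ _] := map_loop_proof a.
have [L hL] := flift_I _ _ _ _ _ hG hC _ ca.
by rewrite (holE _ _ _ _ _ hG hW _ _ cb (li _ _ _ hL)) (holE _ _ _ _ _ hG hC _ _ ca hL).
Qed.

Lemma loop_deform (a : loop W) : exists b : loop Y, homotopic a (map_loop b).
Proof.
have [ca a0 a1] := proj2_sig a.
have [|p|F' [cF' bF' h]] := push (fun p => proj1_sig a (chead p)).
- exact: cont_comp (mcts_cont _ mcts_chead) ca.
- by rewrite -{1}(cube1K p) => /cbd_cons [->|[->|[[]//]]].
have hb : is_loop (fun t => F' (cube1 t)).
  split; first exact: cont_comp (mcts_cont _ mcts_cube1) cF'.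
    by apply: bF'; apply/cbd_cons; left.
  by apply: bF'; apply/cbd_cons; right; left.
exists (exist _ _ hb); apply/hrel_homotopic; move: h; congr (hrel _ _).
by apply/funext => p /=; rewrite cube1K.
Qed.

(** Both lifts are translated to start at e; equal holonomies then mean equal end values, which is
    the matching condition of [fill_cube] for a 2-cell. *)
Lemma hol_inj (a b : loop Y) : hol C (proj1_sig a) = hol C (proj1_sig b) ->
  homotopic (map_loop a) (map_loop b).
Proof.
have [ca a0 a1] := proj2_sig a; have [cb b0 b1] := proj2_sig b.
have [La hLa] := flift_I _ _ _ _ _ hG hC _ ca; have [Lb hLb] := flift_I _ _ _ _ _ hG hC _ cb.
rewrite (holE _ _ _ _ _ hG hC _ _ ca hLa) (holE _ _ _ _ _ hG hC _ _ cb hLb) => E.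
have cc (f : I -> Y) : cont opI (popens Y) f ->
    cont (mopen (mC 1)) (popens Y) (fun p => f (chead p)).
  by move=> cf; exact: cont_comp (mcts_cont _ mcts_chead) cf.
have lc (f : I -> Y) L : lift (K := mI) C f L ->
    lift C (fun p : mC 1 => f (chead p)) (fun p => inv (L I0) ** L (chead p)).
  by move=> hL; apply: (flift_mul _ _ _ _ _ hG); exact: flift_comp mcts_chead hL.
have := fill_cube _ _ _ _ _ _ (cc _ ca) (cc _ cb) (lc _ _ hLa) (lc _ _ hLb).
move=> h; apply/hrel_homotopic; apply: (hrel_map i _ _ ci); apply: h => p.
rewrite -{1}(cube1K p) => /cbd_cons [->|[->|[[]//]]].
  by rewrite a0 b0 !(gVl _ _ _ _ _ hG).
by rewrite a1 b1 E.
Qed.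

(** W is abstract so that the same argument covers the space with 2-cells, with i the identity, and
    the union of the tower, with i the inclusion of stage 1. Loops are compared in Y, where only
    holonomy has to be matched. *)
Lemma flat_iso : pi1tau_iso W OG mul inv e.
Proof.
pose h (a : loop W) := hol CW (proj1_sig a); exists h.
have hm x : h (map_loop (l x)) = q x by rewrite /h hol_map hl.
split.
- by move=> g; have [x <-] := surj g; exists (map_loop (l x)).
- move=> a b; split; last exact: (hol_homotopic _ _ _ _ _ hG hW).
  have [a' ha] := loop_deform a; have [b' hb] := loop_deform b.
  rewrite /h (hol_homotopic _ _ _ _ _ hG hW _ _ ha) (hol_homotopic _ _ _ _ _ hG hW _ _ hb).
  rewrite !hol_map => /hol_inj /hrel_homotopic hab; apply/hrel_homotopic.
  move/hrel_homotopic: ha => ha; move/hrel_homotopic: hb => hb.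
  exact: (hrel_trans _ _ _ ha (hrel_trans _ _ _ hab (hrel_sym _ _ hb))).
- by move=> a b c; exact: (hol_concat _ _ _ _ _ hG hW).
- apply: (tau_fixed _ _ _ _ _ hG) => V hV; last exact: (hol_cts _ _ _ _ _ hG hW _ hV).
  apply: quot.
  have cm : cont (sopens X) (popens (Omega W)) (fun x => map_loop (l x)).
    apply: cont_curry tX _; exact: cont_comp (cont_uncurry _ _ _ tX cl) ci0.
  have := cm _ hV; congr (sopens X _).
  by apply/seteqP; split=> x; rewrite /preimage /= hm.
Qed.

End Fundamental.

Theorem theorem4p9 :
  forall (G : Type) (OG : set (set G)) (mul : G -> G -> G) (inv : G -> G) (e : G),
    is_topgroup OG mul inv e ->
    exists (X : space) (J : Type) (phi : J -> sphere 2 -> susp X),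
      [/\ is_top (sopens X),
          forall j, cont (opS 2) (popens (susp X)) (phi j),
          pi1tau_iso (attach phi) OG mul inv e &
          exists (Zs : nat -> pspace) (incl : forall n, Zs n -> Zs n.+1)
                 (Z' : pspace) (iota : forall n, Zs n -> Z'),
            [/\ Zs 0 = attach phi,
                forall n, cell_attachment (incl n) (n + 3),
                is_colimit incl iota,
                pi1tau_iso Z' OG mul inv e &
                forall m, pi1_trivial (iter m.+1 Omega Z')]].
Proof.
move=> G OG mul inv e hG; have tG := OG_top _ _ _ _ _ hG.
pose X := res G OG; pose q := res_map G OG.
have tX : is_top (sopens X) by exact: res_top.
pose C0 := susp_charts X G e q.
have flat0 : is_flat G OG mul inv (susp X) C0.
  apply: susp_flat => //; first exact: res_map_cts.
  exact: res_map_path.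
have hl x : @hol G mul inv e _ C0 (proj1_sig (meridian X x)) = q x.
  apply: (meridian_hol _ _ _ OG) => //; first exact: res_map_cts.
  exact: res_map_path.
have surj g : exists x, q x = g by exists (g, None).
have quot := res_map_quotient G OG tG.
pose Y0 := FlatSpace G OG mul inv (susp X) C0 flat0.
pose T n := tower G OG mul inv e hG Y0 n.
pose Z := colim G OG mul inv e hG Y0.
pose io n := into G OG mul inv e hG Y0 n.
exists X, (fsphere G mul (susp X) C0 2), (fphi G mul (susp X) C0 2); split=> //.
- exact: fphi_cts.
- apply: (flat_iso _ _ _ _ _ hG flat0 (fs_flat _ _ _ _ (T 1)) X q _ tX (meridian_cts X tX) hl surj quot id) => //.
    by move=> K F L hL; apply/lift_inl.
  move=> F cF bF.
  have [p /bF bp|F' cF' h] := push_off_cells (susp_top X) (fphi_cts G mul (susp X) C0 2) F isT cF.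
    by exists (base (susp X)).
  exists F'; split=> // p bp; have := hrel_bd _ _ _ h bp; rewrite bF // => e1.
  by have /= [] := e1.
- exists (fun n => T n.+1), (fun n y => inc G OG mul inv e hG Y0 n.+1 y), Z, (fun n => io n.+1); split=> //.
  (* The filtration starts at stage 1, so its step n goes from stage n+1 to stage n+2 and attaches
     cells of dimension n+3. *)
  + move=> n; rewrite addn3; exists (fsphere G mul (T n.+1) (fs_charts _ _ _ _ (T n.+1)) n.+3).
    exists (fphi G mul (T n.+1) (fs_charts _ _ _ _ (T n.+1)) n.+3); split; first exact: fphi_cts.
    by exists id; split=> //; exists id; split.
  + split=> //.
    * by move=> n; exact: into_inj.
    * move=> w; case: w => [y|[n d]]; first by exists 0, (inl y).
      by exists n, (inr d).
    * move=> U; split=> [hU n|hU]; first exact: hU.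
      by apply: (colim_open _ _ _ _ _ _ _ 1) => -[//|n] _; exact: hU.
  + apply: (flat_iso _ _ _ _ _ hG flat0 (colim_flat _ _ _ _ _ _ _) X q _ tX (meridian_cts X tX) hl surj quot (io 1)) => //.
    * exact: (into_cts G OG mul inv e hG Y0 1).
    * by move=> K F L hL; exact: (lift_into G OG mul inv e hG Y0 0).
    * move=> F cF bF; have [F' [cF' bF' h]] := push_colim G OG mul inv e hG Y0 0 F isT cF bF.
      by exists F'.
  + move=> m; apply: omega_trivial => F cF bF; exact: colim_trivial.
Qed.
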